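(* Let $n\geq 1$, $\omega>0$, $s>\frac{n}{2}$, $0<\sigma<\frac{2s}{n}-1$, and let $\phi_\omega$ be the function with $\hat\phi_\omega(\xi)=\left(\int_{\mathbb R^n}\frac{d\eta}{(2\pi|\eta|)^{2s}+\omega}\right)^{-(1+\frac1{2\sigma})}\frac{1}{(2\pi|\xi|)^{2s}+\omega}$. Consider the Cauchy problem $$iu_t=((-\Delta)^s-|u|^{2\sigma}\delta_0)u,\quad (t,x)\in\mathbb R\times\mathbb R^n,\qquad u(0,\cdot)=g. \qquad ( * )$$ Assume the following. (1) (Global solutions and conservation laws near $\phi_\omega$) All initial data $g$ sufficiently close to $\phi_\omega$ in the $H^s(\mathbb R^n)$ norm generate a global in time solution $u_g$ of $( * )$, and for these solutions $M[u_g(t)]=M[g]$ and $E[u_g(t)]=E[g]$ for all $t>0$. (2) (Continuous dependence near $\phi_\omega$) There exists $T_0>0$ so that for all $\epsilon>0$ there exists $\delta>0$ such that whenever $\|g-\phi_\omega\|_{H^s}<\delta$, one has $\sup_{0<t<T_0}\|u_g(t,\cdot)-e^{i\omega t}\phi_\omega\|_{H^s}<\epsilon$. Then $e^{i\omega t}\phi_\omega$ is an orbitally stable solution of $( * )$: for every $\epsilon>0$ there exists $\delta=\delta(\epsilon)>0$ so that whenever $\|g-\phi_\omega\|_{H^s(\mathbb R^n)}<\delta$, the solution $u_g$ with initial data $g$ is global with $u_g(t,\cdot)\in H^s(\mathbb R^n)$ for all $t>0$, and $$\sup_{t>0}\inf_{\theta\in\mathbb R}\|u_g(t,\cdot)-e^{-i(\omega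 t+\theta)}\phi_\omega(\cdot)\|_{H^s(\mathbb R^n)}<\epsilon.$$
   Context: Fourier transform: $\hat f(\xi)=\int_{\mathbb R^n} f(x)e^{-2\pi i x\cdot\xi}dx$; $\widehat{(-\Delta)^s f}(\xi)=(2\pi|\xi|)^{2s}\hat f(\xi)$; $\|f\|_{H^s}=\|(-\Delta)^{s/2}f\|_{L^2}+\|f\|_{L^2}$. For $s>n/2$, $H^s(\mathbb R^n)\subset C(\mathbb R^n)$, so point values at $0$ make sense. The function $\phi_\omega$ satisfies $(-\Delta)^s\phi+\omega\phi-|\phi(0)|^{2\sigma}\phi(0)\delta_0=0$ weakly. A global solution of $( * )$ means $u\in C([0,\infty);H^s(\mathbb R^n))$ (complex-valued) satisfying, for all test functions $\psi(t,x)$ and all $t>0$, $$i\Big(\langle u(t,\cdot),\psi(t,\cdot)\rangle-\langle g,\psi(0,\cdot)\rangle-\int_0^t\langle u(\tau,\cdot),\partial_\tau\psi(\tau,\cdot)\rangle d\tau\Big)=\int_0^t\langle(-\Delta)^{s/2}u(\tau,\cdot),(-\Delta)^{s/2}\psi(\tau,\cdot)\rangle d\tau-\int_0^t|u(\tau,0)|^{2\sigma}u(\tau,0)\psi(\tau,0)d\tau,$$ with $\langle f,h\rangle=\int_{\mathbb R^n}fh\,dx$. Mass and energy: $M[u]=\int_{\mathbb R^n}|u|^2dx$ and $E[u]=\frac12\|(-\Delta)^{s/2}u\|_{L^2}^2-\frac1{2\sigma+2}|u(0)|^{2\sigma+2}$. *)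

(* Defs.v *)
From HB Require Import structures.
From mathcomp Require Import all_boot all_order all_algebra.
From mathcomp Require Import complex.
From mathcomp Require Import all_classical all_reals all_analysis.

Set Implicit Arguments.
Unset Strict Implicit.
Unset Printing Implicit Defensive.

Import Order.TTheory GRing.Theory Num.Theory.
Import numFieldNormedType.Exports.

Local Open Scope classical_set_scope.
Local Open Scope ring_scope.

Section measurable_row.
Context (R : realType) (n : nat).

Let coord (i : 'I_n) (x : 'rV[R]_n) : measurableTypeR R := x 0 i.

Let row_set0 : g_sigma_preimage coord set0.
Proof. exact: sigma_algebra0. Qed.

Let row_setC A : g_sigma_preimage coord A -> g_sigma_preimage coord (~` A).
Proof. exact: sigma_algebraC. Qed.

Let row_bigcup (F : _^nat) : (forall i, g_sigma_preimage coord (F i)) ->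
  g_sigma_preimage coord (\bigcup_i (F i)).
Proof. exact: sigma_algebra_bigcup. Qed.

HB.instance Definition _ :=
  @isMeasurable.Build (measure_tuple_display default_measure_display)
    'rV[R]_n (g_sigma_preimage coord) row_set0 row_setC row_bigcup.

Lemma measurable_fun_rowP d (T : measurableType d) (f : T -> 'rV[R]_n) :
  measurable_fun [set: T] f <->
  forall i, measurable_fun [set: T] (fun x => f x 0 i : measurableTypeR R).
Proof.
apply: (@iff_trans _ (g_sigma_preimage (fun i => coord i \o f) `<=` measurable)).
  rewrite g_sigma_preimage_comp; split=> [mf A [/= C preC <-]|prefS].
    exact: mf.
  by move=> _ A mA; apply: prefS; exists A.
split=> [fS i|mf].
- move=> _ A mA; apply: fS; apply: sub_sigma_algebra.
  rewrite -bigcup_seq/=; exists i => /=; first by rewrite mem_index_enum.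
  by exists A.
- apply: smallest_sub; first exact: sigma_algebra_measurable.
  rewrite -bigcup_seq/=; apply: bigcup_sub => i _.
  by move=> A [B mB <-]; exact: mf.
Qed.

Lemma measurable_coord (i : 'I_n) :
  measurable_fun [set: 'rV[R]_n] (fun x => x 0 i : measurableTypeR R).
Proof.
have [h _] := @measurable_fun_rowP _ 'rV[R]_n idfun.
exact: h (@measurable_id _ _ _) i.
Qed.

End measurable_row.

Definition row_cons (R : realType) (n : nat) (p : measurableTypeR R * 'rV[R]_n) :
  'rV[R]_n.+1 := \row_i oapp (p.2 0) p.1 (unlift ord0 i).

Definition row_uncons (R : realType) (n : nat) (x : 'rV[R]_n.+1) :
  measurableTypeR R * 'rV[R]_n := (x 0 ord0, \row_i x 0 (lift ord0 i)).

Lemma row_consK (R : realType) (n : nat) :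
  cancel (@row_cons R n) (@row_uncons R n).
Proof.
move=> [a x]; rewrite /row_uncons /row_cons mxE unlift_none/=; congr pair.
by apply/rowP => i; rewrite !mxE liftK.
Qed.

Lemma measurable_row_cons (R : realType) (n : nat) :
  measurable_fun [set: measurableTypeR R * 'rV[R]_n] (@row_cons R n).
Proof.
apply/measurable_fun_rowP => i.
under eq_fun do rewrite mxE.
case: unliftP => [j _|_] /=; last exact: measurable_fst.
apply: (@measurableT_comp _ _ _ _ _ _ (fun x : 'rV[R]_n => x 0 j)) => //.
exact: measurable_coord.
Qed.

Lemma measurable_row_uncons (R : realType) (n : nat) :
  measurable_fun [set: 'rV[R]_n.+1] (@row_uncons R n).
Proof.
apply/measurable_fun_pair => /=; first exact: measurable_coord.
apply/measurable_fun_rowP => i; under eq_fun do rewrite mxE.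
exact: measurable_coord.
Qed.

Section lebesgue_row_succ.
Context (R : realType) (n : nat).
Variable mu : {sigma_finite_measure set 'rV[R]_n -> \bar R}.

Definition lebesgue_succ : set 'rV[R]_n.+1 -> \bar R :=
  pushforward (@lebesgue_measure R \x mu)%E (@row_cons R n).

Let succ0 : lebesgue_succ set0 = 0%E.
Proof. by rewrite /lebesgue_succ /pushforward preimage_set0 measure0. Qed.

Let succ_ge0 A : (0 <= lebesgue_succ A)%E.
Proof. by rewrite /lebesgue_succ /pushforward; exact: measure_ge0. Qed.

Let succ_sigma_additive : semi_sigma_additive lebesgue_succ.
Proof.
move=> F mF tF mUF; rewrite /lebesgue_succ /pushforward preimage_bigcup.
have mcons A : measurable A -> measurable (@row_cons R n @^-1` A).
  by move=> mA; rewrite -[X in measurable X]setTI; exact: measurable_row_cons.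
apply: measure_semi_sigma_additive.
- by move=> k; apply: mcons; exact: mF.
- apply/trivIsetP => /= i j _ _ ij; rewrite -preimage_setI.
  by move/trivIsetP : tF => /(_ _ _ _ _ ij) ->//; rewrite preimage_set0.
- by rewrite -preimage_bigcup; exact: mcons.
Qed.

HB.instance Definition _ :=
  isMeasure.Build _ _ _ lebesgue_succ succ0 succ_ge0 succ_sigma_additive.

Let succ_sigma_finite : sigma_finite setT lebesgue_succ.
Proof.
have /sigma_finiteP[F [TF ndF Foo]] := sigma_finiteT (@lebesgue_measure R).
have /sigma_finiteP[G [TG ndG Goo]] := sigma_finiteT mu.
exists (fun k => @row_uncons R n @^-1` (F k `*` G k)).
  rewrite -preimage_bigcup (_ : \bigcup_k _ = setT) ?preimage_setT//.
  rewrite -setXTT TF TG predeqE => -[x y]; split; first by move=> [k _ []]; split; exists k.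
  move=> [/= [i _ Fix] [j _ Gjy]]; exists (maxn i j) => //; split.
  - by move: x Fix; exact/subsetPset/ndF/leq_maxl.
  - by move: y Gjy; exact/subsetPset/ndG/leq_maxr.
move=> k; have [mF Fk] := Foo k; have [mG Gk] := Goo k; split.
  rewrite -[X in measurable X]setTI; apply: measurable_row_uncons => //.
  exact: measurableX.
rewrite /lebesgue_succ /pushforward -comp_preimage.
rewrite (_ : _ \o _ = idfun); last by apply/funext => p /=; rewrite row_consK.
by rewrite preimage_id product_measure1E// lte_mul_pinfty// ge0_fin_numE.
Qed.

HB.instance Definition _ :=
  Measure_isSigmaFinite.Build _ _ _ lebesgue_succ succ_sigma_finite.

End lebesgue_row_succ.

Fixpoint lebesgue_row (R : realType) (n : nat) :
    {sigma_finite_measure set 'rV[R]_n -> \bar R} :=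
  match n with
  | 0 => \d_(0 : 'rV[R]_0)
  | n'.+1 => lebesgue_succ (lebesgue_row R n')
  end.

Lemma lebesgue_row_box (R : realType) (n : nat)
    (A : 'I_n -> set (measurableTypeR R)) :
  (forall i, measurable (A i)) ->
  lebesgue_row R n [set x | forall i, A i (x 0 i)] =
  (\prod_(i < n) (@lebesgue_measure R (A i)))%E.
Proof.
elim: n A => [|n IHn] A mA.
  by rewrite big_ord0/= diracE mem_set// => -[].
rewrite big_ord_recl -IHn//= /lebesgue_succ /pushforward.
rewrite -product_measure1E//=.
  congr (_ _); apply/seteqP; split => [[a x] /= Ax|[a x] /= [Aa Ax] i].
    split; first by have := Ax ord0; rewrite mxE unlift_none.
    by move=> i; have := Ax (lift ord0 i); rewrite mxE liftK.
  by rewrite mxE; case: unliftP => [j ->|->].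
rewrite [X in measurable X](_ : _ =
    \bigcap_(i in [set: 'I_n]) ((fun x : 'rV[R]_n => x 0 i) @^-1` A (lift ord0 i))).
  apply: fin_bigcap_measurable => // i _.
  by rewrite -[X in measurable X]setTI; exact: measurable_coord.
by apply/seteqP; split => x /= Ax i => [_|]; exact: Ax.
Qed.

Section setting.
Context {R : realType}.

Local Notation Re := (@complex.Re R).
Local Notation Im := (@complex.Im R).
Local Notation cabs := (@ComplexField.Normc.normc R).

Definition expi (t : R) : R[i] := (cos t +i* sin t)%C.

Definition cintegral d (T : measurableType d) (mu : {measure set T -> \bar R})
    (D : set T) (f : T -> R[i]) : R[i] :=
  ((\int[mu]_(x in D) Re (f x)) +i* (\int[mu]_(x in D) Im (f x)))%C.

Section space.
Context {n : nat}.
Local Notation Rn := 'rV[R]_n.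
Local Notation mu := (lebesgue_row R n).
Implicit Types (f g h F : Rn -> R[i]) (s sigma : R).

Definition dotp (x y : Rn) : R := \sum_i x 0 i * y 0 i.

(* The library norm of a row vector is the sup norm. *)
Definition enorm (x : Rn) : R := Num.sqrt (dotp x x).

Definition L2norm f : \bar R := ('N[mu]_2%:E[EFin \o (cabs \o f)])%E.

Definition memL2 f : Prop :=
  [/\ measurable_fun setT (Re \o f), measurable_fun setT (Im \o f)
    & (L2norm f < +oo)%E].

Definition fourier_integral f (xi : Rn) : R[i] :=
  cintegral mu setT (fun x => f x * expi (- (2 * pi * dotp x xi))).

Definition truncate (r : R) f : Rn -> R[i] :=
  fun x => if enorm x <= r then f x else 0.

(* Fourier-Plancherel transform on L^2, where the integral need not converge
   absolutely: the L^2-limit of the transforms of the truncations, which are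
   integrable.  It determines F from f up to a null set, and conversely. *)
Definition is_fourier f F : Prop :=
  [/\ memL2 f, memL2 F &
    L2norm (fun xi => F xi - fourier_integral (truncate k%:R f) xi)
      @[k --> \oo] --> 0%E].

Definition is_fraclap (a : R) f h : Prop :=
  exists F, is_fourier f F /\
    is_fourier h (fun xi => ((2 * pi * enorm xi) `^ (2 * a))%:C%C * F xi).

(* (-Delta)^a f, as an arbitrary representative of its class in L^2 (and 0 if
   there is no such class); all the uses below depend on the class only. *)
Definition fraclap (a : R) f : Rn -> R[i] := xget (fun=> 0) (is_fraclap a f).

(* H^s for s > n/2: every class has exactly one continuous representative,
   so elements are taken to be these representatives, making f 0 meaningful. *)
Definition Hs s f : Prop :=
  [/\ continuous (Re \o f), continuous (Im \o f), memL2 f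
    & exists h, is_fraclap (s / 2) f h].

(* Meaningful on Hs s only. *)
Definition Hsnorm s f : \bar R :=
  (L2norm (fraclap (s / 2) f) + L2norm f)%E.

Definition pairing f h : R[i] := cintegral mu setT (fun x => f x * h x).

Definition mass f : R := \int[mu]_x (cabs (f x) ^+ 2).

Definition energy s sigma f : R :=
  2^-1 * fine (L2norm (fraclap (s / 2) f)) ^+ 2
  - (2 * sigma + 2)^-1 * cabs (f 0) `^ (2 * sigma + 2).

(* All iterated directional derivatives exist and are continuous. *)
Definition smooth (V : normedModType R) (f : V -> R) : Prop :=
  forall vs : seq V, let df := foldr (fun v k => 'D_v k) f vs in
    continuous df /\ forall x v, derivable df x v.

Definition test_function (psi : R -> Rn -> R[i]) : Prop :=
  [/\ smooth (fun p : R * Rn => Re (psi p.1 p.2)),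
      smooth (fun p : R * Rn => Im (psi p.1 p.2))
    & compact (closure [set p : R * Rn | psi p.1 p.2 != 0])].

Definition dtime (psi : R -> Rn -> R[i]) (t : R) (x : Rn) : R[i] :=
  (derive1 (fun r => Re (psi r x)) t +i* derive1 (fun r => Im (psi r x)) t)%C.

Definition tintegral (t : R) (f : R -> R[i]) : R[i] :=
  cintegral (@lebesgue_measure R) `[0, t] f.

Definition Hs_continuous s (u : R -> Rn -> R[i]) : Prop :=
  (forall t, 0 <= t -> Hs s (u t)) /\
  forall t, 0 <= t ->
    Hsnorm s (fun x => u r x - u t x)
      @[r --> within [set r | 0 <= r] (nbhs t)] --> 0%E.

(* u 0 = g is not required separately: it follows by letting t tend to 0. *)
Definition global_solution s sigma g (u : R -> Rn -> R[i]) : Prop :=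
  Hs_continuous s u /\
  forall psi, test_function psi -> forall t, 0 < t ->
    'i%C * (pairing (u t) (psi t) - pairing g (psi 0)
            - tintegral t (fun tau => pairing (u tau) (dtime psi tau)))
    = tintegral t (fun tau =>
        pairing (fraclap (s / 2) (u tau)) (fraclap (s / 2) (psi tau)))
      - tintegral t (fun tau =>
          (cabs (u tau 0) `^ (2 * sigma))%:C%C * u tau 0 * psi tau 0).

Definition symbol s omega (xi : Rn) : R :=
  ((2 * pi * enorm xi) `^ (2 * s) + omega)^-1.

Definition standing_wave_hat s omega sigma (xi : Rn) : R[i] :=
  ((\int[mu]_eta symbol s omega eta) `^ (- (1 + (2 * sigma)^-1))
   * symbol s omega xi)%:C%C.

End space.
End setting.

(* Main.v *)
Require Import Defs.
From HB Require Import structures.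
From mathcomp Require Import all_boot all_order all_algebra.
From mathcomp Require Import complex.
From mathcomp Require Import all_classical all_reals all_analysis.
From mathcomp Require Import measurable_realfun.
From mathcomp Require Import ring lra.

(** Write [A(f)] for the square of the L^2 norm of [(-Delta)^(s/2) f], [M(f)] for the
mass and [N = A + omega M].  The transform of the wave [phi] is [C / (X + omega)],
where [X = (2 pi |xi|)^(2s)], so [phi] represents [C] times evaluation at the origin in
the form [N].  Completing the square gives, for every unimodular [l],
[N(f - l phi) = N(f) - 2 C Re (conj l * f(0)) + K] with [K = N(phi)] ([form_orbit]).  Choosing
[l] as the phase of [f(0)], the distance from [f] to the orbit of [phi] is controlled by
the three numbers [A(f)], [M(f)] and [|f(0)|].

Stability needs no compactness and no continuity in time: at each single time these
three numbers are confined by the conserved quantities.  The energy expresses [A] by [E]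
and [|f(0)|], so only [|f(0)|] is free.  It is restricted by the trace inequality
[|f(0)|^2 <= c(w) (A + w M)], valid for every frequency [w > 0], where [c(w)] is the
integral of [1 / (X + w)] ([trace_le]).  By homogeneity [c(tau omega)] is
[tau^(th - 1) c(omega)] with [th = n / (2s)] ([resolvent_mass_scale]), and the wave attains
equality at [w = omega], which determines [A(phi)] and [M(phi)] separately
([standing_wave_mass]).  Testing the inequality at the [tau] with
[tau^th = |f(0)|^2 / |phi(0)|^2], everything collapses to the statement that
[tau - 1 - (tau^a - 1) / a] is small relative to [1 + tau], where [a = th (sigma + 1)].
Subcriticality says exactly [a < 1], and then this gap in Bernoulli's inequality is
coercive at 1 ([gap_coercive], [scalar_stability]).  Hence [|f(0)|] is close to
[|phi(0)|], the form [N(f - l phi)] is small, and so is the H^s distance ([near_orbit]).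

That the rotating wave solves the equation is extracted from continuous dependence.
The solution with initial datum [phi] coincides with the rotating wave on a short time
interval; inserting products of a function of time and a slice of a test function into
the equation, and integrating by parts in time, yields the weak standing wave equation
for that slice ([local_wave_weak]).  Integrated back in time it gives the equation for
all times ([wave_parts], [wave_global_solution]).

The analytic input is Plancherel's theorem for the L^2 Fourier transform
([is_fourier_L2n], [parseval]), proved on the line with the Poisson kernel
([cont_comp_supp_isometric]), in R^n by induction on the dimension ([row_isometric]), and
extended by a closure argument ([isometric_closure]); inversion at the origin
([fourier_inversion0]); and the integrability of the symbol ([integrable_symbol]). *)

Set Implicit Arguments.
Unset Strict Implicit.
Unset Printing Implicit Defensive.

Import Order.TTheory GRing.Theory Num.Theory.
Import numFieldNormedType.Exports.

Local Open Scope classical_set_scope.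
Local Open Scope ring_scope.

Local Notation Re := (@complex.Re _).
Local Notation Im := (@complex.Im _).
Local Notation cabs := (@ComplexField.Normc.normc _).
Local Notation rc := (@real_complex _).

(** * Complex arithmetic *)

Section complex_arithmetic.
Context {R : realType}.
Implicit Types (x y : R[i]) (a b t : R).

Lemma ReD x y : Re (x + y) = Re x + Re y.
Proof. by case: x y => [? ?] [? ?]. Qed.

Lemma ImD x y : Im (x + y) = Im x + Im y.
Proof. by case: x y => [? ?] [? ?]. Qed.

Lemma ReN x : Re (- x) = - Re x.
Proof. by case: x. Qed.

Lemma ImN x : Im (- x) = - Im x.
Proof. by case: x. Qed.

Lemma ReM x y : Re (x * y) = Re x * Re y - Im x * Im y.
Proof. by case: x y => [? ?] [? ?]. Qed.

Lemma ImM x y : Im (x * y) = Re x * Im y + Im x * Re y.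
Proof. by case: x y => [? ?] [? ?]. Qed.

Lemma ReJ x : Re (conjc x) = Re x.
Proof. by case: x. Qed.

Lemma ImJ x : Im (conjc x) = - Im x.
Proof. by case: x. Qed.

Definition ReImE := (ReD, ImD, ReN, ImN, ReM, ImM, ReJ, ImJ).

Lemma complex_ext x y : Re x = Re y -> Im x = Im y -> x = y.
Proof. by case: x y => [? ?] [? ?] /= -> ->. Qed.

Lemma sqr_cabs x : cabs x ^+ 2 = Re x ^+ 2 + Im x ^+ 2.
Proof. by case: x => a b /=; rewrite sqr_sqrtr// addr_ge0// sqr_ge0. Qed.

Lemma cabs_ge0 x : 0 <= cabs x.
Proof. by case: x => a b; exact: sqrtr_ge0. Qed.

Lemma cabsM x y : cabs (x * y) = cabs x * cabs y.
Proof. exact: ComplexField.Normc.normcM. Qed.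

Lemma cabsD x y : cabs (x + y) <= cabs x + cabs y.
Proof. exact: le_normcD. Qed.

Lemma cabsN x : cabs (- x) = cabs x.
Proof. exact: normcN. Qed.

Lemma cabs0 : cabs (0 : R[i]) = 0.
Proof. exact: ComplexField.Normc.normc0. Qed.

Lemma cabs1 : cabs (1 : R[i]) = 1.
Proof. exact: ComplexField.Normc.normc1. Qed.

Lemma cabs_eq0 x : cabs x = 0 -> x = 0.
Proof. exact: ComplexField.Normc.eq0_normc. Qed.

Lemma cabsJ x : cabs (conjc x) = cabs x.
Proof. by case: x => a b /=; rewrite sqrrN. Qed.

Lemma cabs_real a : cabs (rc a) = `|a|.
Proof. by rewrite /= expr0n/= addr0 sqrtr_sqr. Qed.

Lemma Re_le_cabs x : `|Re x| <= cabs x.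
Proof.
rewrite -(@ler_pXn2r _ 2)// ?nnegrE ?cabs_ge0//.
by rewrite sqr_cabs real_normK ?num_real// lerDl sqr_ge0.
Qed.

Lemma Im_le_cabs x : `|Im x| <= cabs x.
Proof.
rewrite -(@ler_pXn2r _ 2)// ?nnegrE ?cabs_ge0//.
by rewrite sqr_cabs real_normK ?num_real// lerDr sqr_ge0.
Qed.

Lemma cabs_le_ReIm x : cabs x <= `|Re x| + `|Im x|.
Proof.
rewrite -(@ler_pXn2r _ 2)// ?nnegrE ?cabs_ge0 ?addr_ge0//.
rewrite sqr_cabs sqrrD !real_normK ?num_real//.
by have := mulr_ge0 (normr_ge0 (Re x)) (normr_ge0 (Im x)); lra.
Qed.

Lemma cabs_dist x y : `|cabs x - cabs y| <= cabs (x - y).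
Proof.
rewrite ler_norml; apply/andP; split.
  rewrite lerNl opprB lerBlDr -(cabsN (x - y)) opprB.
  by rewrite (le_trans _ (cabsD _ _))// subrK.
by rewrite lerBlDr (le_trans _ (cabsD _ _))// subrK.
Qed.

Lemma mulcJ_real x : x * conjc x = rc (cabs x ^+ 2).
Proof.
by apply: complex_ext; rewrite sqr_cabs; case: x => a b /=; ring.
Qed.

Lemma cabs_expi t : cabs (expi t : R[i]) = 1.
Proof. by rewrite /expi /= cos2Dsin2 sqrtr1. Qed.

Lemma expiD a b : expi (a + b) = expi a * expi b :> R[i].
Proof.
by rewrite /expi; apply: complex_ext; rewrite ?ReM ?ImM/= ?cosD ?sinD; ring.
Qed.

Lemma expi_neq0 (t : R) : expi t != 0 :> R[i].
Proof.
apply/eqP => e0; have := @cabs_expi t.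
by rewrite e0 cabs0 => /esym/eqP; rewrite oner_eq0.
Qed.

Lemma expi0 : expi 0 = 1 :> R[i].
Proof. by rewrite /expi cos0 sin0. Qed.

Lemma conjM x y : conjc (x * y) = conjc x * conjc y.
Proof. by apply: complex_ext; rewrite !ReImE; ring. Qed.

Lemma conjK x : conjc (conjc x) = x.
Proof. by case: x => a b /=; rewrite opprK. Qed.

Lemma conj_real a : conjc (rc a) = rc a.
Proof. by rewrite /= oppr0. Qed.

Lemma expiN a : expi (- a) = conjc (expi a) :> R[i].
Proof. by rewrite /expi cosN sinN. Qed.

Lemma sqr_cabsD_le x y : cabs (x + y) ^+ 2 <= 2 * cabs x ^+ 2 + 2 * cabs y ^+ 2.
Proof.
rewrite !sqr_cabs ReD ImD.
have := sqr_ge0 (Re x - Re y); have := sqr_ge0 (Im x - Im y).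
by rewrite !expr2; lra.
Qed.

Lemma expi_surj x : cabs x = 1 -> exists t, expi t = x.
Proof.
move=> x1; have : Re x ^+ 2 + Im x ^+ 2 = 1 by rewrite -sqr_cabs x1 expr1n.
case: x {x1} => a b /= ab1.
have a1 : -1 <= a <= 1.
  rewrite -ler_norml -(@ler_pXn2r _ 2)// ?nnegrE// expr1n.
  by rewrite real_normK ?num_real// -ab1 lerDl sqr_ge0.
have sinE : sin (acos a) = `|b|.
  by rewrite sin_acos// -sqrtr_sqr; congr Num.sqrt; rewrite -ab1; ring.
have [b0|b0] := leP 0 b.
  by exists (acos a); rewrite /expi acosK// sinE ger0_norm.
by exists (- acos a); rewrite /expi cosN sinN acosK// sinE ltr0_norm// opprK.
Qed.

End complex_arithmetic.

(** * Integrals of complex-valued functions *)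

Section cmeasurable.
Context {R : realType} {d} {T : measurableType d}.
Implicit Types (f g : T -> R[i]) (h : T -> R).

Definition cmeasurable f :=
  measurable_fun setT (fun x => Re (f x)) /\
  measurable_fun setT (fun x => Im (f x)).

Lemma cmeasurableD f g : cmeasurable f -> cmeasurable g ->
  cmeasurable (fun x => f x + g x).
Proof.
move=> [f1 f2] [g1 g2]; split.
  by under eq_fun do rewrite ReD; exact: measurable_funD.
by under eq_fun do rewrite ImD; exact: measurable_funD.
Qed.

Lemma cmeasurableN f : cmeasurable f -> cmeasurable (fun x => - f x).
Proof.
move=> [f1 f2]; split.
  by under eq_fun do rewrite ReN; exact: measurable_funN.
by under eq_fun do rewrite ImN; exact: measurable_funN.
Qed.

Lemma cmeasurableB f g : cmeasurable f -> cmeasurable g ->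
  cmeasurable (fun x => f x - g x).
Proof. by move=> mf mg; apply: cmeasurableD => //; exact: cmeasurableN. Qed.

Lemma cmeasurableM f g : cmeasurable f -> cmeasurable g ->
  cmeasurable (fun x => f x * g x).
Proof.
move=> [f1 f2] [g1 g2]; split.
  under eq_fun do rewrite ReM.
  by apply: measurable_funB; exact: measurable_funM.
under eq_fun do rewrite ImM.
by apply: measurable_funD; exact: measurable_funM.
Qed.

Lemma cmeasurable_cst (c : R[i]) : cmeasurable (fun=> c).
Proof. by split; exact: measurable_cst. Qed.

Lemma cmeasurableJ f : cmeasurable f -> cmeasurable (fun x => conjc (f x)).
Proof.
move=> [f1 f2]; split.
  by under eq_fun do rewrite ReJ.
by under eq_fun do rewrite ImJ; exact: measurable_funN.
Qed.

Lemma cmeasurable_real h : measurable_fun setT h ->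
  cmeasurable (fun x => rc (h x)).
Proof. by move=> mh; split => //=; exact: measurable_cst. Qed.

Lemma cmeasurable_expi h : measurable_fun setT h ->
  cmeasurable (fun x => expi (h x)).
Proof.
move=> mh; split => /=.
  apply: (measurableT_comp _ mh); apply: continuous_measurable_fun.
  exact: continuous_cos.
apply: (measurableT_comp _ mh); apply: continuous_measurable_fun.
exact: continuous_sin.
Qed.

Lemma measurable_sqr_cabs f : cmeasurable f ->
  measurable_fun setT (fun x => cabs (f x) ^+ 2).
Proof.
move=> [f1 f2]; under eq_fun do rewrite sqr_cabs.
by apply: measurable_funD; exact: measurable_funX.
Qed.

Lemma measurable_sqrt_fun h : measurable_fun setT h ->
  measurable_fun setT (fun x => Num.sqrt (h x)).
Proof.
move=> mh; apply: (measurableT_comp _ mh); apply: continuous_measurable_fun.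
exact: sqrt_continuous.
Qed.

Lemma measurable_cabs f : cmeasurable f ->
  measurable_fun setT (fun x => cabs (f x)).
Proof.
move=> mf; rewrite (_ : (fun _ => _) = fun x => Num.sqrt (cabs (f x) ^+ 2)).
  exact/measurable_sqrt_fun/measurable_sqr_cabs.
by apply/funext => x; rewrite sqrtr_sqr ger0_norm// cabs_ge0.
Qed.

Lemma cmeasurable_if (A : T -> bool) f : measurable_fun setT A ->
  cmeasurable f -> cmeasurable (fun x => if A x then f x else 0).
Proof.
move=> mA [f1 f2]; split.
  rewrite (_ : (fun _ => _) = fun x => if A x then Re (f x) else 0).
    exact: measurable_fun_ifT.
  by apply/funext => x; case: (A x).
rewrite (_ : (fun _ => _) = fun x => if A x then Im (f x) else 0).
  exact: measurable_fun_ifT.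
by apply/funext => x; case: (A x).
Qed.

End cmeasurable.

Lemma cmeasurable_comp {R : realType} {d1 d2} {T1 : measurableType d1}
    {T2 : measurableType d2} (f : T2 -> R[i]) (h : T1 -> T2) :
  cmeasurable f -> measurable_fun setT h -> cmeasurable (fun x => f (h x)).
Proof.
by move=> [f1 f2] mh; split; [exact: (measurableT_comp f1)|exact: (measurableT_comp f2)].
Qed.

Section cintegral.
Context {R : realType} {d} {T : measurableType d} (mu : {measure set T -> \bar R}).
Implicit Types (f g : T -> R[i]) (h : T -> R).

Local Notation cint f := (cintegral mu setT f).

Definition cintegrable f :=
  mu.-integrable setT (fun x => (Re (f x))%:E) /\
  mu.-integrable setT (fun x => (Im (f x))%:E).

Lemma cintegrable_meas f : cintegrable f -> cmeasurable f.
Proof.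
by move=> [/measurable_int/measurable_EFinP ? /measurable_int/measurable_EFinP ?].
Qed.

Lemma cintegrable_le f h : cmeasurable f -> mu.-integrable setT (EFin \o h) ->
  (forall x, cabs (f x) <= h x) -> cintegrable f.
Proof.
move=> [f1 f2] ih fh; split.
- apply: le_integrable ih => //; first exact/measurable_EFinP.
  move=> x _ /=; rewrite lee_fin (le_trans (Re_le_cabs _))//.
  by rewrite (le_trans (fh x))// ler_norm.
- apply: le_integrable ih => //; first exact/measurable_EFinP.
  move=> x _ /=; rewrite lee_fin (le_trans (Im_le_cabs _))//.
  by rewrite (le_trans (fh x))// ler_norm.
Qed.

Lemma integrable_cabs f : cintegrable f ->
  mu.-integrable setT (fun x => (cabs (f x))%:E).
Proof.
move=> cf; have [f1 f2] := cf.
have := integrableD measurableT (integrable_abse f1) (integrable_abse f2).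
apply: le_integrable => //.
  exact/measurable_EFinP/measurable_cabs/cintegrable_meas.
move=> x _ /=; rewrite lee_fin ger0_norm ?cabs_ge0//.
by rewrite ger0_norm ?addr_ge0// cabs_le_ReIm.
Qed.

Lemma cintegrableD f g : cintegrable f -> cintegrable g ->
  cintegrable (fun x => f x + g x).
Proof.
move=> [f1 f2] [g1 g2]; split.
  by under eq_fun do rewrite ReD EFinD; exact: integrableD.
by under eq_fun do rewrite ImD EFinD; exact: integrableD.
Qed.

Lemma cintegrableN f : cintegrable f -> cintegrable (fun x => - f x).
Proof.
move=> [f1 f2]; split.
  by under eq_fun do rewrite ReN EFinN; exact: integrableN.
by under eq_fun do rewrite ImN EFinN; exact: integrableN.
Qed.

Lemma cintegrableB f g : cintegrable f -> cintegrable g ->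
  cintegrable (fun x => f x - g x).
Proof. by move=> cf cg; apply: cintegrableD => //; exact: cintegrableN. Qed.

Lemma cintegrableMb f (k : T -> R[i]) (M : R) : cintegrable f -> cmeasurable k ->
  (forall x, cabs (k x) <= M) -> cintegrable (fun x => f x * k x).
Proof.
move=> cf mk kM.
have iM := integrableZr measurableT M (integrable_cabs cf).
apply: (@cintegrable_le _ (fun x => cabs (f x) * M)).
- by apply: cmeasurableM => //; exact: cintegrable_meas.
- exact: iM.
- by move=> x; rewrite cabsM ler_wpM2l ?cabs_ge0.
Qed.

Lemma cintegrableZ (c : R[i]) f : cintegrable f -> cintegrable (fun x => c * f x).
Proof.
move=> cf; under eq_fun do rewrite mulrC.
by apply: (@cintegrableMb _ _ (cabs c)) => //; exact: cmeasurable_cst.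
Qed.

Lemma eq_cintegral f g : f =1 g -> cint f = cint g.
Proof. by move=> /funext ->. Qed.

Lemma cintegralD f g : cintegrable f -> cintegrable g ->
  cint (fun x => f x + g x) = cint f + cint g.
Proof.
move=> [f1 f2] [g1 g2]; apply: complex_ext; rewrite ?ReD ?ImD/=.
  by under eq_Rintegral do rewrite ReD; rewrite RintegralD.
by under eq_Rintegral do rewrite ImD; rewrite RintegralD.
Qed.

Lemma cintegralZ (c : R[i]) f : cintegrable f ->
  cint (fun x => c * f x) = c * cint f.
Proof.
move=> [f1 f2]; apply: complex_ext; rewrite ?ReM ?ImM/=.
  under eq_Rintegral do rewrite ReM.
  rewrite RintegralB//; [|exact: integrableZl f1|exact: integrableZl f2].
  by rewrite !RintegralZl.
under eq_Rintegral do rewrite ImM.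
rewrite RintegralD//; [|exact: integrableZl f2|exact: integrableZl f1].
by rewrite !RintegralZl.
Qed.

Lemma cintegralN f : cintegrable f -> cint (fun x => - f x) = - cint f.
Proof.
by move=> cf; under eq_fun do rewrite -mulN1r; rewrite cintegralZ// mulN1r.
Qed.

Lemma cintegralB f g : cintegrable f -> cintegrable g ->
  cint (fun x => f x - g x) = cint f - cint g.
Proof.
by move=> cf cg; rewrite cintegralD//; [rewrite cintegralN|exact: cintegrableN].
Qed.

Lemma cintegralJ f : cintegrable f -> cint (fun x => conjc (f x)) = conjc (cint f).
Proof.
move=> [f1 f2]; apply: complex_ext; rewrite ?ReJ ?ImJ/=.
  by under eq_Rintegral do rewrite ReJ.
under eq_Rintegral do rewrite ImJ -mulN1r.
by rewrite RintegralZl// mulN1r.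
Qed.

Lemma cintegral_real h : cint (fun x => rc (h x)) = rc (\int[mu]_x h x).
Proof. by rewrite /cintegral /= Rintegral_cst// mul0r. Qed.

(** Rotating the integral onto the real axis avoids the factor 2 that comparing
real and imaginary parts would cost. *)
Lemma cabs_cintegral_le f : cintegrable f ->
  cabs (cint f) <= \int[mu]_x cabs (f x).
Proof.
move=> cf; set z := cint f.
have [z0|z0] := eqVneq (cabs z) 0.
  by rewrite z0; apply: Rintegral_ge0 => x _; exact: cabs_ge0.
have zgt0 : 0 < cabs z by rewrite lt0r z0 cabs_ge0.
rewrite -(ler_pM2l zgt0) -expr2.
have -> : cabs z ^+ 2 = Re (cint (fun x => conjc z * f x)).
  by rewrite cintegralZ// -/z mulrC mulcJ_real.
rewrite -RintegralZl//; last exact: integrable_cabs.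
apply: le_Rintegral => //.
- by have [] := cintegrableZ (conjc z) cf.
- exact: integrableZl (integrable_cabs cf).
- move=> x _; rewrite -(cabsJ z) -cabsM.
  by rewrite (le_trans (ler_norm _))// Re_le_cabs.
Qed.

Lemma cdominated_cvg (f_ : nat -> T -> R[i]) f h :
  (forall k, cmeasurable (f_ k)) -> cmeasurable f ->
  {ae mu, forall x, cabs (f_ k x - f x) @[k --> \oo] --> 0} ->
  mu.-integrable setT (EFin \o h) ->
  (forall k x, cabs (f_ k x) <= h x) ->
  Re (cint (f_ k)) @[k --> \oo] --> Re (cint f) /\
  Im (cint (f_ k)) @[k --> \oo] --> Im (cint f).
Proof.
move=> mf_ [mf1 mf2] f_f ih f_h.
have key (P : R[i] -> R) (PB : forall x y, P (x - y) = P x - P y)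
    (Pn : forall x, `|P x| <= cabs x)
    (mP : forall k, measurable_fun setT (fun x => P (f_ k x)))
    (mPf : measurable_fun setT (fun x => P (f x))) :
    \int[mu]_x P (f_ k x) @[k --> \oo] --> \int[mu]_x P (f x).
  have [] := @dominated_convergence _ _ _ mu setT measurableT
    (fun k x => (P (f_ k x))%:E) (fun x => (P (f x))%:E) (EFin \o h).
  - by move=> k; exact/measurable_EFinP.
  - exact/measurable_EFinP.
  - apply: filterS f_f => x fx _; apply: cvg_EFin; first exact: nearW.
    apply/cvgrPdist_le => e e0.
    move/cvgrPdist_le : fx => /(_ _ e0); apply: filterS => k.
    rewrite sub0r normrN ger0_norm ?cabs_ge0// => le_e.
    by rewrite distrC -PB (le_trans (Pn _)).
  - exact: ih.
  - by apply: aeW => x k _; rewrite lee_fin (le_trans (Pn _)).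
  - move=> iPf _ lim; apply: fine_cvg; rewrite fineK//.
    exact: integrable_fin_num.
split => /=; apply: key => //.
- by move=> x y; rewrite ReD ReN.
- by move=> x; exact: Re_le_cabs.
- by move=> k; have [] := mf_ k.
- by move=> x y; rewrite ImD ImN.
- by move=> x; exact: Im_le_cabs.
- by move=> k; have [] := mf_ k.
Qed.

End cintegral.

Section cfubini.
Context {R : realType} {d1 d2} {T1 : measurableType d1} {T2 : measurableType d2}.
Variable m1 : {sigma_finite_measure set T1 -> \bar R}.
Variable m2 : {sigma_finite_measure set T2 -> \bar R}.
Implicit Types (F : T1 * T2 -> R[i]).

Lemma measurable_partial_Rintegral (h : T1 * T2 -> R) : measurable_fun setT h ->
  measurable_fun setT (fun x => \int[m2]_y h (x, y)).
Proof.
move=> mh; apply: (measurableT_comp (fine_measurable measurableT)).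
rewrite (_ : (fun _ => _) = fun x => (\int[m2]_y ((EFin \o h)^\+)%E (x, y) -
    \int[m2]_y (EFin \o h)^\- (x, y))%E).
  have mEh : measurable_fun setT (EFin \o h) by exact/measurable_EFinP.
  apply: emeasurable_funB.
    apply: (measurable_fun_fubini_tonelli_F ((EFin \o h)^\+)%E) => //.
    exact: measurable_funepos.
  apply: (measurable_fun_fubini_tonelli_F ((EFin \o h)^\-)%E) => //.
  exact: measurable_funeneg.
by apply/funext => x; rewrite [LHS]integralE; congr (_ - _)%E; apply: eq_integral => y _; rewrite ?funeposE ?funenegE.
Qed.

Lemma cmeasurable_partial F : cmeasurable F ->
  cmeasurable (fun x => cintegral m2 setT (fun y => F (x, y))).
Proof.
by move=> [F1 F2]; split;
  [exact: (measurable_partial_Rintegral F1)|exact: (measurable_partial_Rintegral F2)].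
Qed.

Lemma cfubini F : cintegrable (m1 \x m2)%E F ->
  (forall x, cintegrable m2 (fun y => F (x, y))) ->
  (forall y, cintegrable m1 (fun x => F (x, y))) ->
  cintegral m1 setT (fun x => cintegral m2 setT (fun y => F (x, y))) =
  cintegral m2 setT (fun y => cintegral m1 setT (fun x => F (x, y))).
Proof.
move=> [F1 F2] i2 i1.
have key (h : T1 * T2 -> R) : (m1 \x m2)%E.-integrable setT (EFin \o h) ->
    (forall x, m2.-integrable setT (fun y => (h (x, y))%:E)) ->
    (forall y, m1.-integrable setT (fun x => (h (x, y))%:E)) ->
    \int[m1]_x (\int[m2]_y h (x, y)) = \int[m2]_y (\int[m1]_x h (x, y)).
  move=> ih ih2 ih1; congr fine.
  transitivity (\int[m1]_x \int[m2]_y (h (x, y))%:E)%E.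
    by apply: eq_integral => x _; rewrite fineK//; exact: integrable_fin_num.
  transitivity (\int[m2]_y \int[m1]_x (h (x, y))%:E)%E; last first.
    by apply: eq_integral => x _; rewrite fineK//; exact: integrable_fin_num.
  exact: (Fubini ih).
apply: complex_ext => /=;
  [apply: (key (fun p => Re (F p)))|apply: (key (fun p => Im (F p)))] => //.
- by move=> x; have [] := i2 x.
- by move=> y; have [] := i1 y.
- by move=> x; have [] := i2 x.
- by move=> y; have [] := i1 y.
Qed.

Lemma cintegrable_tensor (f : T1 -> R[i]) (k : T2 -> R[i]) F :
  cintegrable m1 f -> cintegrable m2 k -> cmeasurable F ->
  (forall p, cabs (F p) <= 1) ->
  cintegrable (m1 \x m2)%E (fun p => f p.1 * k p.2 * F p).
Proof.
move=> cf ck mF F1.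
have mf := measurable_cabs (cintegrable_meas cf).
have mk := measurable_cabs (cintegrable_meas ck).
have mfk : cmeasurable (fun p : T1 * T2 => f p.1 * k p.2).
  apply: cmeasurableM.
    exact: (cmeasurable_comp (cintegrable_meas cf) measurable_fst).
  exact: (cmeasurable_comp (cintegrable_meas ck) measurable_snd).
apply: (@cintegrable_le _ _ _ _ _ (fun p => cabs (f p.1) * cabs (k p.2))).
- exact: cmeasurableM.
- apply/integrable12ltyP => /=.
    apply/measurable_EFinP/measurable_funM.
      exact: (measurableT_comp mf measurable_fst).
    exact: (measurableT_comp mk measurable_snd).
  have [iF Ff] := (integrable_cabs cf, integrable_cabs ck).
  have E x : (\int[m2]_y `|(cabs (f x) * cabs (k y))%:E|)%E =
      ((cabs (f x))%:E * \int[m2]_y (cabs (k y))%:E)%E.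
    rewrite -ge0_integralZl//; last 3 first.
    - exact/measurable_EFinP.
    - by move=> *; rewrite lee_fin cabs_ge0.
    - by rewrite lee_fin cabs_ge0.
    by apply: eq_integral => y _; rewrite gee0_abs ?EFinM// lee_fin mulr_ge0 ?cabs_ge0.
  under eq_integral do rewrite E.
  rewrite ge0_integralZr//; last 3 first.
  - exact/measurable_EFinP.
  - by move=> *; rewrite lee_fin cabs_ge0.
  - by apply: integral_ge0 => *; rewrite lee_fin cabs_ge0.
  apply: lte_mul_pinfty.
  + by apply: integral_ge0 => *; rewrite lee_fin cabs_ge0.
  + exact: integrable_fin_num.
  + exact: integrable_lty.
- by move=> p; rewrite !cabsM ler_piMr// mulr_ge0 ?cabs_ge0.
Qed.

(** The multiplication formula [\int (Ff) k = \int f (Fk)], for any bounded kernel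
in place of the Fourier one: the tensor product [f k F] is absolutely integrable. *)
Lemma cintegral_kernel_swap (f : T1 -> R[i]) (k : T2 -> R[i]) F :
  cintegrable m1 f -> cintegrable m2 k -> cmeasurable F ->
  (forall p, cabs (F p) <= 1) ->
  cintegral m2 setT (fun y => k y * cintegral m1 setT (fun x => f x * F (x, y))) =
  cintegral m1 setT (fun x => f x * cintegral m2 setT (fun y => k y * F (x, y))).
Proof.
move=> cf ck mF F1.
have mF1 x : cmeasurable (fun y => F (x, y)).
  exact: (cmeasurable_comp mF (measurable_pair1 x)).
have mF2 y : cmeasurable (fun x => F (x, y)).
  exact: (cmeasurable_comp mF (measurable_pair2 y)).
have cf2 y : cintegrable m1 (fun x => f x * F (x, y)) by exact: cintegrableMb.
have ck1 x : cintegrable m2 (fun y => k y * F (x, y)) by exact: cintegrableMb.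
have := cfubini (cintegrable_tensor cf ck mF F1) => /= fub.
transitivity (cintegral m2 setT (fun y =>
    cintegral m1 setT (fun x => f x * k y * F (x, y)))).
  apply: eq_cintegral => y; rewrite -cintegralZ//.
  by apply: eq_cintegral => x; ring.
rewrite -fub//.
- apply: eq_cintegral => x; rewrite -cintegralZ//.
  by apply: eq_cintegral => y; ring.
- move=> x; rewrite (_ : (fun _ => _) = fun y => f x * (k y * F (x, y))).
    exact: cintegrableZ.
  by apply/funext => y; rewrite mulrA.
- move=> y; rewrite (_ : (fun _ => _) = fun x => k y * (f x * F (x, y))).
    exact: cintegrableZ.
  by apply/funext => x; ring.
Qed.

End cfubini.

(** * Square-integrable complex functions *)

Section sqint.
Context {R : realType} {d} {T : measurableType d} (mu : {measure set T -> \bar R}).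
Implicit Types (f g : T -> R[i]).

(** The square of the L^2 norm; [L2n] below is the norm itself. *)
Definition sqint f : \bar R := (\int[mu]_x (cabs (f x) ^+ 2)%:E)%E.

Definition L2n f : \bar R := ('N[mu]_2%:E[EFin \o (cabs \o f)])%E.

Lemma sqint_ge0 f : (0 <= sqint f)%E.
Proof. by apply: integral_ge0 => x _; rewrite lee_fin sqr_ge0. Qed.

Lemma L2n_ge0 f : (0 <= L2n f)%E.
Proof. exact: Lnorm_ge0. Qed.

Lemma Lnorm2E (h : T -> R) :
  ('N[mu]_2%:E[EFin \o h] = sqrte (\int[mu]_x (h x ^+ 2)%:E))%E.
Proof.
rewrite unlock -poweR12_sqrt; last first.
  by apply: integral_ge0 => x _; rewrite lee_fin sqr_ge0.
congr (_ `^ _)%E; apply: eq_integral => x _ /=.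
by rewrite ?poweR_EFin powR_mulrn// real_normK// num_real.
Qed.

Lemma L2nE f : L2n f = sqrte (sqint f).
Proof. exact: Lnorm2E. Qed.

Lemma L2n_lty f : (L2n f < +oo)%E <-> (sqint f < +oo)%E.
Proof.
rewrite L2nE; have := sqint_ge0 f; case: (sqint f) => [r| |]//=.
by rewrite !ltry.
Qed.

Lemma eq_sqint f g : (forall x, cabs (f x) = cabs (g x)) -> sqint f = sqint g.
Proof. by move=> fg; apply: eq_integral => x _; rewrite fg. Qed.

Lemma eq_L2n f g : (forall x, cabs (f x) = cabs (g x)) -> L2n f = L2n g.
Proof. by move=> fg; rewrite !L2nE (eq_sqint fg). Qed.

Lemma measurable_sqint f : cmeasurable f ->
  measurable_fun setT (fun x => (cabs (f x) ^+ 2)%:E).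
Proof. by move=> mf; exact/measurable_EFinP/measurable_sqr_cabs. Qed.

Lemma le_sqint f g : cmeasurable f -> cmeasurable g ->
  (forall x, cabs (f x) <= cabs (g x)) -> (sqint f <= sqint g)%E.
Proof.
move=> mf mg fg; apply: ge0_le_integral => //.
- by move=> x _; rewrite lee_fin sqr_ge0.
- exact: measurable_sqint.
- exact: measurable_sqint.
- by move=> x _; rewrite lee_fin ler_pXn2r ?nnegrE ?cabs_ge0.
Qed.

Lemma L2nD f g : cmeasurable f -> cmeasurable g ->
  (L2n (fun x => f x + g x)%R <= L2n f + L2n g)%E.
Proof.
move=> mf mg.
apply: (@le_trans _ _ ('N[mu]_2%:E[EFin \o ((cabs \o f) \+ (cabs \o g))%R])%E).
  rewrite L2nE Lnorm2E lee_sqrt; last first.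
    by apply: integral_ge0 => x _; rewrite lee_fin sqr_ge0.
  apply: ge0_le_integral => //=.
  - by move=> x _; rewrite lee_fin sqr_ge0.
  - exact/measurable_sqint/cmeasurableD.
  - apply/measurable_EFinP/measurable_funX.
    by apply: measurable_funD; exact: measurable_cabs.
  - move=> x _; rewrite lee_fin ler_pXn2r ?nnegrE ?addr_ge0 ?cabs_ge0//.
    exact: cabsD.
by apply: minkowski_EFin => //; [exact: measurable_cabs|exact: measurable_cabs|lra].
Qed.

Lemma L2nN f : L2n (fun x => - f x) = L2n f.
Proof. by apply: eq_L2n => x; rewrite cabsN. Qed.

Lemma L2n_triangle f g : cmeasurable f -> cmeasurable g ->
  (L2n f <= L2n g + L2n (fun x => f x - g x)%R)%E.
Proof.
move=> mf mg; rewrite (_ : f = fun x => g x + (f x - g x)).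
  under [X in (_ <= _ + L2n X)%E]eq_fun do rewrite addrAC subrr add0r.
  by apply: L2nD => //; exact: cmeasurableB.
by apply/funext => x; rewrite addrC subrK.
Qed.

Lemma L2nZ (c : R[i]) f : cmeasurable f ->
  L2n (fun x => c * f x) = ((cabs c)%:E * L2n f)%E.
Proof.
move=> mf; rewrite !L2nE.
have -> : sqint (fun x => c * f x) = ((cabs c ^+ 2)%:E * sqint f)%E.
  rewrite /sqint; under eq_integral do rewrite cabsM exprMn EFinM.
  rewrite ge0_integralZl//.
  - exact: measurable_sqint.
  - by move=> x _; rewrite lee_fin sqr_ge0.
  - by rewrite lee_fin sqr_ge0.
have := sqint_ge0 f; have := cabs_ge0 c; case: (sqint f) => [r| |]//= c0 r0.
  by rewrite sqrtrM ?sqr_ge0// sqrtr_sqr ger0_norm.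
have [->|cn0] := eqVneq (cabs c) 0.
  by rewrite expr0n/= !mul0e/= sqrtr0.
have cgt0 : 0 < cabs c by rewrite lt0r cn0.
by rewrite !gt0_muley ?lte_fin ?exprn_gt0.
Qed.

Lemma sqintD_le f g : cmeasurable f -> cmeasurable g ->
  (sqint (fun x => f x + g x)%R <= 2%:E * sqint f + 2%:E * sqint g)%E.
Proof.
move=> mf mg; rewrite /sqint -!ge0_integralZl//; last 4 first.
- exact: measurable_sqint.
- by move=> x _; rewrite lee_fin sqr_ge0.
- exact: measurable_sqint.
- by move=> x _; rewrite lee_fin sqr_ge0.
rewrite -ge0_integralD//; last 4 first.
- by move=> x _; rewrite -EFinM lee_fin mulr_ge0// sqr_ge0.
- by apply: measurable_funeM; exact: measurable_sqint.
- by move=> x _; rewrite -EFinM lee_fin mulr_ge0// sqr_ge0.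
- by apply: measurable_funeM; exact: measurable_sqint.
apply: ge0_le_integral => //.
- by move=> x _; rewrite lee_fin sqr_ge0.
- exact/measurable_sqint/cmeasurableD.
- by apply: emeasurable_funD; apply: measurable_funeM; exact: measurable_sqint.
- by move=> x _; rewrite -!EFinM -EFinD lee_fin sqr_cabsD_le.
Qed.

Lemma sqintB_le f g : cmeasurable f -> cmeasurable g ->
  (sqint (fun x => f x - g x)%R <= 2%:E * sqint f + 2%:E * sqint g)%E.
Proof.
move=> mf mg; rewrite -(@eq_sqint (fun x => - g x) g).
  by apply: sqintD_le => //; exact: cmeasurableN.
by move=> x; rewrite cabsN.
Qed.

Definition cL2 f := cmeasurable f /\ (sqint f < +oo)%E.

Lemma cL2D f g : cL2 f -> cL2 g -> cL2 (fun x => f x + g x).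
Proof.
move=> [mf f2] [mg g2]; split; first exact: cmeasurableD.
apply: le_lt_trans (sqintD_le mf mg) _.
by apply: lte_add_pinfty; exact: lte_mul_pinfty.
Qed.

Lemma cL2N f : cL2 f -> cL2 (fun x => - f x).
Proof.
move=> [mf f2]; split; first exact: cmeasurableN.
by rewrite (@eq_sqint _ f)// => x; rewrite cabsN.
Qed.

Lemma cL2B f g : cL2 f -> cL2 g -> cL2 (fun x => f x - g x).
Proof. by move=> f2 g2; apply: cL2D => //; exact: cL2N. Qed.

Lemma cL2Mb f (k : T -> R[i]) (M : R) : cL2 f -> cmeasurable k ->
  (forall x, cabs (k x) <= M) -> cL2 (fun x => k x * f x).
Proof.
move=> [mf f2] mk kM; split; first exact: cmeasurableM.
have M0 (x : T) : 0 <= M by rewrite (le_trans (cabs_ge0 (k x))).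
apply: (@le_lt_trans _ _ ((M ^+ 2)%:E * sqint f)%E); last first.
  by rewrite lte_mul_pinfty// lee_fin sqr_ge0.
rewrite /sqint -ge0_integralZl//; last 3 first.
- exact: measurable_sqint.
- by move=> x _; rewrite lee_fin sqr_ge0.
- by rewrite lee_fin sqr_ge0.
apply: ge0_le_integral => //.
- by move=> x _; rewrite lee_fin sqr_ge0.
- exact/measurable_sqint/cmeasurableM.
- by apply: measurable_funeM; exact: measurable_sqint.
move=> x _; rewrite -EFinM lee_fin -exprMn ler_pXn2r ?nnegrE ?cabs_ge0//.
  by rewrite cabsM ler_wpM2r ?cabs_ge0.
by rewrite mulr_ge0 ?cabs_ge0// (M0 x).
Qed.

Lemma cL2Z (c : R[i]) f : cL2 f -> cL2 (fun x => c * f x).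
Proof.
by move=> f2; apply: (cL2Mb (M := cabs c) f2) => //; exact: cmeasurable_cst.
Qed.

Lemma cintegrable_mulL2 f g : cL2 f -> cL2 g -> cintegrable mu (fun x => f x * g x).
Proof.
move=> [mf f2] [mg g2].
have iS h : cL2 h -> mu.-integrable setT (fun x => (cabs (h x) ^+ 2)%:E).
  move=> [mh h2]; apply/integrableP; split; first exact: measurable_sqint.
  under eq_integral do rewrite gee0_abs ?lee_fin ?sqr_ge0//.
  exact: h2.
apply: (@cintegrable_le _ _ _ _ _
  (fun x => cabs (f x) ^+ 2 + cabs (g x) ^+ 2)).
- exact: cmeasurableM.
- exact: integrableD (iS _ (conj mf f2)) (iS _ (conj mg g2)).
- move=> x; rewrite cabsM.
  have := sqr_ge0 (cabs (f x) - cabs (g x)).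
  have := mulr_ge0 (cabs_ge0 (f x)) (cabs_ge0 (g x)).
  by rewrite !expr2; lra.
Qed.

Lemma L2n_fine f : cL2 f -> L2n f = (Num.sqrt (fine (sqint f)))%:E.
Proof.
move=> [_ f2]; rewrite L2nE; have := sqint_ge0 f.
by case: (sqint f) f2 => [r| |].
Qed.

Lemma fine_sqint f : fine (sqint f) = \int[mu]_x (cabs (f x) ^+ 2).
Proof. by []. Qed.

Lemma sqint_fineK f : cL2 f -> (fine (sqint f))%:E = sqint f.
Proof. by move=> [_ f2]; rewrite fineK// ge0_fin_numE ?sqint_ge0. Qed.

(** Expanding a square pointwise avoids splitting extended-real integrals later:
this is how the inner product enters Parseval's formula and the forms below. *)
Lemma fine_sqintD f g : cL2 f -> cL2 g ->
  fine (sqint (fun x => f x + g x)) =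
  fine (sqint f) + fine (sqint g) +
  2 * Re (cintegral mu setT (fun x => f x * conjc (g x))).
Proof.
move=> f2 g2; have [mf fo] := f2; have [mg go] := g2.
have iS h : cL2 h -> mu.-integrable setT (fun x => (cabs (h x) ^+ 2)%:E).
  move=> [mh h2]; apply/integrableP; split; first exact: measurable_sqint.
  under eq_integral do rewrite gee0_abs ?lee_fin ?sqr_ge0//.
  exact: h2.
have gJ2 : cL2 (fun x => conjc (g x)).
  split; first exact: cmeasurableJ.
  by rewrite (@eq_sqint _ g)// => x; rewrite cabsJ.
have [ifg _] := cintegrable_mulL2 f2 gJ2.
rewrite !fine_sqint /= -RintegralZl//.
have ifg2 : mu.-integrable setT
    (EFin \o (fun x => 2 * Re (f x * conjc (g x)))) by exact: integrableZl ifg.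
rewrite -RintegralD//; [|exact: iS|exact: iS].
rewrite -RintegralD//; last exact: integrableD (iS _ f2) (iS _ g2).
by apply: eq_Rintegral => x _; rewrite !sqr_cabs !ReImE; ring.
Qed.

End sqint.

(** * Integral transforms with a unimodular kernel *)

Section phase_transform.
Local Opaque expi cintegral.
Context {R : realType} {d} {T : measurableType d}.
Variable mu : {sigma_finite_measure set T -> \bar R}.
Variable q : T -> T -> R.
Hypothesis mq : measurable_fun setT (fun p : T * T => q p.1 p.2).
Implicit Types (f g : T -> R[i]).

Definition phase_transform f (xi : T) : R[i] :=
  cintegral mu setT (fun x => f x * expi (q x xi)).

Local Notation ftr := phase_transform.

Let mE : cmeasurable (fun p : T * T => expi (q p.1 p.2) : R[i]).
Proof. exact: cmeasurable_expi. Qed.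

Let mE1 x : cmeasurable (fun xi => expi (q x xi) : R[i]).
Proof. exact: (cmeasurable_comp mE (measurable_pair1 x)). Qed.

Let mE2 xi : cmeasurable (fun x => expi (q x xi) : R[i]).
Proof. exact: (cmeasurable_comp mE (measurable_pair2 xi)). Qed.

Lemma cintegrable_phase f xi : cintegrable mu f ->
  cintegrable mu (fun x => f x * expi (q x xi)).
Proof.
move=> cf; apply: (@cintegrableMb _ _ _ _ _ _ 1) => // x.
by rewrite cabs_expi.
Qed.

Lemma cmeasurable_phase_transform f : cmeasurable f -> cmeasurable (ftr f).
Proof.
move=> mf.
have mF : cmeasurable (fun p : T * T => f p.2 * expi (q p.2 p.1)).
  apply: cmeasurableM; first exact: (cmeasurable_comp mf measurable_snd).
  apply: (cmeasurable_comp mE (h := fun p : T * T => (p.2, p.1))).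
  by apply/measurable_fun_pair; [exact: measurable_snd|exact: measurable_fst].
exact: (cmeasurable_partial mu mF).
Qed.

Lemma phase_transformD f g xi : cintegrable mu f -> cintegrable mu g ->
  ftr (fun x => f x + g x) xi = ftr f xi + ftr g xi.
Proof.
move=> cf cg; rewrite /ftr -cintegralD; [|exact: cintegrable_phase..].
by apply: eq_cintegral => x; rewrite mulrDl.
Qed.

Lemma phase_transformZ (c : R[i]) f xi : cintegrable mu f ->
  ftr (fun x => c * f x) xi = c * ftr f xi.
Proof.
move=> cf; rewrite /ftr -cintegralZ; last exact: cintegrable_phase.
by apply: eq_cintegral => x; rewrite mulrA.
Qed.

Lemma phase_transformB f g xi : cintegrable mu f -> cintegrable mu g ->
  ftr (fun x => f x - g x) xi = ftr f xi - ftr g xi.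
Proof.
move=> cf cg; rewrite /ftr -cintegralB; [|exact: cintegrable_phase..].
by apply: eq_cintegral => x; rewrite mulrBl.
Qed.

Lemma cabs_phase_transform_le f xi : cintegrable mu f ->
  cabs (ftr f xi) <= \int[mu]_x cabs (f x).
Proof.
move=> cf; rewrite (le_trans (cabs_cintegral_le _))//.
  exact: cintegrable_phase.
rewrite le_eqVlt; apply/orP; left; apply/eqP/eq_Rintegral => x _.
by rewrite cabsM cabs_expi mulr1.
Qed.

(** Against an integrable weight the square of the transform unfolds into a
double integral of [f] against the transform of the weight; for the weights
that approximate 1 the latter concentrates on the diagonal. *)
Lemma phase_transform_weighted f (w : T -> R) : cintegrable mu f ->
  mu.-integrable setT (EFin \o w) ->
  \int[mu]_xi (w xi * cabs (ftr f xi) ^+ 2) =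
  Re (cintegral mu setT (fun x => f x * conjc (cintegral mu setT (fun y => f y *
    cintegral mu setT (fun xi => rc (w xi) * expi (q y xi - q x xi)))))).
Proof.
move=> cf iw.
have mf := cintegrable_meas cf.
have cw : cintegrable mu (fun xi => rc (w xi)).
  split => //; exact: integrable0.
have mft := cmeasurable_phase_transform mf.
have ftr_le xi : cabs (ftr f xi) <= \int[mu]_x cabs (f x).
  exact: cabs_phase_transform_le.
have cwf : cintegrable mu (fun xi => rc (w xi) * conjc (ftr f xi)).
  apply: (cintegrableMb cw (cmeasurableJ mft)) => xi.
  by rewrite cabsJ; exact: ftr_le.
have E1 (p : T * T) : cabs (expi (q p.1 p.2) : R[i]) <= 1 by rewrite cabs_expi.
have swap1 := cintegral_kernel_swap cf cwf mE E1.
have -> : \int[mu]_xi (w xi * cabs (ftr f xi) ^+ 2) =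
    Re (cintegral mu setT (fun xi => rc (w xi) * conjc (ftr f xi) * ftr f xi)).
  transitivity (Re (cintegral mu setT (fun xi => rc (w xi * cabs (ftr f xi) ^+ 2)))).
    by rewrite cintegral_real.
  congr (Re _); apply: eq_cintegral => xi.
  by rewrite -mulrA (mulrC (conjc _)) mulcJ_real -rmorphM.
rewrite swap1; apply: (congr1 (@complex.Re R)); apply: eq_cintegral => x.
apply: (congr1 ( *%R (f x))).
have mEN : cmeasurable (fun xi => expi (- q x xi) : R[i]).
  by under eq_fun do rewrite expiN; exact: cmeasurableJ (mE1 x).
have EN1 xi : cabs (expi (- q x xi) : R[i]) <= 1 by rewrite cabs_expi.
have cwe : cintegrable mu (fun xi => rc (w xi) * expi (- q x xi)).
  exact: (cintegrableMb cw mEN EN1).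
have swap2 := cintegral_kernel_swap cf cwe mE E1.
transitivity (conjc (cintegral mu setT
    (fun xi => rc (w xi) * expi (- q x xi) * ftr f xi))).
  rewrite -cintegralJ.
    apply: eq_cintegral => xi.
    by rewrite !conjM conj_real expiN conjK mulrAC.
  exact: (cintegrableMb cwe mft ftr_le).
rewrite swap2; apply: (congr1 (@conjc _)); apply: eq_cintegral => y.
apply: (congr1 ( *%R (f y))).
by apply: eq_cintegral => xi; rewrite expiD; ring.
Qed.

(** Stated for [sqint], hence without integrability conditions on the transform. *)
Definition isometric f := sqint mu (ftr f) = sqint mu f.

Lemma limn_einf_le (u : nat -> \bar R) (c : \bar R) :
  (forall k, u k <= c)%E -> (limn_einf u <= c)%E.
Proof.
move=> uc; rewrite limn_einf_lim; apply: lime_le; first exact: is_cvg_einfs.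
apply: nearW => k; rewrite (le_trans _ (uc k))//.
by apply: ereal_inf_lbound; exists k => //=.
Qed.

(** If the transform is isometric on a class of functions stable under
differences, then by Fatou's lemma it is isometric on every function that the
class approximates simultaneously in L^1 and in L^2. *)
Lemma isometric_closure (G : set (T -> R[i])) f :
  (forall g, G g -> [/\ cintegrable mu g, cL2 mu g & isometric g]) ->
  (forall g h, G g -> G h -> G (fun x => g x - h x)) ->
  cintegrable mu f -> cL2 mu f ->
  (forall e : R, 0 < e -> exists g, [/\ G g,
     \int[mu]_x cabs (f x - g x) <= e &
     (sqint mu (fun x => f x - g x)%R <= e%:E)%E]) ->
  isometric f.
Proof.
move=> GP GB cf f2 approx.
have mf := cintegrable_meas cf.
suff key (e : R) : 0 < e -> exists g, [/\ G g,
    (L2n mu (fun x => f x - g x)%R <= e%:E)%E &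
    (L2n mu (fun x => ftr f x - ftr g x)%R <= e%:E)%E].
  suff L2E : L2n mu (ftr f) = L2n mu f.
    move: L2E; rewrite !L2nE /isometric => L2E.
    by rewrite -(sqr_sqrte (sqint_ge0 _ _)) L2E sqr_sqrte// sqint_ge0.
  have [_ f2oo] := f2.
  apply/eqP; rewrite eq_le; apply/andP; split.
    apply/lee_addgt0Pr => e e0; have [g [Gg g1 g2]] := key _ (divr_gt0 e0 (ltr0Sn _ 1)).
    have [cg [mg _] ig] := GP _ Gg.
    rewrite (le_trans (L2n_triangle mu (cmeasurable_phase_transform mf)
      (cmeasurable_phase_transform mg)))//.
    rewrite (_ : L2n mu (ftr g) = L2n mu g); last by rewrite !L2nE ig.
    rewrite [e in leRHS](splitr e) EFinD addeA leeD//.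
    rewrite (le_trans (L2n_triangle mu mg mf))// leeD2l//.
    by rewrite (@eq_L2n _ _ _ _ _ (fun x => f x - g x))// => x; rewrite -cabsN opprB.
  apply/lee_addgt0Pr => e e0; have [g [Gg g1 g2]] := key _ (divr_gt0 e0 (ltr0Sn _ 1)).
  have [cg [mg _] ig] := GP _ Gg.
  rewrite (le_trans (L2n_triangle mu mf mg))//.
  rewrite [e in leRHS](splitr e) EFinD addeA leeD//.
  rewrite (_ : L2n mu g = L2n mu (ftr g)); last by rewrite !L2nE ig.
  rewrite (le_trans (L2n_triangle mu (cmeasurable_phase_transform mg)
      (cmeasurable_phase_transform mf)))// leeD2l//.
  rewrite (@eq_L2n _ _ _ _ _ (fun x => ftr f x - ftr g x))// => x.
  by rewrite -cabsN opprB.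
move=> e0.
have e4 : 0 < e ^+ 2 / 4 by rewrite divr_gt0// exprn_gt0.
have [g [Gg g1 g2]] := approx _ e4; exists g.
have [cg g2' _] := GP _ Gg; have [mg _] := g2'.
have sqrt_le (h : T -> R[i]) : (sqint mu h <= (e ^+ 2)%:E)%E ->
    (L2n mu h <= e%:E)%E.
  move=> he; rewrite L2nE (_ : e%:E = sqrte (e ^+ 2)%:E); last first.
    by rewrite /= sqrtr_sqr gtr0_norm.
  by rewrite lee_sqrt// lee_fin sqr_ge0.
split => //.
  by apply: sqrt_le; rewrite (le_trans g2)// lee_fin; have := sqr_ge0 e; lra.
have ek k : 0 < Num.min (k.+1%:R^-1) (e ^+ 2 / 4) :> R.
  by rewrite lt_min e4 andbT invr_gt0.
(* A sequence in the class that converges to [f] in L^1: its transforms converge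
   uniformly to that of [f], and Fatou's lemma bounds the L^2 distance to [g]. *)
have /choice[h hP] : forall k, exists g, [/\ G g,
    \int[mu]_x cabs (f x - g x) <= Num.min (k.+1%:R^-1) (e ^+ 2 / 4) &
    (sqint mu (fun x => f x - g x)%R <= (Num.min (k.+1%:R^-1) (e ^+ 2 / 4))%:E)%E].
  by move=> k; exact: approx.
have hG k : G (h k) by have [] := hP k.
apply: sqrt_le.
have mhg k : cmeasurable (fun x => h k x - g x).
  by apply: cmeasurableB => //; have [_ [? _] _] := GP _ (hG k).
have sqhg k : (sqint mu (ftr (fun x => h k x - g x)%R) <= (e ^+ 2)%:E)%E.
  have [ch [mh _] ih] := GP _ (hG k).
  have [_ _ ->] := GP _ (GB _ _ (hG k) Gg).
  rewrite (@eq_sqint _ _ _ _ _ (fun x => (f x - g x) - (f x - h k x))); last first.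
    by move=> x; congr cabs; ring.
  apply: (le_trans (sqintB_le mu (cmeasurableB mf mg) (cmeasurableB mf mh))).
  have -> : e ^+ 2 = 2 * (e ^+ 2 / 4) + 2 * (e ^+ 2 / 4) by field.
  rewrite [leRHS]EFinD (EFinM 2); apply: leeD; first by rewrite lee_pmul2l.
  rewrite lee_pmul2l//.
  have [_ _ le_hk] := hP k; rewrite (le_trans le_hk)// lee_fin.
  by rewrite ge_min lexx orbT.
pose u k x : \bar R := (cabs (ftr (fun x => h k x - g x) x) ^+ 2)%:E.
have mu_ k : measurable_fun setT (u k).
  by apply: measurable_sqint; exact: cmeasurable_phase_transform.
have u0 k x : setT x -> (0 <= u k x)%E by move=> _; rewrite lee_fin sqr_ge0.
have fat := fatou mu measurableT mu_ u0.
apply: le_trans (limn_einf_le sqhg).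
apply: le_trans fat.
rewrite /sqint le_eqVlt; apply/orP; left; apply/eqP.
apply: eq_integral => x _; apply/esym.
have ulim : u k x @[k --> \oo] --> (cabs (ftr f x - ftr g x) ^+ 2)%:E.
  apply: cvg_EFin; first exact: nearW.
  rewrite /u /comp /=.
  under eq_fun => k do rewrite expr2.
  rewrite expr2; suff lim : cabs (ftr (fun x => h k x - g x) x) @[k --> \oo] -->
    cabs (ftr f x - ftr g x) by exact: cvgM.
  apply/cvgrPdist_le => r r0; near=> k.
  have [ch [mh _] ih] := GP _ (hG k).
  rewrite phase_transformB//.
  rewrite (le_trans (cabs_dist _ _))//.
  rewrite (_ : _ - _ - _ = ftr f x - ftr (h k) x); last by ring.
  rewrite -phase_transformB//.
  rewrite (le_trans (cabs_phase_transform_le _ _))//; first exact: cintegrableB.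
  have [_ le_hk _] := hP k; rewrite (le_trans le_hk)//.
  rewrite ge_min ltW//.
  near: k; exact: (near_infty_natSinv_lt (PosNum r0)).
by rewrite is_cvg_limn_einfE; [exact: cvg_lim ulim|apply/cvg_ex; eexists; exact: ulim].
Unshelve. all: by end_near. Qed.

End phase_transform.

(** * One-dimensional changes of variables and the Poisson kernel *)

Section real_line.
Context {R : realType}.
Local Notation leb := (@lebesgue_measure R).

Lemma measurable_affine (a r : R) :
  measurable_fun [set: measurableTypeR R] (fun x : measurableTypeR R =>
    (a + r * x : measurableTypeR R)).
Proof.
apply: continuous_measurable_fun => x.
by apply: cvgD; [exact: cvg_cst|apply: cvgM; [exact: cvg_cst|exact: cvg_id]].
Qed.

Lemma ge0_integral_affine (a r : R) (f : R -> \bar R) : 0 < r ->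
  measurable_fun [set: measurableTypeR R] f -> (forall x, (0 <= f x)%E) ->
  (\int[leb]_x f x = r%:E * \int[leb]_x f (a + r * x)%R)%E.
Proof.
move=> r0 mf f0.
pose phi : measurableTypeR R -> measurableTypeR R := fun x => a + r * x.
have mphi : measurable_fun [set: measurableTypeR R] phi by exact: measurable_affine.
have -> : (\int[leb]_x f (a + r * x)%R = \int[leb]_x (f \o phi) x)%E by [].
rewrite -[in RHS](@preimage_setT _ _ phi).
rewrite -(ge0_integral_pushforward mphi leb measurableT mf)//.
rewrite -(ge0_integral_mscale _ measurableT (NngNum (ltW r0)))//.
  apply: eq_measure_integral => A mA _.
  apply: lebesgue_measure_unique => //= _ [[c d]] _ <-.
  rewrite /mscale/= /pushforward (_ : phi @^-1` _ =
      `](c - a) / r, (d - a) / r]%classic); last first.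
    apply/seteqP; split => x /=; rewrite !in_itv/= /phi.
      by rewrite ltr_pdivrMr// ler_pdivlMr// ltrBlDl lerBrDl (mulrC x).
    by rewrite ltr_pdivrMr// ler_pdivlMr// ltrBlDl lerBrDl (mulrC x).
  rewrite !lebesgue_measure_itv/= !lte_fin ltr_pM2r ?invr_gt0// ltrD2r.
  case: ifPn => _; last by rewrite mule0.
  by rewrite -!EFinB -EFinM; congr (_%:E); field; rewrite gt_eqF.
Qed.

Lemma integral_affine (a r : R) (f : R -> R) : 0 < r ->
  leb.-integrable setT (EFin \o f) ->
  \int[leb]_x f x = r * \int[leb]_x f (a + r * x).
Proof.
move=> r0 intf.
have mf : measurable_fun [set: measurableTypeR R] (EFin \o f).
  exact: measurable_int intf.
have E (g : measurableTypeR R -> \bar R) :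
    measurable_fun [set: measurableTypeR R] g ->
    (forall x, (0 <= g x)%E) -> leb.-integrable setT g ->
    fine (\int[leb]_x g x)%E = r * fine (\int[leb]_x g (a + r * x)%R)%E.
  move=> mg g0 ig; rewrite (ge0_integral_affine a r0)// fineM//.
  rewrite ge0_fin_numE; last by apply: integral_ge0 => x _.
  rewrite ltNge leye_eq; apply/negP => /eqP Eoo.
  have := integrable_lty measurableT ig.
  by rewrite (ge0_integral_affine a r0)// Eoo gt0_muley ?lte_fin// ltxx.
have ip := integrable_funepos measurableT intf.
have in_ := integrable_funeneg measurableT intf.
have mg_fin (g : measurableTypeR R -> \bar R) :
    measurable_fun [set: measurableTypeR R] g ->
    (forall x, (0 <= g x)%E) -> leb.-integrable setT g ->
    (\int[leb]_x g (a + r * x)%R)%E \is a fin_num.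
  move=> mg g0 ig; rewrite ge0_fin_numE; last by apply: integral_ge0 => x _.
  rewrite ltNge leye_eq; apply/negP => /eqP Eoo.
  have := integrable_lty measurableT ig.
  by rewrite (ge0_integral_affine a r0)// Eoo gt0_muley ?lte_fin// ltxx.
have mp := measurable_funepos mf.
have mn := measurable_funeneg mf.
rewrite /Rintegral [in LHS]integralE [in RHS]integralE.
rewrite fineB; [|exact: integrable_fin_num..].
rewrite (E _ mp)//; rewrite (E _ mn)//.
rewrite -mulrBr -fineB.
- congr (_ * fine (_ - _)); apply: eq_integral => x _.
    by rewrite !funeposE.
  by rewrite !funenegE.
- by apply: (mg_fin _ mp _ ip) => x; exact: funepos_ge0.
- by apply: (mg_fin _ mn _ in_) => x; exact: funeneg_ge0.
Qed.

Lemma cintegral_affine (a r : R) (f : R -> R[i]) : 0 < r ->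
  cintegrable leb f ->
  cintegral leb setT f = rc r * cintegral leb setT (fun x => f (a + r * x)).
Proof.
move=> r0 [f1 f2]; apply: complex_ext; rewrite ?ReM ?ImM/=.
  by rewrite mul0r subr0 (integral_affine a r0 f1).
by rewrite mul0r addr0 (integral_affine a r0 f2).
Qed.

Lemma odd_Rintegral0 (f : R -> R) : leb.-integrable setT (EFin \o f) ->
  (forall x, f (- x) = - f x) -> \int[leb]_x f x = 0.
Proof.
move=> intf oddf.
have mN : measurable_fun [set: measurableTypeR R] (-%R : _ -> measurableTypeR R).
  exact: oppr_measurable.
have : \int[leb]_x f x = \int[leb]_x f (- x).
  congr fine; transitivity
    (\int[pushforward leb (-%R : _ -> measurableTypeR R)]_x (f x)%:E)%E.
    by apply: eq_measure_integral => A mA _; exact/esym/lebesgue_measureN.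
  rewrite integral_pushforward//; first exact: measurable_int intf.
  rewrite (_ : _ \o _ = \- (EFin \o f))%E; first exact: integrableN.
  by apply/funext => x /=; rewrite oddf EFinN.
under [RHS]eq_Rintegral do rewrite oddf -mulN1r.
by rewrite RintegralZl// mulN1r; lra.
Qed.

(** The summand 1 makes the integrand nonnegative, so that the fundamental theorem
of calculus on the half-line applies to the explicit primitive. *)
Lemma integral_expR_cos (a b : R) : 0 < a ->
  (\int[leb]_x (expR (- (a * `|x|)) * (1 + cos (b * x)))%:E =
   (2 / a + 2 * a / (a ^+ 2 + b ^+ 2))%:E)%E.
Proof.
move=> a0.
have ab0 : a ^+ 2 + b ^+ 2 != 0.
  by rewrite gt_eqF// ltr_wpDr ?sqr_ge0// exprn_gt0.
pose f (x : R) : R := expR (- (a * x)) * (1 + cos (b * x)).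
pose F (x : R) : R := - expR (- (a * x)) / a +
  expR (- (a * x)) * (b * sin (b * x) - a * cos (b * x)) / (a ^+ 2 + b ^+ 2).
have dF (x : R) : is_derive x 1 F (f x).
  rewrite /F; apply: is_derive_eq.
  rewrite /f /GRing.scale/=; field.
  by rewrite ab0 gt_eqF.
have cosle t : 0 <= 1 + cos t :> R by rewrite -lerBlDl sub0r cos_geN1.
have cf : continuous f.
  move=> x; apply: cvgM.
    apply: continuous_comp; last exact: continuous_expR.
    by apply: cvgN; apply: cvgM; [exact: cvg_cst|exact: cvg_id].
  apply: cvgD; first exact: cvg_cst.
  apply: continuous_comp; last exact: continuous_cos.
  by apply: cvgM; [exact: cvg_cst|exact: cvg_id].
rewrite (@ge0_symfun_integralT _ (fun x => expR (- (a * `|x|)) * (1 + cos (b * x)))).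
- rewrite -set_itvcy.
  transitivity (2%:E * \int[leb]_(x in `[0%R, +oo[) (f x)%:E)%E.
    congr (_ * _)%E; apply: eq_integral => x; rewrite inE/= in_itv/= andbT => x0.
    by rewrite ger0_norm.
  rewrite (@ge0_continuous_FTC2y _ f F 0 0).
  + rewrite /F !mulr0 oppr0 expR0 sin0 cos0 -EFinB -EFinM; congr (_%:E).
    by field; rewrite ab0 gt_eqF.
  + by move=> x _; rewrite mulr_ge0 ?expR_ge0.
  + exact: continuous_subspaceT.
  + have e0 : expR (- (a * x)) @[x --> +oo%R] --> (0 : R).
      have axy : a * x @[x --> +oo%R] --> +oo by apply: gt0_cvgMry => //; exact: cvg_id.
      exact: (cvg_comp _ _ axy (@cvgr_expR R)).
    pose M := a^-1 + (`|b| + `|a|) / (a ^+ 2 + b ^+ 2).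
    have Fle x : `|F x| <= M * expR (- (a * x)).
      have -> : F x = (- a^-1 + (b * sin (b * x) - a * cos (b * x)) /
          (a ^+ 2 + b ^+ 2)) * expR (- (a * x)) by rewrite /F; ring.
      rewrite normrM (ger0_norm (expR_ge0 _)) ler_wpM2r ?expR_ge0//.
      rewrite (le_trans (ler_normD _ _))// lerD//.
        by rewrite normrN ger0_norm// invr_ge0 ltW.
      rewrite normrM [X in _ * X]ger0_norm; last first.
        by rewrite invr_ge0 addr_ge0 ?sqr_ge0.
      rewrite ler_wpM2r ?invr_ge0 ?addr_ge0 ?sqr_ge0//.
      rewrite (le_trans (ler_normB _ _))// !normrM lerD// ler_piMr//.
        by rewrite ler_norml sin_geN1 sin_le1.
      by rewrite ler_norml cos_geN1 cos_le1.
    apply: (@squeeze_cvgr _ _ _ _ (fun x => - (M * expR (- (a * x))))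
      (fun x => M * expR (- (a * x)))).
    - by apply: nearW => x; rewrite -ler_norml Fle.
    - rewrite -oppr0; apply: cvgN; rewrite -(mulr0 M).
      by apply: cvgM => //; exact: cvg_cst.
    - by rewrite -(mulr0 M); apply: cvgM => //; exact: cvg_cst.
  + by move=> x _; have [] := dF x.
  + apply: cvg_at_right_filter; apply: differentiable_continuous.
    by apply/derivable1_diffP; have [] := dF 0.
  + by move=> x _; rewrite derive1E; exact: derive_val.
- by move=> x; rewrite mulr_ge0 ?expR_ge0.
- move=> x; apply: cvgM.
    apply: continuous_comp; last exact: continuous_expR.
    by apply: cvgN; apply: cvgM; [exact: cvg_cst|exact: norm_continuous].
  apply: cvgD; first exact: cvg_cst.
  apply: continuous_comp; last exact: continuous_cos.
  by apply: cvgM; [exact: cvg_cst|exact: cvg_id].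
- by move=> x /=; rewrite normrN mulrN cosN.
Qed.

(** The weight is chosen because its transform is known in closed form and is
nonnegative: it is the Poisson kernel. *)
Definition exp_weight (a : R) (xi : R) : R := expR (- (a * `|xi|)).

Lemma exp_weight_ge0 a xi : 0 <= exp_weight a xi.
Proof. exact: expR_ge0. Qed.

Lemma continuous_exp_weight a : continuous (exp_weight a).
Proof.
move=> x; apply: continuous_comp; last exact: continuous_expR.
by apply: cvgN; apply: cvgM; [exact: cvg_cst|exact: norm_continuous].
Qed.

Lemma continuous_linear_cos (b : R) : continuous (fun x => cos (b * x)).
Proof.
move=> x; apply: continuous_comp; last exact: continuous_cos.
by apply: cvgM; [exact: cvg_cst|exact: cvg_id].
Qed.

Lemma integrable_exp_weight a : 0 < a ->
  leb.-integrable setT (EFin \o exp_weight a).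
Proof.
move=> a0.
have mw : measurable_fun [set: measurableTypeR R] (exp_weight a).
  by apply: continuous_measurable_fun; exact: continuous_exp_weight.
apply/integrableP; split; first exact/measurable_EFinP.
apply: le_lt_trans (ltry (2 / a + 2 * a / (a ^+ 2 + 0 ^+ 2))).
rewrite -integral_expR_cos//; apply: ge0_le_integral => //.
- by apply/measurable_EFinP; exact: measurableT_comp.
- apply/measurable_EFinP/measurable_funM => //.
  apply: continuous_measurable_fun => x; apply: cvgD; first exact: cvg_cst.
  exact: continuous_linear_cos.
- move=> x _; rewrite lee_fin mul0r cos0 ger0_norm ?exp_weight_ge0//.
  by rewrite ler_peMr ?exp_weight_ge0//; lra.
Qed.

(** The imaginary part is an odd integral; the real part is the integral of
[1 + cos] minus the same integral at frequency 0. *)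
Lemma cintegral_exp_weight (a b : R) : 0 < a ->
  cintegral leb setT (fun xi => rc (exp_weight a xi) * expi (b * xi)) =
  rc (2 * a / (a ^+ 2 + b ^+ 2)).
Proof.
move=> a0.
have half (p r : R) : p + p = r + r -> p = r by lra.
have iw := integrable_exp_weight a0.
have bounded_trig (h : R -> R) : measurable_fun [set: measurableTypeR R] h ->
    (forall x, `|h x| <= 1) ->
    leb.-integrable setT (EFin \o (fun x => exp_weight a x * h x)).
  move=> mh h1; apply: le_integrable iw => //.
    apply/measurable_EFinP/measurable_funM => //.
    by apply: continuous_measurable_fun; exact: continuous_exp_weight.
  by move=> x _ /=; rewrite lee_fin normrM ler_piMr.
have mcos (c : R) : measurable_fun [set: measurableTypeR R] (fun x => cos (c * x)).
  by apply: continuous_measurable_fun; exact: continuous_linear_cos.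
have intc (c : R) : \int[leb]_x (exp_weight a x) +
    \int[leb]_x (exp_weight a x * cos (c * x)) =
    2 / a + 2 * a / (a ^+ 2 + c ^+ 2).
  rewrite -RintegralD//; last first.
    by apply: bounded_trig => // x; exact: cos_max.
  rewrite -[RHS]/(fine (2 / a + 2 * a / (a ^+ 2 + c ^+ 2))%:E).
  rewrite -integral_expR_cos//; congr fine; apply: eq_integral => x _.
  by rewrite mulrDr mulr1.
have int1 : \int[leb]_x (exp_weight a x) = 2 / a.
  have := intc 0; under [X in _ + X]eq_Rintegral do rewrite mul0r cos0 mulr1.
  have -> : 2 * a / (a ^+ 2 + 0 ^+ 2) = 2 / a by field; rewrite gt_eqF.
  exact: half.
apply: complex_ext => /=.
  under eq_Rintegral do rewrite mul0r subr0.
  by have := intc b; rewrite int1 => /addrI.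
under eq_Rintegral do rewrite mul0r addr0.
apply: odd_Rintegral0.
  apply: bounded_trig; last by move=> x; exact: sin_max.
  apply: continuous_measurable_fun => x.
  apply: continuous_comp; last exact: continuous_sin.
  by apply: cvgM; [exact: cvg_cst|exact: cvg_id].
by move=> x; rewrite /exp_weight normrN mulrN sinN mulrN.
Qed.

Definition poisson (z : R) : R := pi^-1 * (oneDsqr z)^-1.

Lemma poisson_ge0 z : 0 <= poisson z.
Proof. by rewrite mulr_ge0// invr_ge0 ?pi_ge0// ltW// oneDsqr_gt0. Qed.

Lemma continuous_poisson : continuous poisson.
Proof.
by move=> z; apply: cvgM; [exact: cvg_cst|exact: continuous_oneDsqrV].
Qed.

Lemma integral_poisson : (\int[leb]_z (poisson z)%:E = 1)%E.
Proof.
rewrite ge0_symfun_integralT.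
- rewrite -set_itvcy /poisson.
  under eq_integral do rewrite EFinM.
  rewrite ge0_integralZl//.
  + rewrite integral0y_oneDsqr -!EFinM; congr (_%:E).
    by rewrite mulKf ?divff// gt_eqF// pi_gt0.
  + apply/measurable_EFinP; apply: measurable_funTS.
    by apply: continuous_measurable_fun; exact: continuous_oneDsqrV.
  + by rewrite lee_fin invr_ge0 pi_ge0.
- exact: poisson_ge0.
- exact: continuous_poisson.
- by move=> x /=; rewrite /poisson /oneDsqr sqrrN.
Qed.

Lemma integrable_poisson : leb.-integrable setT (EFin \o poisson).
Proof.
apply/integrableP; split.
  apply/measurable_EFinP; apply: continuous_measurable_fun.
  exact: continuous_poisson.
under eq_integral do rewrite /= ger0_norm ?poisson_ge0//.
by rewrite integral_poisson ltry.
Qed.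

End real_line.

(** * Plancherel's identity on the line *)

Section complex_limits.
Context {R : realType}.

Lemma cvg_cabs0 (f : nat -> R[i]) (l : R[i]) :
  Re (f k) @[k --> \oo] --> Re l -> Im (f k) @[k --> \oo] --> Im l ->
  cabs (f k - l) @[k --> \oo] --> (0 : R).
Proof.
move=> f1 f2.
apply: (@squeeze_cvgr _ _ _ _ (fun=> 0)
  (fun k => `|Re (f k) - Re l| + `|Im (f k) - Im l|)).
- by apply: nearW => k; rewrite cabs_ge0 (le_trans (cabs_le_ReIm _))// !ReImE.
- exact: cvg_cst.
- rewrite -[X in _ --> X](addr0 (0 : R)); apply: cvgD.
    rewrite -(@normr0 _ R) -(subrr (Re l)); apply: cvg_norm; apply: cvgB => //.
    exact: cvg_cst.
  rewrite -(@normr0 _ R) -(subrr (Im l)); apply: cvg_norm; apply: cvgB => //.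
  exact: cvg_cst.
Qed.

Lemma cvg0_cabsM (f : nat -> R[i]) (c : R[i]) :
  cabs (f k) @[k --> \oo] --> (0 : R) -> cabs (f k * c) @[k --> \oo] --> (0 : R).
Proof.
move=> f0; under eq_fun do rewrite cabsM.
by rewrite -(mul0r (cabs c)); apply: cvgM => //; exact: cvg_cst.
Qed.

End complex_limits.

Lemma integrable_indic_fin {R : realType} {d} {T : measurableType d}
    (mu : {measure set T -> \bar R}) (A : set T) :
  measurable A -> (mu A < +oo)%E -> mu.-integrable setT (EFin \o (\1_A : T -> R)).
Proof.
move=> mA Afin; apply/integrableP; split; first exact/measurable_EFinP/measurable_indic.
under eq_integral do rewrite /= ger0_norm ?indicE//.
by rewrite (_ : (fun _ => _) = EFin \o \1_A)// integral_indic// setIT.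
Qed.

Section bounded_support.
Context {R : realType} {d} {T : measurableType d} (mu : {measure set T -> \bar R}).
Variables (A : set T) (M : R) (g : T -> R[i]).
Hypotheses (mA : measurable A) (Afin : (mu A < +oo)%E) (mg : cmeasurable g).
Hypothesis gM : forall x, cabs (g x) <= M * \1_A x.

Let iA : mu.-integrable setT (EFin \o (\1_A : T -> R)).
Proof. exact: integrable_indic_fin. Qed.

Lemma bounded_support_cintegrable : cintegrable mu g.
Proof.
apply: (cintegrable_le mg _ gM).
by have := integrableZl measurableT M iA.
Qed.

Lemma bounded_support_cL2 : cL2 mu g.
Proof.
split => //; have [_] := integrableP _ _ _ (integrableZl measurableT (M ^+ 2) iA).
apply: le_lt_trans; apply: ge0_le_integral => //.
- by move=> x _; rewrite lee_fin sqr_ge0.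
- exact: measurable_sqint.
- apply: measurableT_comp => //; apply/measurable_EFinP/measurable_funM => //.
- move=> x _ /=; rewrite lee_fin ger0_norm; last first.
    by rewrite mulr_ge0 ?sqr_ge0// indicE.
  rewrite (le_trans (_ : _ <= (M * \1_A x) ^+ 2))//.
    by rewrite ler_pXn2r ?nnegrE ?cabs_ge0 ?gM// (le_trans (cabs_ge0 _) (gM x)).
  by rewrite exprMn indicE; case: (x \in A); rewrite ?expr1n ?expr0n.
Qed.

End bounded_support.

Section plancherel_line.
Context {R : realType}.
Local Notation leb := (@lebesgue_measure R).
Local Notation Rm := (measurableTypeR R).

Definition line_phase (x xi : Rm) : R := - (2 * pi * (x * xi)).

Lemma measurable_line_phase :
  measurable_fun setT (fun p : Rm * Rm => line_phase p.1 p.2).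
Proof.
apply: (@measurable_funN _ _ _ _ (fun p : Rm * Rm => 2 * pi * (p.1 * p.2))).
apply: measurable_funM; first exact: measurable_cst.
by apply: measurable_funM; [exact: measurable_fst|exact: measurable_snd].
Qed.

Local Notation ftr := (phase_transform leb line_phase).

(** The weighted square of the transform is [g] paired with its convolution by
the Poisson kernel of width [e], written after the substitution [y = x + e z]. *)
Lemma line_weighted (e : R) (g : Rm -> R[i]) : 0 < e -> cintegrable leb g ->
  (forall x, cintegrable leb (fun z => g (x + e * z) * rc (poisson z))) ->
  \int[leb]_xi (exp_weight (2 * pi * e) xi * cabs (ftr g xi) ^+ 2) =
  Re (cintegral leb setT (fun x => g x * conjc
    (cintegral leb setT (fun z => g (x + e * z) * rc (poisson z))))).
Proof.
move=> e0 cg cgp.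
have a0 : 0 < 2 * pi * e by rewrite !mulr_gt0// pi_gt0.
rewrite (phase_transform_weighted measurable_line_phase cg (integrable_exp_weight a0)).
apply: (congr1 (@complex.Re R)); apply: eq_cintegral => x.
apply: (congr1 ( *%R (g x))); apply: (congr1 (@conjc R)).
have pos t : 0 < e ^+ 2 + t ^+ 2 :> R by rewrite ltr_wpDr ?sqr_ge0// exprn_gt0.
pose P y : R := pi^-1 * (e / (e ^+ 2 + (x - y) ^+ 2)).
transitivity (cintegral leb setT (fun y => g y * rc (P y))).
  apply: eq_cintegral => y; apply: (congr1 ( *%R (g y))).
  transitivity (cintegral leb setT (fun xi =>
      rc (exp_weight (2 * pi * e) xi) * expi (2 * pi * (x - y) * xi))).
    apply: eq_cintegral => xi; congr (_ * expi _); rewrite /line_phase; ring.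
  rewrite cintegral_exp_weight//; congr rc; rewrite /P.
  rewrite (_ : (2 * pi * e) ^+ 2 + _ = 4 * pi ^+ 2 * (e ^+ 2 + (x - y) ^+ 2)); last by ring.
  have : e ^+ 2 + (x - y) ^+ 2 != 0 by rewrite gt_eqF// pos.
  have : pi != 0 :> R by rewrite gt_eqF// pi_gt0.
  move: (e ^+ 2 + _) (@pi R) => D p p0 D0; field; rewrite D0 p0.
  by [].
have PE z : P (x + e * z) = e^-1 * poisson z.
  rewrite /P /poisson /oneDsqr.
  rewrite (_ : e ^+ 2 + (x - (x + e * z)) ^+ 2 = e ^+ 2 * (1 + z ^+ 2)); last by ring.
  have z0 : 1 + z ^+ 2 != 0 by rewrite gt_eqF// ltr_wpDr ?sqr_ge0.
  have en0 : e != 0 by rewrite gt_eqF.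
  have pn0 : pi != 0 :> R by rewrite gt_eqF// pi_gt0.
  rewrite [RHS]mulrCA; congr (_ * _); move: (1 + z ^+ 2) z0 => D D0.
  by field; rewrite en0 D0.
rewrite (cintegral_affine x e0); last first.
  have mP : measurable_fun setT (P : Rm -> R).
    apply: continuous_measurable_fun => y; apply: cvgM; first exact: cvg_cst.
    apply: cvgM; first exact: cvg_cst.
    apply: cvgV; first by rewrite gt_eqF.
    apply: cvgD; first exact: cvg_cst.
    rewrite expr2; under eq_fun do rewrite expr2.
    by apply: cvgM; (apply: cvgB; [exact: cvg_cst|exact: cvg_id]).
  apply: (cintegrableMb (M := pi^-1 * e^-1) cg); first exact: cmeasurable_real.
  move=> y; rewrite cabs_real ger0_norm; last first.
    by rewrite /P !mulr_ge0 ?invr_ge0 ?pi_ge0 ?ltW.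
  rewrite ler_wpM2l ?invr_ge0 ?pi_ge0// ler_pdivrMr// ler_pdivlMl//.
  by rewrite -expr2 lerDl sqr_ge0.
transitivity (rc e * cintegral leb setT
    (fun z => rc e^-1 * (g (x + e * z) * rc (poisson z)))).
  congr (_ * _); apply: eq_cintegral => z; rewrite PE rmorphM/= mulrCA.
  by [].
rewrite cintegralZ// mulrA -rmorphM/= divff ?gt_eqF// mul1r.
by [].
Qed.

Definition cont_comp_supp (g : Rm -> R[i]) :=
  [/\ continuous (fun x : R => Re (g x)), continuous (fun x : R => Im (g x)) &
     exists M K : R, forall x : R, cabs (g x) <= M * \1_(`[-K, K]%classic : set R) x].

Section cont_comp_supp_isometric.
Variable g : Rm -> R[i].
Hypothesis gP : cont_comp_supp g.

Let mg : cmeasurable g.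
Proof. by have [g1 g2 _] := gP; split; exact: continuous_measurable_fun. Qed.

Lemma cont_comp_supp_L12 : cintegrable leb g /\ cL2 leb g.
Proof.
have [_ _ [M [K gM]]] := gP.
have mA : measurable (`[-K, K]%classic : set Rm) by exact: measurable_itv.
have Afin : (leb (`[(- K)%R, K]%classic : set Rm) < +oo)%E.
  by rewrite lebesgue_measure_itv/=; case: ifPn => _; rewrite -?EFinB ltry.
split; first exact: (bounded_support_cintegrable mA Afin mg gM).
exact: (bounded_support_cL2 mA Afin mg gM).
Qed.

Let gb : exists2 M : R, 0 <= M & forall x, cabs (g x) <= M.
Proof.
have [_ _ [M [K gM]]] := gP; exists `|M| => // x.
rewrite (le_trans (gM x))// (le_trans (ler_norm _))// normrM ler_piMr//.
by rewrite indicE; case: (_ \in _); rewrite ?normr1 ?normr0.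
Qed.

Let cpois : cintegrable leb (fun z : Rm => rc (poisson z)).
Proof. by split; [exact: integrable_poisson|exact: integrable0]. Qed.

Let mshift (x e : R) : cmeasurable (fun z : Rm => g (x + e * z)).
Proof. exact: (cmeasurable_comp mg (measurable_affine x e)). Qed.

Let cgp (x e : R) : cintegrable leb (fun z => g (x + e * z) * rc (poisson z)).
Proof.
have [M M0 gM] := gb; under eq_fun do rewrite mulrC.
by apply: (cintegrableMb (M := M) cpois) => //; exact: mshift.
Qed.

Let avg (k : nat) (x : Rm) :=
  cintegral leb setT (fun z => g (x + k.+1%:R^-1 * z) * rc (poisson z)).

Let avg_cvg x : cabs (avg k x - g x) @[k --> \oo] --> (0 : R).
Proof.
have [M M0 gM] := gb; have [g1 g2 _] := gP.
have ip := integrableZl measurableT M (@integrable_poisson R).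
have -> : g x = cintegral leb setT (fun z => g x * rc (poisson z)).
  rewrite cintegralZ// cintegral_real /Rintegral integral_poisson/=.
  by rewrite mulr1.
have [] := @cdominated_cvg _ _ _ leb
  (fun k z => g (x + k.+1%:R^-1 * z) * rc (poisson z))
  (fun z => g x * rc (poisson z)) (fun z => M * poisson z) _ _ _ ip.
- by move=> k; exact: cintegrable_meas (cgp _ _).
- exact: cintegrable_meas (cintegrableZ _ cpois).
- apply: aeW => z.
  have yx : x + k.+1%:R^-1 * z @[k --> \oo] --> x.
    rewrite -[X in _ --> X](addr0 x); apply: cvgD; first exact: cvg_cst.
    rewrite -(mul0r z); apply: cvgM; last exact: cvg_cst.
    exact: cvg_harmonic.
  under eq_fun do rewrite -mulrBl.
  apply: cvg0_cabsM; apply: cvg_cabs0.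
    exact: (cvg_comp _ _ yx (g1 x)).
  exact: (cvg_comp _ _ yx (g2 x)).
- by move=> k z; rewrite cabsM cabs_real ger0_norm ?poisson_ge0// ler_wpM2r ?poisson_ge0.
- exact: cvg_cabs0.
Qed.

(** As the width tends to 0 the Poisson averages of [g] converge pointwise and
boundedly to [g], while the weight on the transform side increases to 1. *)
Lemma cont_comp_supp_isometric : isometric leb line_phase g.
Proof.
have [M M0 gM] := gb.
have [cg g2] := cont_comp_supp_L12.
have mft := cmeasurable_phase_transform leb measurable_line_phase mg.
pose w k := exp_weight (2 * pi * k.+1%:R^-1 : R).
have a0 k : 0 < 2 * pi * k.+1%:R^-1 :> R by rewrite !mulr_gt0// pi_gt0.
pose u k := \int[leb]_xi (w k xi * cabs (ftr g xi) ^+ 2).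
have uE k : u k = Re (cintegral leb setT (fun x => g x * conjc (avg k x))).
  exact: line_weighted.
have avgM k x : cabs (avg k x) <= M.
  apply: (le_trans (cabs_cintegral_le (cgp _ _))).
  apply: (@le_trans _ _ (\int[leb]_z (M * poisson z))).
    apply: le_Rintegral => //; first exact: integrable_cabs (cgp _ _).
      exact: (integrableZl measurableT M (@integrable_poisson R)).
    move=> z _; rewrite cabsM cabs_real ger0_norm ?poisson_ge0//.
    by rewrite ler_wpM2r ?poisson_ge0.
  rewrite RintegralZl//; last exact: integrable_poisson.
  by rewrite /Rintegral integral_poisson mulr1.
have mavg k : cmeasurable (avg k).
  have mF : cmeasurable (fun p : Rm * Rm => g (p.1 + k.+1%:R^-1 * p.2) * rc (poisson p.2)).
    apply: cmeasurableM.
      apply: (cmeasurable_comp mg (h := fun p : Rm * Rm => p.1 + k.+1%:R^-1 * p.2)).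
      apply: measurable_funD; first exact: measurable_fst.
      by apply: measurable_funM; [exact: measurable_cst|exact: measurable_snd].
    apply: cmeasurable_real; apply: (measurableT_comp _ measurable_snd).
    by apply: continuous_measurable_fun; exact: continuous_poisson.
  exact: (cmeasurable_partial leb mF).
have ulim : u k @[k --> \oo] --> fine (sqint leb g).
  have [] := @cdominated_cvg _ _ _ leb
    (fun k x => g x * conjc (avg k x)) (fun x => g x * conjc (g x))
    (fun x => cabs (g x) * M).
  - by move=> k; apply: cmeasurableM => //; exact: cmeasurableJ.
  - by apply: cmeasurableM => //; exact: cmeasurableJ.
  - apply: aeW => x.
    under eq_fun do rewrite -mulrBr mulrC.
    apply: cvg0_cabsM; apply: cvg_trans (avg_cvg x).
    apply: near_eq_cvg; apply: nearW => k.
    by rewrite -cabsJ; congr cabs; rewrite rmorphB.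
  - exact: (integrableZr measurableT M (integrable_cabs cg)).
  - by move=> k x; rewrite cabsM cabsJ ler_wpM2l ?cabs_ge0.
  move=> lim _; under eq_fun do rewrite uE.
  rewrite fine_sqint (_ : \int[_]__ _ = Re (cintegral leb setT (fun x => g x * conjc (g x))))//.
  by apply: eq_Rintegral => x _; rewrite mulcJ_real.
have cw k : cintegrable leb (fun xi : Rm => rc (w k xi)).
  by split; [exact: integrable_exp_weight|exact: integrable0].
have mS := measurable_sqr_cabs mft.
have SM xi : cabs (rc (cabs (ftr g xi) ^+ 2)) <= (\int[leb]_x cabs (g x)) ^+ 2.
  rewrite cabs_real ger0_norm ?sqr_ge0// ler_pXn2r ?nnegrE ?cabs_ge0//.
    by apply: cabs_phase_transform_le => //; exact: measurable_line_phase.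
  by apply: Rintegral_ge0 => x _; exact: cabs_ge0.
have uEFin k : (\int[leb]_xi (w k xi * cabs (ftr g xi) ^+ 2)%:E)%E = (u k)%:E.
  rewrite /u /Rintegral fineK//; apply: integrable_fin_num => //.
  have [cint_w _] := cintegrableMb (cw k) (cmeasurable_real (mS)) SM.
  apply: eq_integrable cint_w => // xi _ /=.
  by rewrite mulr0 subr0.
rewrite /isometric -[RHS]sqint_fineK//.
have wlim : (\int[leb]_xi (w k xi * cabs (ftr g xi) ^+ 2)%:E)%E @[k --> \oo] -->
    sqint leb (ftr g).
  have mwS k : measurable_fun setT (fun xi : Rm => (w k xi * cabs (ftr g xi) ^+ 2)%:E).
    apply/measurable_EFinP/measurable_funM => //.
    by apply: continuous_measurable_fun; exact: continuous_exp_weight.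
  have wS0 k (xi : Rm) : setT xi -> (0 <= (w k xi * cabs (ftr g xi) ^+ 2)%:E)%E.
    by move=> _; rewrite lee_fin mulr_ge0 ?exp_weight_ge0 ?sqr_ge0.
  have wSnd (xi : Rm) : setT xi ->
      nondecreasing_seq (fun k => (w k xi * cabs (ftr g xi) ^+ 2)%:E).
    move=> _ m k mk; rewrite lee_fin ler_wpM2r ?sqr_ge0//.
    rewrite ler_expR lerN2 ler_wpM2r// ler_wpM2l ?mulr_ge0 ?pi_ge0//.
    by rewrite lef_pV2 ?posrE// ler_nat.
  have := @cvg_monotone_convergence _ _ _ leb _ measurableT _ mwS wS0 wSnd.
  rewrite (_ : sqint _ _ = (\int[leb]_xi
    limn (fun k => (w k xi * cabs (ftr g xi) ^+ 2)%:E))%E)//.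
  apply: eq_integral => xi _; apply/esym/cvg_lim => //.
  apply: cvg_EFin; first exact: nearW.
  rewrite /comp /= -[X in _ --> X]mul1r; apply: cvgM; last exact: cvg_cst.
  have arg0 : - (2 * pi * k.+1%:R^-1 * `|xi|) @[k --> \oo] --> (0 : R).
    rewrite -(@oppr0 R) -(mul0r `|xi|).
    apply: cvgN; apply: cvgM; last exact: cvg_cst.
    rewrite -(mulr0 (2 * pi)); apply: cvgM; first exact: cvg_cst.
    exact: cvg_harmonic.
  rewrite -[X in _ --> X](@expR0 R).
  exact: (cvg_comp _ _ arg0 (@continuous_expR R 0)).
apply: (cvg_unique (@ereal_hausdorff R) wlim).
rewrite (_ : (fun _ => _) = fun k => (u k)%:E); last exact/funext.
by apply: cvg_EFin => //; exact: nearW.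
Qed.

End cont_comp_supp_isometric.

End plancherel_line.

Section line_isometric.
Context {R : realType}.
Local Notation leb := (@lebesgue_measure R).
Local Notation Rm := (measurableTypeR R).

Lemma cont_comp_suppB (g h : Rm -> R[i]) : cont_comp_supp g -> cont_comp_supp h ->
  cont_comp_supp (fun x => g x - h x).
Proof.
move=> [g1 g2 [M [K gM]]] [h1 h2 [N [L hN]]]; split.
- by under eq_fun do rewrite ReD ReN; move=> x; apply: cvgB; [exact: g1|exact: h1].
- by under eq_fun do rewrite ImD ImN; move=> x; apply: cvgB; [exact: g2|exact: h2].
- exists (`|M| + `|N|), (Num.max K L) => x.
  rewrite (le_trans (cabsD _ _))// cabsN mulrDl.
  have incl (P Q : R) y : P <= Q -> (\1_`[- P, P] y : R) <= \1_`[- Q, Q] y.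
    move=> PQ; rewrite !indicE.
    have [yP|//] := boolP (y \in `[- P, P]%classic).
    rewrite mem_set//=; move: yP; rewrite inE/= !in_itv/= => /andP[yP1 yP2].
    by rewrite (le_trans yP2 PQ) (le_trans _ yP1)// lerN2.
  rewrite lerD//.
    rewrite (le_trans (gM x))// (le_trans (_ : _ <= `|M| * \1_`[- K, K] x))//.
      by rewrite ler_wpM2r ?indicE// ler_norm.
    by rewrite ler_wpM2l// incl// le_max lexx.
  rewrite (le_trans (hN x))// (le_trans (_ : _ <= `|N| * \1_`[- L, L] x))//.
    by rewrite ler_wpM2r ?indicE// ler_norm.
  by rewrite ler_wpM2l// incl// le_max lexx orbT.
Qed.

Definition clamp (M y : R) : R := Num.max (- M) (Num.min M y).

Lemma clamp_le (M y : R) : 0 <= M -> `|clamp M y| <= M.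
Proof.
move=> M0; rewrite /clamp ler_norml le_max lexx/= ge_max ge_min lexx/= andbT.
by lra.
Qed.

Lemma clamp_id (M y : R) : `|y| <= M -> clamp M y = y.
Proof.
by rewrite ler_norml => /andP[My yM]; rewrite /clamp (min_r yM) (max_r My).
Qed.

Lemma max_lipschitz (a x y : R) : `|Num.max a x - Num.max a y| <= `|x - y|.
Proof.
have := ler_norm (y - x); have := ler_norm (x - y); rewrite (distrC y x).
by move: `|x - y| => N; case: (leP a x) => ?; case: (leP a y) => ? ? ?;
  rewrite ler_norml; lra.
Qed.

Lemma min_lipschitz (a x y : R) : `|Num.min a x - Num.min a y| <= `|x - y|.
Proof.
have minE z : Num.min a z = - Num.max (- a) (- z) by rewrite oppr_max !opprK.
rewrite !minE -opprD normrN (le_trans (max_lipschitz _ _ _))//.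
by rewrite -opprD normrN.
Qed.

Lemma clamp_lipschitz (M x y : R) : `|clamp M x - clamp M y| <= `|x - y|.
Proof. exact: le_trans (max_lipschitz _ _ _) (min_lipschitz _ _ _). Qed.

Lemma continuous_clamp (M : R) : continuous (clamp M).
Proof.
move=> x; apply/cvgrPdist_le => e e0.
have /cvgrPdist_le/(_ _ e0) : y @[y --> x] --> x by exact: cvg_id.
by apply: filterS => y; exact: le_trans (clamp_lipschitz _ _ _).
Qed.

Definition cutoff (K x : R) : R := Num.max 0 (Num.min 1 (K + 1 - `|x|)).

Lemma cutoff_ge0 K x : 0 <= cutoff K x.
Proof. by rewrite /cutoff le_max lexx. Qed.

Lemma cutoff_le (K x : R) : cutoff K x <= \1_(`[- (K + 1), K + 1]%classic : set R) x.
Proof.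
rewrite /cutoff indicE; have [xK|] := boolP (x \in _).
  by rewrite ge_max ler01 ge_min lexx.
rewrite notin_setE/= in_itv/= => xK.
rewrite ge_max lexx/= ge_min subr_le0; apply/orP; right.
by rewrite leNgt; apply/negP => /ltW; rewrite ler_norml.
Qed.

Lemma cutoff_id (K x : R) : `|x| <= K -> cutoff K x = 1.
Proof.
move=> xK; rewrite /cutoff min_l ?max_r//.
by rewrite lerBrDr addrC lerD2r.
Qed.

Lemma continuous_cutoff K : continuous (cutoff K).
Proof.
move=> x; apply/cvgrPdist_le => e e0.
have /cvgrPdist_le/(_ _ e0) : y @[y --> x] --> x by exact: cvg_id.
apply: filterS => y; apply: le_trans.
apply: le_trans (max_lipschitz _ _ _) _; apply: le_trans (min_lipschitz _ _ _) _.
rewrite opprB addrC addrA subrK distrC.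
exact: ler_dist_dist.
Qed.

(** Bounded measurable functions with bounded support are approximated in L^1
by continuous ones (Lusin); truncating these at the height and, smoothly, at
the support of the limit turns L^1 into L^2 approximation. *)
Lemma line_isometric (g : Rm -> R[i]) (M K : R) : cmeasurable g ->
  (forall x, cabs (g x) <= M * \1_(`[- K, K]%classic : set R) x) ->
  isometric leb line_phase g.
Proof.
move=> mg gMK.
have [[N N0 gN] gK] : (exists2 N : R, 0 <= N & forall x, cabs (g x) <= N) /\
    (forall x, K < `|x| -> g x = 0).
  split.
    exists `|M| => // x; rewrite (le_trans (gMK x))// (le_trans (ler_norm _))//.
    by rewrite normrM ler_piMr// indicE; case: (_ \in _); rewrite ?normr1 ?normr0.
  move=> x Kx; apply: cabs_eq0; apply/eqP; rewrite eq_le cabs_ge0 andbT.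
  rewrite (le_trans (gMK x))// indicE memNset ?mulr0//= in_itv/=.
  by rewrite -ler_norml; apply/negP; rewrite -ltNge.
have mA : measurable (`[- K, K]%classic : set Rm) by exact: measurable_itv.
have itv_fin (L : R) : (leb (`[(- L)%R, L]%classic : set Rm) < +oo)%E.
  by rewrite lebesgue_measure_itv/=; case: ifPn => _; rewrite -?EFinB ltry.
have cg := bounded_support_cintegrable mA (itv_fin K) mg gMK.
have g2 := bounded_support_cL2 mA (itv_fin K) mg gMK.
pose E : set Rm := `[- (K + 1), K + 1]%classic.
have mE : measurable E by exact: measurable_itv.
apply: (isometric_closure (measurable_line_phase) (G := @cont_comp_supp R)) => //.
- move=> h hG; have [ch h2] := cont_comp_supp_L12 hG.
  by split => //; exact: cont_comp_supp_isometric.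
- exact: cont_comp_suppB.
move=> e e0.
(* L^1 closeness [2 d] gives squared L^2 closeness [3 N (2 d)], since the
   difference is bounded by [3 N]; both must be at most [e]. *)
pose d := e / (2 * (1 + 3 * N)).
have N3 : 0 < 1 + 3 * N by rewrite ltr_wpDr// mulr_ge0.
have d0 : 0 < d by rewrite divr_gt0// mulr_gt0.
have approx (f : Rm -> R) : leb.-integrable setT (EFin \o f) ->
    exists h : R -> R, [/\ continuous h, leb.-integrable E (EFin \o h) &
      \int[leb]_(x in E) `|f x - h x| <= d].
  move=> intf.
  have intfE : leb.-integrable E (EFin \o f) by exact: integrableS intf.
  have [h_ [ch ih lim]] := approximation_continuous_integrable mE (itv_fin (K + 1)) intfE.
  move/fine_cvgP : lim => [finlim /cvgrPdist_le/(_ _ d0) lim].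
  have [n [_ hn]] := filter_ex (filterI finlim lim).
  exists (h_ n); split; [exact: ch|exact: ih|].
  by move: hn; rewrite sub0r normrN; apply: le_trans; exact: ler_norm.
have [h1 [ch1 ih1 h1d]] := approx _ cg.1.
have [h2 [ch2 ih2 h2d]] := approx _ cg.2.
pose h x : R[i] := (cutoff K x * clamp N (h1 x) +i* (cutoff K x * clamp N (h2 x)))%C.
have hle x : cabs (h x) <= 2 * N * \1_E x.
  rewrite (le_trans (cabs_le_ReIm _))//= !normrM (ger0_norm (cutoff_ge0 _ _)).
  rewrite -mulrDr mulrC ler_pM ?addr_ge0 ?cutoff_ge0 ?cutoff_le//.
  by rewrite mulr_natl mulr2n lerD// clamp_le.
have hG : cont_comp_supp h.
  split; last by exists (2 * N), (K + 1).
    move=> x; apply: cvgM; first exact: continuous_cutoff.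
    by apply: continuous_comp; [exact: ch1|exact: continuous_clamp].
  move=> x; apply: cvgM; first exact: continuous_cutoff.
  by apply: continuous_comp; [exact: ch2|exact: continuous_clamp].
have [ch hL2] := cont_comp_supp_L12 hG.
have mh := cintegrable_meas ch.
have gh x : cabs (g x - h x) <= \1_E x * (`|Re (g x) - h1 x| + `|Im (g x) - h2 x|).
  rewrite (le_trans (cabs_le_ReIm _))// !ReImE mulrDr.
  have key (P : R[i] -> R) (k : R -> R) : P 0 = 0 -> `|P (g x)| <= cabs (g x) ->
      `|P (g x) - cutoff K x * clamp N (k x)| <= \1_E x * `|P (g x) - k x|.
    move=> P0 Ple.
    have gE : P (g x) = cutoff K x * clamp N (P (g x)).
      have [Kx|xK] := ltP K `|x|.
        by rewrite gK// P0 clamp_id ?normr0// mulr0.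
      by rewrite cutoff_id// mul1r clamp_id// (le_trans Ple).
    rewrite [X in `|X - _| <= _]gE -mulrBr normrM (ger0_norm (cutoff_ge0 _ _)).
    by rewrite ler_pM ?cutoff_ge0 ?cutoff_le ?clamp_lipschitz.
  by rewrite lerD// key// ?Re_le_cabs ?Im_le_cabs.
have igh : \int[leb]_x cabs (g x - h x) <= 2 * d.
  have iabs (P : R[i] -> R) (k : R -> R) :
      leb.-integrable setT (fun x => (P (g x))%:E) ->
      leb.-integrable E (EFin \o k) ->
      leb.-integrable E (EFin \o (fun x => `|P (g x) - k x|)).
    move=> iP ik.
    have iPE : leb.-integrable E (fun x => (P (g x))%:E) by exact: integrableS iP.
    exact: (integrable_abse (integrableB mE iPE ik)).
  have i1 := iabs _ _ cg.1 ih1; have i2 := iabs _ _ cg.2 ih2.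
  apply: (@le_trans _ _ (\int[leb]_(x in E)
      (`|Re (g x) - h1 x| + `|Im (g x) - h2 x|))); last first.
    by rewrite RintegralD// mulr_natl mulr2n lerD.
  rewrite [leRHS]Rintegral_mkcond; apply: le_Rintegral => //.
  - exact: integrable_cabs (cintegrableB cg ch).
  - have := integrableD mE i1 i2; rewrite (integrable_mkcond _ mE).
    by rewrite restrict_EFin.
  - move=> x _; rewrite patchE; have := gh x; rewrite indicE.
    by case: (x \in E); rewrite ?mul1r ?mul0r.
exists h; split => //.
  rewrite (le_trans igh)// /d.
  rewrite mulrCA invfM mulrA mulrA mulfK// ler_pdivrMr//.
  by rewrite ler_peMr ?(ltW e0)// lerDl mulr_ge0.
have ghN x : cabs (g x - h x) <= 3 * N.
  rewrite (le_trans (cabsD _ _))// cabsN (_ : 3 * N = N + 2 * N); last by ring.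
  have E1 : \1_E x <= 1 :> R by rewrite indicE; case: (x \in E).
  by rewrite lerD// (le_trans (hle x))// ler_piMr// mulr_ge0.
have i3 := integrableZl measurableT (3 * N) (integrable_cabs (cintegrableB cg ch)).
rewrite -(sqint_fineK (cL2B g2 hL2)) lee_fin fine_sqint.
apply: (@le_trans _ _ (\int[leb]_x (3 * N * cabs (g x - h x)))).
  apply: le_Rintegral => //.
  - apply: le_integrable i3 => //.
      by apply: measurable_sqint; exact: cmeasurableB.
    move=> x _; rewrite /= lee_fin ger0_norm ?sqr_ge0// ger0_norm ?mulr_ge0 ?cabs_ge0//.
    by rewrite expr2 ler_wpM2r ?cabs_ge0.
  - by move=> x _; rewrite expr2 ler_wpM2r ?cabs_ge0.
rewrite RintegralZl//; last exact: integrable_cabs (cintegrableB cg ch).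
rewrite (le_trans (ler_wpM2l _ igh)) ?mulr_ge0// /d.
rewrite (_ : 3 * N * (2 * (e / (2 * (1 + 3 * N)))) = e * (3 * N / (1 + 3 * N))).
  by rewrite ler_piMr ?(ltW e0)// ler_pdivrMr// mul1r lerDr.
by field; rewrite gt_eqF.
Qed.

End line_isometric.

(** * Plancherel's identity on R^n *)

Section row_measure.
Context {R : realType}.
Local Notation leb := (@lebesgue_measure R).
Local Notation Rm := (measurableTypeR R).
Local Notation mu n := (lebesgue_row R n).

Definition row_phase {n} (x xi : 'rV[R]_n) : R := - (2 * pi * dotp x xi).

Lemma measurable_row_phase n :
  measurable_fun setT (fun p : 'rV[R]_n * 'rV[R]_n => row_phase p.1 p.2).
Proof.
apply: (@measurable_funN _ _ _ _ (fun p : 'rV[R]_n * 'rV[R]_n => 2 * pi * dotp p.1 p.2)).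
apply: measurable_funM; first exact: measurable_cst.
apply: (@measurable_sum _ _ _ _ _ _ (fun i (p : 'rV[R]_n * 'rV[R]_n) => p.1 0 i * p.2 0 i)) => i.
apply: measurable_funM.
  exact: (measurableT_comp (@measurable_coord R n i) measurable_fst).
exact: (measurableT_comp (@measurable_coord R n i) measurable_snd).
Qed.

Lemma dotp_row_cons n (a b : Rm) (x y : 'rV[R]_n) :
  dotp (row_cons (a, x)) (row_cons (b, y)) = a * b + dotp x y.
Proof.
rewrite /dotp big_ord_recl; congr (_ + _).
  by rewrite !mxE unlift_none.
by apply: eq_bigr => i _; rewrite !mxE liftK.
Qed.

Lemma ge0_integral_row_succ n (f : 'rV[R]_n.+1 -> \bar R) :
  measurable_fun setT f -> (forall x, (0 <= f x)%E) ->
  (\int[mu n.+1]_x f x = \int[leb \x mu n]_p f (row_cons p))%E.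
Proof.
move=> mf f0.
rewrite -[in RHS](@preimage_setT _ _ (@row_cons R n)).
by rewrite -(ge0_integral_pushforward (@measurable_row_cons R n) _ measurableT mf).
Qed.

Lemma cintegral_row_succ n (f : 'rV[R]_n.+1 -> R[i]) : cintegrable (mu n.+1) f ->
  (forall a, cintegrable (mu n) (fun x => f (row_cons (a, x)))) ->
  cintegral (mu n.+1) setT f =
  cintegral leb setT (fun a => cintegral (mu n) setT (fun x => f (row_cons (a, x)))).
Proof.
move=> [f1 f2] cs.
have key (h : 'rV[R]_n.+1 -> R) : (mu n.+1).-integrable setT (fun x => (h x)%:E) ->
    (forall a, (mu n).-integrable setT (fun x => (h (row_cons (a, x)))%:E)) ->
    \int[mu n.+1]_x h x = \int[leb]_a (\int[mu n]_x h (row_cons (a, x))).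
  move=> ih ihs; have mh : measurable_fun setT (EFin \o h) by exact: measurable_int ih.
  have ihc : (leb \x mu n)%E.-integrable setT (fun p => (h (row_cons p))%:E).
    apply/integrableP; split; first exact: (measurableT_comp mh (@measurable_row_cons R n)).
    rewrite -(ge0_integral_row_succ (f := fun x => `|(h x)%:E|%E))//.
      by have /integrableP[] := ih.
    exact: measurableT_comp.
  congr fine; transitivity (\int[leb \x mu n]_p (h (row_cons p))%:E)%E.
    exact: (integral_pushforward (@measurable_row_cons R n) mh ihc measurableT).
  rewrite -(integral12_prod_meas1 ihc); apply: eq_integral => a _.
  by rewrite fineK//; exact: integrable_fin_num.
apply: complex_ext; apply: key => //.
- by move=> a; have [] := cs a.
- by move=> a; have [] := cs a.
Qed.

(** Cubes rather than balls, since their volumes follow from the product structure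
of the measure. *)
Definition box n (K : R) : set 'rV[R]_n := [set x | forall i, `[- K, K]%classic (x 0 i)].

Lemma measurable_box n K : measurable (@box n K).
Proof.
rewrite [X in measurable X](_ : _ =
    \bigcap_(i in [set: 'I_n]) ((fun x : 'rV[R]_n => x 0 i) @^-1` `[- K, K]%classic)).
  apply: fin_bigcap_measurable => // i _.
  have mI : measurable (`[- K, K]%classic : set Rm) by exact: measurable_itv.
  by rewrite -[X in measurable X]setTI; exact: (@measurable_coord R n i measurableT _ mI).
by apply/seteqP; split => x /= Ax i => [_|]; exact: Ax.
Qed.

Lemma lebesgue_box n K : 0 <= K -> mu n (@box n K) = ((2 * K) ^+ n)%:E.
Proof.
move=> K0; rewrite (@lebesgue_row_box R n (fun=> `[- K, K]%classic)); last first.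
  by move=> i; exact: measurable_itv.
rewrite (eq_bigr (fun=> (2 * K)%:E)) => [|i _].
  by rewrite prodEFin prodr_const card_ord.
rewrite lebesgue_measure_itv/= lte_fin.
case: ltP => [_|]; first by rewrite -EFinB opprK mulr_natl mulr2n.
by move=> KK; congr (_%:E); lra.
Qed.

Lemma lebesgue_box_lty n K : (mu n (@box n K) < +oo)%E.
Proof.
apply: (@le_lt_trans _ _ (mu n (@box n `|K|))); last by rewrite lebesgue_box ?ltry.
apply: le_measure; rewrite ?inE; [exact: measurable_box..|].
move=> x Kx i; have := Kx i; rewrite /= !in_itv/= => /andP[x1 x2].
by rewrite (le_trans x2 (ler_norm _)) (le_trans _ x1)// lerN2 ler_norm.
Qed.

Definition bounded_on_box n (g : 'rV[R]_n -> R[i]) :=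
  cmeasurable g /\ exists M K : R, forall x, cabs (g x) <= M * \1_(box K) x.

Lemma bounded_on_box_L12 n (g : 'rV[R]_n -> R[i]) : bounded_on_box g ->
  cintegrable (mu n) g /\ cL2 (mu n) g.
Proof.
move=> [mg [M [K gM]]]; split.
  exact: (bounded_support_cintegrable (measurable_box K) (lebesgue_box_lty n K) mg gM).
exact: (bounded_support_cL2 (measurable_box K) (lebesgue_box_lty n K) mg gM).
Qed.

Lemma bounded_on_boxB n (g h : 'rV[R]_n -> R[i]) :
  bounded_on_box g -> bounded_on_box h -> bounded_on_box (fun x => g x - h x).
Proof.
move=> [mg [M [K gM]]] [mh [N [L hN]]]; split; first exact: cmeasurableB.
exists (`|M| + `|N|), (Num.max K L) => x.
rewrite (le_trans (cabsD _ _))// cabsN mulrDl.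
have incl (P Q : R) : P <= Q -> (\1_(box P) x : R) <= \1_(box Q) x.
  move=> PQ; rewrite !indicE; have [xP|//] := boolP (x \in box P).
  rewrite mem_set// => i; move: xP; rewrite inE => /(_ i)/=.
  rewrite !in_itv/= => /andP[yP1 yP2].
  by rewrite (le_trans yP2 PQ) (le_trans _ yP1)// lerN2.
rewrite lerD//.
  rewrite (le_trans (gM x))// (le_trans (_ : _ <= `|M| * \1_(box K) x))//.
    by rewrite ler_wpM2r ?indicE// ler_norm.
  by rewrite ler_wpM2l// incl// le_max lexx.
rewrite (le_trans (hN x))// (le_trans (_ : _ <= `|N| * \1_(box L) x))//.
  by rewrite ler_wpM2r ?indicE// ler_norm.
by rewrite ler_wpM2l// incl// le_max lexx orbT.
Qed.

Lemma bounded_on_box_slice n (g : 'rV[R]_n.+1 -> R[i]) a : bounded_on_box g ->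
  bounded_on_box (fun x => g (row_cons (a, x))).
Proof.
move=> [mg [M [K gM]]]; split.
  exact: (cmeasurable_comp mg (measurableT_comp (@measurable_row_cons R n)
    (measurable_pair1 a))).
exists `|M|, K => x; rewrite (le_trans (gM _))//.
rewrite (le_trans (_ : _ <= `|M| * \1_(box K) (row_cons (a, x))))//.
  by rewrite ler_wpM2r ?indicE// ler_norm.
rewrite ler_wpM2l// !indicE; have [axK|//] := boolP (row_cons (a, x) \in box K).
rewrite mem_set// => i; move: axK; rewrite inE => /(_ (lift ord0 i)).
by rewrite mxE liftK.
Qed.

Local Notation ftr n := (phase_transform (mu n) (@row_phase n)).

(** The transform in dimension n + 1 is the one-dimensional transform, in the
first variable, of the n-dimensional transforms of the slices. *)
Lemma row_transform_succ n (g : 'rV[R]_n.+1 -> R[i]) b eta : bounded_on_box g ->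
  ftr n.+1 g (row_cons (b, eta)) =
  phase_transform leb line_phase
    (fun a => ftr n (fun x => g (row_cons (a, x))) eta) b.
Proof.
move=> bg.
have [cg _] := bounded_on_box_L12 bg.
rewrite /phase_transform cintegral_row_succ.
- apply: eq_cintegral => a; rewrite mulrC -cintegralZ.
    apply: eq_cintegral => x; rewrite mulrCA; congr (_ * _).
    rewrite /row_phase dotp_row_cons /line_phase -expiD; congr expi; ring.
  have [cs _] := bounded_on_box_L12 (bounded_on_box_slice a bg).
  exact: (cintegrable_phase (@measurable_row_phase n)).
- exact: (cintegrable_phase (@measurable_row_phase n.+1)).
- move=> a; have [cs _] := bounded_on_box_L12 (bounded_on_box_slice a bg).
  apply: (cintegrableMb (M := 1)) => //; last by move=> x; rewrite cabs_expi.
  apply: cmeasurable_expi.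
  have mr : measurable_fun setT (fun x : 'rV[R]_n => row_cons (a : Rm, x)).
    exact: (measurableT_comp (@measurable_row_cons R n) (measurable_pair1 a)).
  exact: (measurableT_comp (measurableT_comp (@measurable_row_phase n.+1)
    (measurable_pair2 (row_cons (b, eta)))) mr).
Qed.

(** Induction on the dimension: Tonelli's theorem reduces the square of the transform
to the identity on the line for each frequency of the slice transforms, then to the
identity in dimension [n] for each slice. *)
Lemma row_isometric n (g : 'rV[R]_n -> R[i]) : bounded_on_box g ->
  isometric (mu n) row_phase g.
Proof.
elim: n => [|n IHn] in g *.
  (* In dimension 0 the measure is a point mass and the phase vanishes. *)
  move=> _; apply: eq_sqint => xi; congr cabs.
  have -> : phase_transform (mu 0%N) row_phase g xi = cintegral (mu 0%N) setT (fun=> g xi).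
    apply: eq_cintegral => x; rewrite /row_phase /dotp big_ord0 mulr0 oppr0 expi0 mulr1.
    by congr g; apply/rowP => -[].
  have mu1 : fine (mu 0%N setT) = 1.
    by rewrite /= indicE mem_set.
  rewrite /cintegral !Rintegral_cst//; case: (g xi) => c e /=.
  by move: mu1 => /= ->; rewrite !mulr1.
move=> bg; have [mg [M [K gM]]] := bg.
pose H (p : Rm * 'rV[R]_n) := ftr n (fun x => g (row_cons (p.1, x))) p.2.
have mH : cmeasurable H.
  have mF : cmeasurable (fun q : (Rm * 'rV[R]_n) * 'rV[R]_n =>
      g (row_cons (q.1.1, q.2)) * expi (row_phase q.2 q.1.2)).
    apply: cmeasurableM.
      apply: (cmeasurable_comp mg (h := fun q : (Rm * 'rV[R]_n) * 'rV[R]_n =>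
        row_cons (q.1.1, q.2))).
      apply: (measurableT_comp (@measurable_row_cons R n)).
      apply/measurable_fun_pair; last exact: measurable_snd.
      exact: (measurableT_comp measurable_fst measurable_fst).
    apply: cmeasurable_expi.
    apply: (measurableT_comp (@measurable_row_phase n)
      (g := fun q : (Rm * 'rV[R]_n) * 'rV[R]_n => (q.2, q.1.2))).
    apply/measurable_fun_pair; first exact: measurable_snd.
    exact: (measurableT_comp measurable_snd measurable_fst).
  exact: (cmeasurable_partial (mu n) mF).
have HB eta a : cabs (H (a, eta)) <= `|M| * fine (mu n (box K)) * \1_`[- K, K] a.
  have ibox := integrable_indic_fin (@measurable_box n K) (lebesgue_box_lty n K).
  have [cs _] := bounded_on_box_L12 (bounded_on_box_slice a bg).
  apply: le_trans (cabs_phase_transform_le (@measurable_row_phase n) eta cs) _.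
  apply: (@le_trans _ _ (\int[mu n]_x (`|M| * \1_`[- K, K] a * \1_(box K) x))).
    apply: le_Rintegral => //; first exact: integrable_cabs.
      exact: (integrableZl measurableT _ ibox).
    move=> x _; rewrite (le_trans (gM _))// -mulrA.
    rewrite (le_trans (_ : _ <= `|M| * \1_(box K) (row_cons (a, x))))//.
      by rewrite ler_wpM2r ?indicE// ler_norm.
    rewrite ler_wpM2l// !indicE; have [axK|//] := boolP (row_cons (a, x) \in box K).
      move: axK; rewrite inE => axK.
      rewrite mem_set/=; last by have := axK ord0; rewrite mxE unlift_none.
      rewrite mem_set ?mulr1// => i.
      by have := axK (lift ord0 i); rewrite mxE liftK.
    by rewrite mulr_ge0.
  rewrite RintegralZl// le_eqVlt; apply/orP; left; apply/eqP.
  rewrite [RHS]mulrAC; congr (_ * _).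
  by rewrite /Rintegral integral_indic ?setIT//; exact: measurable_box.
pose S (p : Rm * 'rV[R]_n) := (cabs (H p) ^+ 2)%:E.
transitivity (\int[mu n]_eta (sqint leb (phase_transform leb line_phase
    (fun a => H (a, eta)))))%E.
  rewrite /sqint ge0_integral_row_succ; last 2 first.
  - apply: measurable_sqint.
    exact: (cmeasurable_phase_transform _ (@measurable_row_phase n.+1)).
  - by move=> x; rewrite lee_fin sqr_ge0.
  rewrite fubini_tonelli2; last 2 first.
  - apply: (measurableT_comp (measurable_sqint _) (@measurable_row_cons R n)).
    exact: (cmeasurable_phase_transform _ (@measurable_row_phase n.+1)).
  - by move=> x; rewrite lee_fin sqr_ge0.
  apply: eq_integral => eta _; apply: eq_integral => b _.
  by rewrite row_transform_succ.
transitivity (\int[mu n]_eta (sqint leb (fun a => H (a, eta))))%E.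
  apply: eq_integral => eta _; apply: (line_isometric _ (HB eta)).
  exact: (cmeasurable_comp mH (measurable_pair2 eta)).
have mS : measurable_fun setT S by exact: measurable_sqint.
have S0 p : (0 <= S p)%E by rewrite lee_fin sqr_ge0.
rewrite -(fubini_tonelli _ mS S0).
transitivity (\int[leb]_a (sqint (mu n) (fun x => g (row_cons (a, x)))))%E.
  apply: eq_integral => a _; rewrite -(IHn _ (bounded_on_box_slice a bg)).
  by [].
rewrite {2}/sqint ge0_integral_row_succ; last 2 first.
- exact: measurable_sqint.
- by move=> x; rewrite lee_fin sqr_ge0.
rewrite fubini_tonelli1//.
- exact: (measurableT_comp (measurable_sqint mg) (@measurable_row_cons R n)).
- by move=> x; rewrite lee_fin sqr_ge0.
Qed.

End row_measure.

(** * The Fourier transform on L^2 *)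

Lemma cvg_sqrte0 {R : realType} (a : nat -> \bar R) :
  a k @[k --> \oo] --> 0%E -> sqrte (a k) @[k --> \oo] --> 0%E.
Proof.
move/fine_cvgP => [fin lim]; apply/fine_cvgP; split.
  by apply: filterS fin => k; case: (a k).
have : Num.sqrt (fine (a k)) @[k --> \oo] --> (0 : R).
  rewrite -[X in _ --> X](@sqrtr0 R); exact: (cvg_comp _ _ lim (@sqrt_continuous R 0)).
apply: cvg_trans; apply: near_eq_cvg; apply: filterS fin => k /=.
by case: (a k).
Qed.

Section fourier_theory.
Context {R : realType} {n : nat}.
Local Notation Rn := 'rV[R]_n.
Local Notation mu := (lebesgue_row R n).
Local Notation ftr := (phase_transform mu (@row_phase R n)).
Implicit Types (f g F G : Rn -> R[i]).

Lemma L2normE f : L2norm f = L2n mu f.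
Proof. by []. Qed.

Lemma memL2P f : memL2 f <-> cL2 mu f.
Proof.
split=> [[f1 f2 foo]|[[f1 f2] foo]]; first by split => //; exact/L2n_lty.
by split => //; exact/L2n_lty.
Qed.

(** Dominated convergence. Both the truncations to balls and the truncations in
height and support have this form. *)
Lemma sqint_restriction_cvg (f : Rn -> R[i]) (f_ : nat -> Rn -> R[i]) : cL2 mu f ->
  (forall k, cmeasurable (f_ k)) -> (forall k x, cabs (f x - f_ k x) <= cabs (f x)) ->
  (forall x, exists N, forall k, (N <= k)%N -> f_ k x = f x) ->
  sqint mu (fun x => f x - f_ k x) @[k --> \oo] --> 0%E.
Proof.
move=> f2 mf_ fle fev; have [mf foo] := f2.
have i2 : mu.-integrable setT (fun x => (cabs (f x) ^+ 2)%:E).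
  apply/integrableP; split; first exact: measurable_sqint.
  by under eq_integral do rewrite gee0_abs ?lee_fin ?sqr_ge0//.
have [] := @dominated_convergence _ _ _ mu setT measurableT
  (fun k x => (cabs (f x - f_ k x) ^+ 2)%:E) (fun=> 0%E) (fun x => (cabs (f x) ^+ 2)%:E).
- by move=> k; apply: measurable_sqint; exact: cmeasurableB.
- exact: measurable_cst.
- apply: aeW => x _; apply: cvg_near_cst.
  have [N fN] := fev x; exists N => // k /= Nk.
  by rewrite fN// subrr cabs0 expr0n.
- exact: i2.
- apply: aeW => x k _; rewrite gee0_abs ?lee_fin ?sqr_ge0//.
  by rewrite ler_pXn2r ?nnegrE ?cabs_ge0.
by move=> _ _; rewrite integral0.
Qed.

Lemma enorm_ge0 (x : Rn) : 0 <= enorm x.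
Proof. exact: sqrtr_ge0. Qed.

Lemma measurable_enorm : measurable_fun setT (@enorm R n).
Proof.
apply: measurable_sqrt_fun; rewrite /dotp.
apply: (@measurable_sum _ _ _ _ _ _ (fun i (x : Rn) => x 0 i * x 0 i)) => i.
by apply: measurable_funM; exact: measurable_coord.
Qed.

Lemma coord_le_enorm (x : Rn) i : `|x 0 i| <= enorm x.
Proof.
rewrite -sqrtr_sqr /enorm ler_wsqrtr// /dotp (bigD1 i)//= expr2 lerDl.
by apply: sumr_ge0 => j _; rewrite -expr2 sqr_ge0.
Qed.

Lemma enorm_le_box (x : Rn) (K : R) : 0 <= K -> box K x -> enorm x <= n%:R * K.
Proof.
move=> K0 xK; rewrite -(ger0_norm (mulr_ge0 (ler0n R n) K0)) -sqrtr_sqr.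
rewrite /enorm ler_wsqrtr// /dotp.
apply: (@le_trans _ _ (\sum_(i < n) K ^+ 2)).
  apply: ler_sum => i _; rewrite -expr2 -real_normK ?num_real//.
  by rewrite ler_pXn2r ?nnegrE// ler_norml; have := xK i; rewrite /= in_itv.
rewrite sumr_const card_ord exprMn -[X in X <= _]mulr_natl ler_wpM2r ?sqr_ge0// expr2.
by rewrite -natrM ler_nat; case: n => // m; rewrite leq_pmulr.
Qed.

Lemma cmeasurable_truncate r f : cmeasurable f -> cmeasurable (truncate r f).
Proof.
move=> mf; apply: cmeasurable_if => //.
by apply: measurable_fun_ler; [exact: measurable_enorm|exact: measurable_cst].
Qed.

Lemma truncate_le r f x : cabs (truncate r f x) <= cabs (f x).
Proof. by rewrite /truncate; case: ifP; rewrite ?cabs0 ?cabs_ge0. Qed.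

Lemma truncate_cL2 r f : cL2 mu f -> cL2 mu (truncate r f).
Proof.
move=> [mf foo]; split; first exact: cmeasurable_truncate.
by apply: le_lt_trans foo; apply: le_sqint => //;
  [exact: cmeasurable_truncate|exact: truncate_le].
Qed.

Lemma truncate_cintegrable r f : cL2 mu f -> cintegrable mu (truncate r f).
Proof.
move=> f2.
have box2 : cL2 mu (fun x => rc (\1_(box r) x)).
  have mb : measurable_fun setT (\1_(@box R n r) : Rn -> R).
    by apply: measurable_indic; exact: measurable_box.
  apply: (@bounded_support_cL2 _ _ _ mu (box r) 1).
  - exact: measurable_box.
  - exact: lebesgue_box_lty.
  - exact: cmeasurable_real.
  - by move=> x; rewrite mul1r cabs_real indicE ger0_norm.
have := cintegrable_mulL2 (truncate_cL2 r f2) box2.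
rewrite (_ : (fun _ => _) = truncate r f)//; apply/funext => x.
rewrite /truncate; case: ifP => [xr|_]; last by rewrite mul0r.
rewrite indicE mem_set ?mulr1// => i /=; rewrite in_itv/= -ler_norml.
by rewrite (le_trans (coord_le_enorm _ _)).
Qed.

Lemma truncateD r f g (c : R[i]) :
  truncate r (fun x => f x + c * g x) = fun x => truncate r f x + c * truncate r g x.
Proof.
by apply/funext => x; rewrite /truncate; case: ifP => //; rewrite mulr0 addr0.
Qed.

Lemma truncate_cvg f : cL2 mu f ->
  L2n mu (fun x => f x - truncate k%:R f x) @[k --> \oo] --> 0%E.
Proof.
move=> f2; have [mf _] := f2.
under eq_fun do rewrite L2nE.
have lim : sqint mu (fun x => f x - truncate k%:R f x) @[k --> \oo] --> 0%E.
  apply: sqint_restriction_cvg => //.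
  - by move=> k; exact: cmeasurable_truncate.
  - move=> k x; rewrite /truncate; case: ifP => _; last by rewrite subr0.
    by rewrite subrr cabs0 cabs_ge0.
  - move=> x; exists (Num.bound (enorm x)) => k Nk; rewrite /truncate ifT//.
    by rewrite (le_trans (ltW (archi_boundP (enorm_ge0 x))))// ler_nat.
exact: cvg_sqrte0.
Qed.

(** Restricting [f] to a cube and to the set where it is bounded gives approximants
to which the closure lemma applies. *)
Lemma fourier_isometric f : cintegrable mu f -> cL2 mu f ->
  isometric mu (@row_phase R n) f.
Proof.
move=> cf f2; have [mf foo] := f2.
apply: (isometric_closure (@measurable_row_phase R n) (G := @bounded_on_box R n)) => //.
- by move=> g bg; have [cg g2] := bounded_on_box_L12 bg; split => //; exact: row_isometric.
- by move=> g h; exact: bounded_on_boxB.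
move=> e e0.
pose B (k : nat) : set Rn := box k%:R `&` [set x | cabs (f x) <= k%:R].
have mB k : measurable (B k).
  apply: measurableI; first exact: measurable_box.
  rewrite -[X in measurable X]setTI.
  rewrite [X in measurable (_ `&` X)](_ : _ = (fun x => cabs (f x)) @^-1` `]-oo, k%:R]).
    apply: measurable_cabs => //; exact: measurable_itv.
  by apply/seteqP; split => x /=; rewrite in_itv.
pose f_ k x := rc (\1_(B k) x) * f x.
have mf_ k : cmeasurable (f_ k).
  by apply: cmeasurableM => //; apply: cmeasurable_real; exact: measurable_indic.
have fev x : exists N, forall k, (N <= k)%N -> f_ k x = f x.
  pose N := maxn (Num.bound (enorm x)) (Num.bound (cabs (f x))).
  exists N => k; rewrite geq_max => /andP[k1 k2].
  rewrite /f_ indicE mem_set ?mul1r//; split => [i|] /=.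
    rewrite in_itv/= -ler_norml (le_trans (coord_le_enorm _ _))//.
    by rewrite (le_trans (ltW (archi_boundP (enorm_ge0 x))))// ler_nat.
  by rewrite (le_trans (ltW (archi_boundP (cabs_ge0 _))))// ler_nat.
have fle k x : cabs (f x - f_ k x) <= cabs (f x).
  rewrite /f_ indicE; case: (x \in B k); first by rewrite mul1r subrr cabs0 cabs_ge0.
  by rewrite mul0r subr0.
have lim2 := sqint_restriction_cvg f2 mf_ fle fev.
have lim1 : \int[mu]_x cabs (f x - f_ k x) @[k --> \oo] --> (0 : R).
  have [] := @dominated_convergence _ _ _ mu setT measurableT
    (fun k x => (cabs (f x - f_ k x))%:E) (fun=> 0%E) (fun x => (cabs (f x))%:E).
  - by move=> k; apply/measurable_EFinP/measurable_cabs/cmeasurableB.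
  - exact: measurable_cst.
  - apply: aeW => x _; apply: cvg_near_cst.
    have [N fN] := fev x; exists N => // k /= Nk.
    by rewrite fN// subrr cabs0.
  - exact: integrable_cabs.
  - by apply: aeW => x k _; rewrite gee0_abs ?lee_fin ?cabs_ge0.
  by move=> _ _; rewrite integral0 => lim; exact: (fine_cvg lim).
have bB k : bounded_on_box (f_ k).
  split => //; exists k%:R, k%:R => x; rewrite /f_ indicE.
  have [xB|_] := boolP (x \in B k); last first.
    by rewrite mul0r cabs0 mulr_ge0// indicE.
  move: xB; rewrite inE => -[xb /= xk].
  by rewrite mul1r indicE mem_set// mulr1.
move/cvgrPdist_le/(_ _ e0) : lim1 => lim1.
move/fine_cvgP : lim2 => [fin2 /cvgrPdist_le/(_ _ e0) lim2].
have [k [k1 [k2 k3]]] := filter_ex (filterI lim1 (filterI fin2 lim2)).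
exists (f_ k); split => //.
  by move: k1; rewrite sub0r normrN; apply: le_trans; exact: ler_norm.
rewrite -(fineK k2) lee_fin.
by move: k3; rewrite sub0r normrN; apply: le_trans; exact: ler_norm.
Qed.

End fourier_theory.

Section plancherel.
Context {R : realType} {n : nat}.
Local Notation Rn := 'rV[R]_n.
Local Notation mu := (lebesgue_row R n).
Local Notation ftr := (phase_transform mu (@row_phase R n)).
Implicit Types (f g F G : Rn -> R[i]).

Lemma isometric_L2n f : cintegrable mu f -> cL2 mu f -> L2n mu (ftr f) = L2n mu f.
Proof. by move=> cf f2; rewrite !L2nE (fourier_isometric cf f2). Qed.

Lemma cmeasurable_ftr f : cmeasurable f -> cmeasurable (ftr f).
Proof. exact: (cmeasurable_phase_transform _ (@measurable_row_phase R n)). Qed.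

Lemma is_fourierP f F : is_fourier f F <-> [/\ cL2 mu f, cL2 mu F &
  L2n mu (fun xi => F xi - ftr (truncate k%:R f) xi) @[k --> \oo] --> 0%E].
Proof.
by split => -[/memL2P f2 /memL2P F2 lim]; split => //; exact/memL2P.
Qed.

Lemma cvg_abse0_le (a : nat -> \bar R) (e : R) : 0 < e -> (forall k, 0 <= a k)%E ->
  a k @[k --> \oo] --> 0%E -> \forall k \near \oo, (a k <= e%:E)%E.
Proof.
move=> e0 a0 /fine_cvgP[fin /cvgrPdist_le/(_ _ e0)].
move=> lim; apply: filterS (filterI fin lim) => k [ak].
by rewrite sub0r normrN ger0_norm ?fine_ge0// -lee_fin fineK.
Qed.

(** Plancherel's theorem on L^2: both sides are limits of the corresponding norms
of the truncations, for which the identity is known. *)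
Lemma is_fourier_L2n f F : is_fourier f F -> L2n mu F = L2n mu f.
Proof.
move=> /is_fourierP[f2 F2 lim]; have [[mf _] [mF _]] := (f2, F2).
have fk2 k : cL2 mu (truncate k%:R f) by exact: truncate_cL2.
have fk1 k : cintegrable mu (truncate k%:R f) by exact: truncate_cintegrable.
have mfk k : cmeasurable (truncate k%:R f) by have [] := fk2 k.
have iso k := isometric_L2n (fk1 k) (fk2 k).
have lim2 := truncate_cvg f2.
apply/eqP; rewrite eq_le; apply/andP; split; apply/lee_addgt0Pr => e e0.
  have [k lek] := filter_ex (cvg_abse0_le e0 (fun k => L2n_ge0 _ _) lim).
  rewrite (le_trans (L2n_triangle mu mF (cmeasurable_ftr (mfk k))))//.
  rewrite leeD// iso !L2nE lee_sqrt ?sqint_ge0//.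
  by apply: le_sqint => //; exact: truncate_le.
have e2 : 0 < e / 2 by rewrite divr_gt0.
have lek1 := cvg_abse0_le e2 (fun k => L2n_ge0 _ _) lim.
have lek2 := cvg_abse0_le e2 (fun k => L2n_ge0 _ _) lim2.
have [k [k1 k2]] := filter_ex (filterI lek1 lek2).
rewrite (le_trans (L2n_triangle mu mf (mfk k)))//.
rewrite [e in leRHS](splitr e) EFinD addeA leeD// -iso.
rewrite (le_trans (L2n_triangle mu (cmeasurable_ftr (mfk k)) mF))// leeD2l//.
rewrite (@eq_L2n _ _ _ _ _ (fun xi => F xi - ftr (truncate k%:R f) xi))// => xi.
by rewrite -cabsN opprB.
Qed.

Lemma is_fourier_lin f g F G (c : R[i]) : is_fourier f F -> is_fourier g G ->
  is_fourier (fun x => f x + c * g x) (fun xi => F xi + c * G xi).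
Proof.
move=> /is_fourierP[f2 F2 limf] /is_fourierP[g2 G2 limg]; apply/is_fourierP.
have [[mf _] [mF _]] := (f2, F2); have [[mg _] [mG _]] := (g2, G2).
split; [by apply: cL2D => //; exact: cL2Z|by apply: cL2D => //; exact: cL2Z|].
pose u (k : nat) := (L2n mu (fun xi => F xi - ftr (truncate k%:R f) xi)%R +
  (cabs c)%:E * L2n mu (fun xi => G xi - ftr (truncate k%:R g) xi)%R)%E.
have ulim : u k @[k --> \oo] --> 0%E.
  rewrite -[X in _ --> X](adde0 (0%E : \bar R)); apply: cvgeD => //.
  by rewrite -[X in _ --> X](mule0 (cabs c)%:E); apply: cvgeZl.
apply: (squeeze_cvge _ (cvg_cst _) ulim).
apply: nearW => k; rewrite L2n_ge0/= /u.
have fk1 : cintegrable mu (truncate k%:R f) by exact: truncate_cintegrable.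
have gk1 : cintegrable mu (truncate k%:R g) by exact: truncate_cintegrable.
have mfk := cmeasurable_ftr (cintegrable_meas fk1).
have mgk := cmeasurable_ftr (cintegrable_meas gk1).
rewrite -L2nZ; last exact: cmeasurableB.
apply: le_trans (L2nD _ _ _); last 2 first.
- exact: cmeasurableB.
- by apply: cmeasurableM; [exact: cmeasurable_cst|exact: cmeasurableB].
rewrite le_eqVlt; apply/orP; left; apply/eqP; apply: eq_L2n => xi; congr cabs.
rewrite truncateD (phase_transformD (@measurable_row_phase R n))//; last first.
  exact: cintegrableZ.
by rewrite (phase_transformZ (@measurable_row_phase R n))//; ring.
Qed.

Lemma eq_is_fourier f g F G : f =1 g -> F =1 G -> is_fourier f F -> is_fourier g G.
Proof. by move=> /funext -> /funext ->. Qed.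

Lemma is_fourierB f g F G : is_fourier f F -> is_fourier g G ->
  is_fourier (fun x => f x - g x) (fun xi => F xi - G xi).
Proof.
move=> fF gG; apply: eq_is_fourier (is_fourier_lin (-1) fF gG) => x.
  by rewrite mulN1r.
by rewrite mulN1r.
Qed.

Lemma is_fourier_unique f F G : is_fourier f F -> is_fourier f G ->
  L2n mu (fun xi => F xi - G xi) = 0%E.
Proof.
move=> fF fG; rewrite (is_fourier_L2n (is_fourierB fF fG)).
under eq_fun do rewrite subrr.
rewrite L2nE /sqint; under eq_integral do rewrite cabs0 expr0n.
by rewrite integral0 sqrte0.
Qed.

(** The converse uniqueness: by Plancherel's theorem no inverse transform is needed. *)
Lemma is_fourier_inj f g F : is_fourier f F -> is_fourier g F ->
  L2n mu (fun x => f x - g x) = 0%E.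
Proof.
move=> fF gF; rewrite -(is_fourier_L2n (is_fourierB fF gF)).
under eq_fun do rewrite subrr.
rewrite L2nE /sqint; under eq_integral do rewrite cabs0 expr0n.
by rewrite integral0 sqrte0.
Qed.

Lemma is_fourier_ae f F G : is_fourier f F -> cL2 mu G ->
  L2n mu (fun xi => F xi - G xi) = 0%E -> is_fourier f G.
Proof.
move=> /is_fourierP[f2 F2 lim] G2 FG; apply/is_fourierP; split => //.
have [[mF _] [mG _]] := (F2, G2).
apply: (squeeze_cvge _ (cvg_cst _) lim); apply: nearW => k.
have mk : cmeasurable (ftr (truncate k%:R f)).
  exact/cmeasurable_ftr/cintegrable_meas/truncate_cintegrable.
rewrite L2n_ge0/= -[leRHS]add0e -FG -[X in (X + _)%E]L2nN.
apply: le_trans (L2nD _ _ _).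
- rewrite le_eqVlt; apply/orP; left; apply/eqP; apply: eq_L2n => xi; congr cabs.
  by ring.
- exact/cmeasurableN/cmeasurableB.
- exact: cmeasurableB.
Qed.

(** For bounded support the truncations are eventually constant. *)
Lemma is_fourier_bounded_on_box g : bounded_on_box g -> is_fourier g (ftr g).
Proof.
move=> bg; have [cg g2] := bounded_on_box_L12 bg.
have [mg [M [K gM]]] := bg.
apply/is_fourierP; split => //.
  split; first exact: cmeasurable_ftr.
  by rewrite (fourier_isometric cg g2); have [] := g2.
apply: cvg_near_cst; exists (Num.bound (n%:R * `|K|)) => // k /= Kk.
rewrite (_ : truncate k%:R g = g).
  under eq_fun do rewrite subrr.
  rewrite L2nE /sqint; under eq_integral do rewrite cabs0 expr0n.
  by rewrite integral0 sqrte0.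
apply/funext => x; rewrite /truncate; case: ifPn => // xk.
apply/esym/cabs_eq0/eqP; rewrite eq_le cabs_ge0 andbT (le_trans (gM x))//.
rewrite indicE memNset ?mulr0// => xK; move/negP : xk; apply.
rewrite (le_trans (_ : _ <= n%:R * `|K|))//.
  apply: enorm_le_box => // i; have := xK i; rewrite /= !in_itv/= => /andP[x1 x2].
  by rewrite (le_trans x2 (ler_norm _)) (le_trans _ x1)// lerN2 ler_norm.
have K0 : 0 <= n%:R * `|K| by rewrite mulr_ge0.
by rewrite (le_trans (ltW (archi_boundP K0)))// ler_nat.
Qed.

(** Parseval's formula, by polarization with the scalars 1 and i. *)
Lemma parseval f g F G : is_fourier f F -> is_fourier g G ->
  cintegral mu setT (fun xi => F xi * conjc (G xi)) =
  cintegral mu setT (fun x => f x * conjc (g x)).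
Proof.
move=> fF gG; have /is_fourierP[f2 F2 _] := fF; have /is_fourierP[g2 G2 _] := gG.
have sqE h H : is_fourier h H -> fine (sqint mu H) = fine (sqint mu h).
  move=> hH; have /is_fourierP[h2 H2 _] := hH.
  have := is_fourier_L2n hH; rewrite (L2n_fine h2) (L2n_fine H2) => -[] E.
  rewrite -(@sqr_sqrtr _ (fine (sqint mu H))) ?E ?sqr_sqrtr//.
    by rewrite fine_ge0// sqint_ge0.
  by rewrite fine_ge0// sqint_ge0.
have cL2J h : cL2 mu h -> cL2 mu (fun x => conjc (h x)).
  move=> [mh hoo]; split; first exact: cmeasurableJ.
  by rewrite (@eq_sqint _ _ _ _ _ h)// => x; rewrite cabsJ.
have ReE (c : R[i]) : Re (cintegral mu setT (fun xi => F xi * conjc (c * G xi))) =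
    Re (cintegral mu setT (fun x => f x * conjc (c * g x))).
  have := sqE _ _ (is_fourier_lin c fF gG).
  rewrite (fine_sqintD F2 (cL2Z c G2)) (fine_sqintD f2 (cL2Z c g2)).
  have gcG : is_fourier (fun x => c * g x) (fun xi => c * G xi).
    have := is_fourier_lin (c - 1) gG gG.
    by apply: eq_is_fourier => x; ring.
  rewrite (sqE _ _ fF) (sqE _ _ gcG) => /addrI.
  by apply: mulfI; rewrite pnatr_eq0.
have cFG : cintegrable mu (fun xi => F xi * conjc (G xi)).
  by apply: cintegrable_mulL2 => //; exact: cL2J.
have cfg : cintegrable mu (fun x => f x * conjc (g x)).
  by apply: cintegrable_mulL2 => //; exact: cL2J.
apply: complex_ext.
  have := ReE 1; under eq_cintegral do rewrite mul1r.
  by under [X in _ = Re X -> _]eq_cintegral do rewrite mul1r.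
have := ReE 'i%C.
rewrite (@eq_cintegral _ _ _ mu _ (fun xi => - 'i%C * (F xi * conjc (G xi)))); last first.
  by move=> xi; apply: complex_ext; rewrite !ReImE /=; ring.
rewrite [in X in _ = X -> _](@eq_cintegral _ _ _ mu _
   (fun x => - 'i%C * (f x * conjc (g x)))); last first.
  by move=> x; apply: complex_ext; rewrite !ReImE /=; ring.
rewrite !cintegralZ// !ReM !ReN !ImN/= !oppr0 !mul0r !sub0r.
by rewrite !mulN1r !opprK.
Qed.

End plancherel.

(** * Fourier inversion at the origin *)

Section inversion.
Context {R : realType} {n : nat}.
Local Notation Rn := 'rV[R]_n.
Local Notation mu := (lebesgue_row R n).
Local Notation ftr := (phase_transform mu (@row_phase R n)).
Implicit Types (f g F G : Rn -> R[i]).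

Lemma continuous_dotp (xi : Rn) : continuous (fun x : Rn => dotp x xi).
Proof.
rewrite /dotp; apply: continuous_big => [p|i _ x].
  by apply: cvgD; [exact: cvg_fst|exact: cvg_snd].
have h : (fun t : R => t * xi 0 i) t @[t --> x 0 i] --> x 0 i * xi 0 i.
  by apply: cvgM; [exact: cvg_id|exact: cvg_cst].
exact: (cvg_comp _ _ (@coord_continuous R 1 n 0 i x) h).
Qed.

Lemma continuous_row_phase (xi : Rn) : continuous (fun x : Rn => row_phase x xi).
Proof.
move=> x; have h (t0 : R) : - (2 * pi * t) @[t --> t0] --> - (2 * pi * t0).
  by apply: cvgN; apply: cvgM; [exact: cvg_cst|exact: cvg_id].
exact: (cvg_comp _ _ (@continuous_dotp xi x) (h _)).
Qed.

Definition cube_density (e : R) (x : Rn) : R := ((2 * e) ^+ n)^-1 * \1_(box e) x.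

Lemma cube_density_ge0 e x : 0 < e -> 0 <= cube_density e x.
Proof.
by move=> e0; rewrite mulr_ge0 ?indicE// invr_ge0 exprn_ge0// mulr_ge0// ltW.
Qed.

Lemma bounded_cube_density e : 0 < e -> bounded_on_box (fun x : Rn => rc (cube_density e x)).
Proof.
move=> e0; split.
  apply: cmeasurable_real; apply: measurable_funM; first exact: measurable_cst.
  by apply: measurable_indic; exact: measurable_box.
exists (((2 * e) ^+ n)^-1), e => x.
by rewrite cabs_real ger0_norm ?cube_density_ge0.
Qed.

Lemma integral_cube_density e : 0 < e -> \int[mu]_x cube_density e x = 1.
Proof.
move=> e0; have ib := integrable_indic_fin (@measurable_box R n e) (lebesgue_box_lty n e).
have mb := @measurable_box R n e.
have vol : \int[mu]_x \1_(@box R n e) x = (2 * e) ^+ n.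
  rewrite /Rintegral integral_indic// setIT.
  exact: (congr1 fine (lebesgue_box n (ltW e0))).
rewrite RintegralZl// vol.
by rewrite mulVf// gt_eqF// exprn_gt0// mulr_gt0.
Qed.

Lemma cube_average_cvg (h : Rn -> R[i]) :
  {for 0, continuous (fun x => Re (h x))} -> {for 0, continuous (fun x => Im (h x))} ->
  (forall e : R, 0 < e -> cintegrable mu (fun x => rc (cube_density e x) * h x)) ->
  forall r : R, 0 < r -> \forall k \near \oo,
    cabs (cintegral mu setT (fun x => rc (cube_density k.+1%:R^-1 x) * h x) - h 0) <= r.
Proof.
move=> c1 c2 ch r r0.
have r2 : 0 < r / 2 by rewrite divr_gt0.
have near0 : \forall x \near (0 : Rn), cabs (h x - h 0) <= r.
  move/cvgrPdist_le : c1 => /(_ _ r2) c1; move/cvgrPdist_le : c2 => /(_ _ r2) c2.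
  apply: filterS (filterI c1 c2) => x [x1 x2].
  rewrite (le_trans (cabs_le_ReIm _))// !ReImE [r]splitr lerD//.
    by rewrite distrC.
  by rewrite distrC.
have [d /= d0 dP] : exists2 d : R, 0 < d & forall x : Rn, ball 0 d x -> cabs (h x - h 0) <= r.
  by move/nbhs_ballP : near0 => [d /= d0 dP]; exists d.
have := near_infty_natSinv_lt (PosNum d0); apply: filterS => k /= kd.
have k0 : 0 < k.+1%:R^-1 :> R by rewrite invr_gt0.
set D := fun x : Rn => rc (cube_density k.+1%:R^-1 x).
have cD : cintegrable mu D.
  by have [] := bounded_on_box_L12 (bounded_cube_density k0).
have cDh0 : cintegrable mu (fun x => h 0 * D x) by exact: cintegrableZ.
have -> : h 0 = cintegral mu setT (fun x => h 0 * D x).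
  by rewrite cintegralZ// cintegral_real integral_cube_density// mulr1.
rewrite -cintegralB//; last exact: ch.
apply: le_trans (cabs_cintegral_le _) _; first by apply: cintegrableB => //; exact: ch.
apply: (@le_trans _ _ (\int[mu]_x (r * cube_density k.+1%:R^-1 x))); last first.
  rewrite RintegralZl//; last by have [] := cD.
  by rewrite integral_cube_density// mulr1.
apply: le_Rintegral => //.
- by apply: integrable_cabs; apply: cintegrableB => //; exact: ch.
- by have [iD _] := cD; exact: (integrableZl measurableT r iD).
move=> x _; rewrite (mulrC (h 0)) -mulrBr cabsM cabs_real.
rewrite ger0_norm ?cube_density_ge0// mulrC.
rewrite /cube_density indicE; have [xb|_] := boolP (x \in box _).
  rewrite ler_wpM2r ?mulr_ge0 ?invr_ge0 ?exprn_ge0//.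
  move: xb; rewrite inE => xb.
  apply: dP; split => // i j; rewrite ord1 mxE -ball_normE /= sub0r normrN.
  apply: le_lt_trans kd; rewrite ler_norml.
  by have := xb j; rewrite /= in_itv.
by rewrite !mulr0.
Qed.

(** Fourier inversion at the origin: test against the uniform densities of
shrinking cubes, whose transforms are bounded by 1 and tend to 1 pointwise. *)
Lemma fourier_inversion0 f F :
  continuous (fun x => Re (f x)) -> continuous (fun x => Im (f x)) ->
  is_fourier f F -> cintegrable mu F -> f 0 = cintegral mu setT F.
Proof.
move=> c1 c2 fF cF; have /is_fourierP[f2 F2 _] := fF.
have k0 k : 0 < k.+1%:R^-1 :> R by rewrite invr_gt0.
pose D k := fun x : Rn => rc (cube_density (k.+1%:R^-1) x).
have bD k : bounded_on_box (D k) by exact: bounded_cube_density.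
have D12 k := bounded_on_box_L12 (bD k).
have pars k := parseval fF (is_fourier_bounded_on_box (bD k)).
have DJ k x : conjc (D k x) = D k x by rewrite /D conj_real.
have ftD1 k xi : cabs (ftr (D k) xi) <= 1.
  have [cD _] := D12 k.
  apply: le_trans (cabs_phase_transform_le (@measurable_row_phase R n) xi cD) _.
  rewrite -(integral_cube_density (k0 k)) le_eqVlt; apply/orP; left; apply/eqP.
  by apply: eq_Rintegral => x _; rewrite cabs_real ger0_norm// cube_density_ge0.
have ftDlim xi : cabs (ftr (D k) xi - 1) @[k --> \oo] --> (0 : R).
  apply/cvgrPdist_le => r r0.
  have cph : {for 0, continuous (fun x : Rn => row_phase x xi)}.
    exact: (@continuous_row_phase xi 0).
  have h0 : expi (row_phase 0 xi) = 1 :> R[i].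
    rewrite /row_phase /dotp big1 ?mulr0 ?oppr0 ?expi0// => i _.
    by rewrite mxE mul0r.
  have := @cube_average_cvg (fun x => expi (row_phase x xi)) _ _ _ _ r0.
  rewrite h0 => H; apply: filterS (H _ _ _) => [k||| ].
  - by rewrite sub0r normrN ger0_norm// cabs_ge0.
  - exact: (cvg_comp _ _ cph (@continuous_cos R _)).
  - exact: (cvg_comp _ _ cph (@continuous_sin R _)).
  - move=> e e0; have [ce _] := bounded_on_box_L12 (bounded_cube_density e0).
    exact: (cintegrable_phase (@measurable_row_phase R n)).
have mF := cintegrable_meas cF.
have mftD k : cmeasurable (ftr (D k)).
  by apply: cmeasurable_ftr; have [/cintegrable_meas] := D12 k.
have [lim1 lim2] : Re (cintegral mu setT (fun xi => F xi * conjc (ftr (D k) xi)))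
      @[k --> \oo] --> Re (cintegral mu setT F) /\
    Im (cintegral mu setT (fun xi => F xi * conjc (ftr (D k) xi)))
      @[k --> \oo] --> Im (cintegral mu setT F).
  apply: (@cdominated_cvg _ _ _ mu (fun k xi => F xi * conjc (ftr (D k) xi)) F
    (fun xi => cabs (F xi))) => //.
  - by move=> k; apply: cmeasurableM => //; exact: cmeasurableJ.
  - apply: aeW => xi; have := cvg0_cabsM (F xi) (ftDlim xi).
    apply: cvg_trans; apply: near_eq_cvg; apply: nearW => k.
    set z := ftr (D k) xi.
    have -> : F xi * conjc z - F xi = F xi * conjc (z - 1).
      by apply: complex_ext; rewrite !ReImE /=; ring.
    by rewrite !cabsM cabsJ mulrC.
  - exact: integrable_cabs.
  - by move=> k xi; rewrite cabsM cabsJ ler_piMr ?cabs_ge0.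
have lim := cvg_cabs0 lim1 lim2.
apply/eqP; rewrite -subr_eq0; apply/eqP/cabs_eq0/eqP.
rewrite eq_le cabs_ge0 andbT; apply/ler_addgt0Pr => r r0; rewrite add0r.
have r2 : 0 < r / 2 by rewrite divr_gt0.
have ch e : 0 < e -> cintegrable mu (fun x => rc (cube_density e x) * f x).
  move=> e0; apply: cintegrable_mulL2 => //.
  by have [] := bounded_on_box_L12 (bounded_cube_density e0).
have avg := cube_average_cvg (c1 0) (c2 0) ch r2.
move/cvgrPdist_le/(_ _ r2) : lim => lim.
have [k [k1 k2]] := filter_ex (filterI lim avg).
move: k1; rewrite sub0r normrN ger0_norm ?cabs_ge0// pars => k1.
rewrite (_ : cintegral mu setT (fun x => rc (cube_density k.+1%:R^-1 x) * f x) =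
   cintegral mu setT (fun x => f x * conjc (D k x))) in k2; last first.
  by apply: eq_cintegral => x; rewrite DJ mulrC.
move: k1 k2; set z := cintegral mu setT (fun x => f x * _) => k1 k2.
rewrite (_ : f 0 - _ = (z - cintegral mu setT F) - (z - f 0)); last by ring.
by rewrite (le_trans (cabsD _ _))// cabsN [r]splitr lerD.
Qed.

End inversion.

(** * The resolvent symbol: integrability and homogeneity *)

Section symbol.
Context {R : realType}.
Local Notation leb := (@lebesgue_measure R).
Local Notation Rm := (measurableTypeR R).
Local Notation mu n := (lebesgue_row R n).

Definition weight {n} (s : R) (xi : 'rV[R]_n) : R := (2 * pi * enorm xi) `^ (2 * s).

Lemma weight_ge0 n s (xi : 'rV[R]_n) : 0 <= weight s xi.
Proof. exact: powR_ge0. Qed.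

Lemma measurable_weight n s : measurable_fun setT (@weight n s).
Proof.
apply: (measurableT_comp (measurable_powR _)).
by apply: measurable_funM; [exact: measurable_cst|exact: measurable_enorm].
Qed.

Lemma symbolE n s omega (xi : 'rV[R]_n) : symbol s omega xi = (weight s xi + omega)^-1.
Proof. by []. Qed.

Lemma weightD_gt0 n s omega (xi : 'rV[R]_n) : 0 < omega -> 0 < weight s xi + omega.
Proof. by move=> o0; rewrite ltr_wpDl// weight_ge0. Qed.

Lemma symbol_gt0 n s omega (xi : 'rV[R]_n) : 0 < omega -> 0 < symbol s omega xi.
Proof. by move=> o0; rewrite invr_gt0 weightD_gt0. Qed.

Lemma symbol_le n s omega (xi : 'rV[R]_n) : 0 < omega -> symbol s omega xi <= omega^-1.
Proof.
by move=> o0; rewrite lef_pV2 ?posrE// ?weightD_gt0// lerDr weight_ge0.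
Qed.

Lemma measurable_symbol n s omega : 0 < omega ->
  measurable_fun setT (fun xi : 'rV[R]_n => symbol s omega xi).
Proof.
move=> o0; rewrite (_ : (fun _ => _) = fun xi => (weight s xi + omega) `^ (-1)).
  apply: (measurableT_comp (measurable_powR _)).
  by apply: measurable_funD; [exact: measurable_weight|exact: measurable_cst].
by apply/funext => xi; rewrite powR_inv1// ltW// weightD_gt0.
Qed.

Lemma enormZ n (r : R) (x : 'rV[R]_n) : 0 <= r -> enorm (r *: x) = r * enorm x.
Proof.
move=> r0; rewrite /enorm -[in RHS](ger0_norm r0) -sqrtr_sqr -sqrtrM ?sqr_ge0//.
congr Num.sqrt; rewrite /dotp mulr_sumr; apply: eq_bigr => i _.
by rewrite !mxE; ring.
Qed.

Lemma measurable_dilation n (r : R) :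
  measurable_fun setT (fun x : 'rV[R]_n => r *: x).
Proof.
apply/measurable_fun_rowP => i; under eq_fun do rewrite mxE.
apply: measurable_funM; first exact: measurable_cst.
exact: measurable_coord.
Qed.

(** By induction on the dimension from the change of variables on the line. *)
Lemma ge0_integral_dilation n (r : R) (f : 'rV[R]_n -> \bar R) : 0 < r ->
  measurable_fun setT f -> (forall x, (0 <= f x)%E) ->
  (\int[mu n]_x f x = (r ^+ n)%:E * \int[mu n]_x f (r *: x)%R)%E.
Proof.
move=> r0; elim: n => [|n IHn] in f *.
  move=> mf f0; rewrite expr0 mul1e; apply: eq_integral => x _; congr f.
  by apply/rowP => -[].
move=> mf f0.
have mfr : measurable_fun setT (fun x : 'rV[R]_n.+1 => f (r *: x)).
  exact: (measurableT_comp mf (@measurable_dilation _ r)).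
have mfc := measurableT_comp mf (@measurable_row_cons R n).
have mfrc := measurableT_comp mfr (@measurable_row_cons R n).
rewrite !ge0_integral_row_succ// !fubini_tonelli1//.
rewrite (ge0_integral_affine 0 r0); last 2 first.
- by apply: measurable_fun_fubini_tonelli_F => //; exact: mfc.
- by move=> a; apply: integral_ge0.
rewrite exprS EFinM -muleA; congr (_ * _)%E.
rewrite -ge0_integralZl//; last 3 first.
- by apply: measurable_fun_fubini_tonelli_F => //; exact: mfrc.
- by move=> a _; apply: integral_ge0.
- by rewrite lee_fin exprn_ge0// ltW.
apply: eq_integral => a _; rewrite add0r /fubini_F IHn//.
  congr (_ * _)%E; apply: eq_integral => x _ /=; congr f.
  apply/rowP => i; rewrite !mxE; case: unliftP => [j _|_] //=.
  by rewrite mxE.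
exact: (measurableT_comp mfc (measurable_pair1 (r * a : Rm))).
Qed.

Lemma integral_cst_box n (c K : R) : 0 <= c -> 0 <= K ->
  (\int[mu n]_x (c * \1_(box K) x)%:E = (c * (2 * K) ^+ n)%:E)%E.
Proof.
move=> c0 K0; under eq_integral do rewrite EFinM.
have mb := @measurable_box R n K.
rewrite ge0_integralZl_EFin//; last by apply/measurable_EFinP; exact: measurable_indic.
rewrite integral_indic// setIT EFinM; congr (_ * _)%E; exact: lebesgue_box.
Qed.

(** Off the cube of half-side [2^k] the symbol is at most [4^(-sk)], while the
next cube has volume [4^n 2^(nk)]: for [s > n/2] the dyadic sum converges. *)
Lemma symbol_dyadic n s omega (xi : 'rV[R]_n) (k : nat) : 0 < s -> 0 < omega ->
  ~ box (2 ^+ k) xi -> symbol s omega xi <= (2 `^ (- (2 * s))) ^+ k.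
Proof.
move=> s0 o0 nb.
have kx : 2 ^+ k <= 2 * pi * enorm xi.
  have [i ki] : exists i, 2 ^+ k < `|xi 0 i|.
    apply: contrapT => nex; apply: nb => i /=; rewrite in_itv/= -ler_norml leNgt.
    by apply/negP => ki; apply: nex; exists i.
  rewrite (le_trans (ltW ki))// (le_trans (coord_le_enorm _ i))//.
  rewrite ler_peMl ?enorm_ge0//; have := @pi_ge2 R; lra.
have -> : (2 `^ (- (2 * s))) ^+ k = ((2 ^+ k) `^ (2 * s))^-1 :> R.
  rewrite powRN exprVn; congr (_^-1).
  by rewrite -(powR_mulrn k (powR_ge0 2 _)) -(powR_mulrn k (ler0n R 2)) -!powRrM mulrC.
rewrite lef_pV2 ?posrE ?weightD_gt0 ?powR_gt0 ?exprn_gt0//.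
rewrite (@le_trans _ _ (weight s xi))//; last by rewrite lerDl ltW.
apply: ge0_ler_powR; rewrite ?nnegrE ?mulr_ge0 ?(ltW s0) ?exprn_ge0//.
  exact: pi_ge0.
exact: enorm_ge0.
Qed.

Lemma integrable_symbol n s omega : 0 < omega -> n%:R / 2 < s ->
  (mu n).-integrable setT (EFin \o (fun xi : 'rV[R]_n => symbol s omega xi)).
Proof.
move=> o0 ns.
have s0 : 0 < s by apply: le_lt_trans ns; rewrite divr_ge0.
apply/integrableP; split; first by apply/measurable_EFinP; exact: measurable_symbol.
under eq_integral do rewrite /= ger0_norm ?(ltW (symbol_gt0 _ _ _))//.
pose q : R := 2 `^ (- (2 * s)).
have q0 : 0 <= q by exact: powR_ge0.
pose b (k : nat) : set 'rV[R]_n := box (2 ^+ k).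
pose u (k : nat) (xi : 'rV[R]_n) : \bar R := (q ^+ k * \1_(b k.+1) xi)%:E.
have mb k : measurable (b k) by exact: measurable_box.
have mu_ k : measurable_fun setT (u k).
  by apply/measurable_EFinP/measurable_funM; [exact: measurable_cst|exact: measurable_indic].
have u0 k xi : (0 <= u k xi)%E by rewrite lee_fin mulr_ge0 ?exprn_ge0// indicE.
have iu k : (\int[mu n]_xi u k xi = (4 ^+ n * (q * 2 ^+ n) ^+ k)%:E)%E.
  rewrite integral_cst_box ?exprn_ge0//; congr (_%:E).
  have -> : 2 * 2 ^+ k.+1 = 4 * 2 ^+ k :> R by rewrite exprS; ring.
  by rewrite !exprMn -!exprM (mulnC k n) mulrCA.
have xb xi : exists k, b k xi.
  pose k := Num.bound (enorm xi); exists k => i /=; rewrite in_itv/= -ler_norml.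
  rewrite (le_trans (coord_le_enorm _ _))// (le_trans (ltW (archi_boundP (enorm_ge0 xi))))//.
  by rewrite -natrX ler_nat ltnW// ltn_expl.
apply: (@le_lt_trans _ _ (\int[mu n]_xi ((omega^-1 * \1_(b 0%N) xi)%:E +
    \sum_(k <oo) u k xi))%E).
  apply: ge0_le_integral => //.
  - by move=> xi _; rewrite lee_fin ltW// symbol_gt0.
  - by apply/measurable_EFinP; exact: measurable_symbol.
  - apply: emeasurable_funD.
      by apply/measurable_EFinP/measurable_funM; [exact: measurable_cst|exact: measurable_indic].
    by apply: ge0_emeasurable_sum => //.
  - move=> xi _; have [b0|nb0] := pselect (b 0%N xi).
      rewrite -[leLHS]adde0 leeD//; last by apply: nneseries_ge0 => k _ _; exact: u0.
      by rewrite indicE mem_set// mulr1 lee_fin symbol_le.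
    rewrite indicE memNset// mulr0 add0e.
    have exb : exists k, xi \in b k by have [k bk] := xb xi; exists k; rewrite inE.
    case: (ex_minnP exb) => -[|j] bj minj; first by move: bj; rewrite inE.
    have nbj : ~ b j xi by move=> bjx; have := minj j; rewrite inE ltnn => /(_ bjx).
    apply: (@le_trans _ _ (u j xi)).
      rewrite lee_fin indicE bj mulr1; exact: symbol_dyadic.
    apply: le_trans (nneseries_lim_ge j.+1 _); last by move=> k _ _; exact: u0.
    by rewrite big_nat_recr//= leeDr// sume_ge0.
rewrite ge0_integralD//; last 4 first.
- by move=> xi _; rewrite lee_fin mulr_ge0 ?invr_ge0 ?(ltW o0)// indicE.
- by apply/measurable_EFinP/measurable_funM; [exact: measurable_cst|exact: measurable_indic].
- by move=> xi _; apply: nneseries_ge0 => k _ _; exact: u0.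
- exact: ge0_emeasurable_sum.
apply: lte_add_pinfty.
  by rewrite integral_cst_box ?invr_ge0 ?(ltW o0)// ltry.
rewrite integral_nneseries//.
under eq_eseriesr do rewrite iu.
pose z : R := q * 2 ^+ n.
have z0 : 0 <= z by rewrite mulr_ge0// exprn_ge0.
have z1 : z < 1.
  rewrite /z /q -powR_mulrn// -powRD ?pnatr_eq0//; last by rewrite implybT.
  rewrite addrC -opprB powRN invf_lt1 ?powR_gt0//.
  rewrite /powR pnatr_eq0/= -[X in X < _]expR0 ltr_expR mulr_gt0 ?ln_gt0 ?ltr1n//.
  by move: ns; rewrite subr_gt0 ltr_pdivrMr// mulrC.
apply: (@le_lt_trans _ _ (4 ^+ n / (1 - z))%:E); last exact: ltry.
apply: lime_le.
  by apply: is_cvg_nneseries => k _ _; rewrite lee_fin mulr_ge0 ?exprn_ge0.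
apply: nearW => m; rewrite sumEFin lee_fin.
have zn1 : z != 1 by rewrite lt_eqF.
have /(congr1 (fun v => v m)) := geometric_seriesE (4 ^+ n) zn1.
rewrite /series/= => ->; rewrite ler_wpM2r ?invr_ge0 ?subr_ge0 ?(ltW z1)//.
by rewrite ler_piMr ?exprn_ge0// lerBlDr lerDl exprn_ge0.
Qed.

End symbol.

Section resolvent.
Context {R : realType} {n : nat}.
Local Notation mu := (lebesgue_row R n).

(** The value at the origin of the fundamental solution of [(-Delta)^s + omega]. *)
Definition resolvent_mass (s omega : R) : R := \int[mu]_xi symbol s omega xi.

(** The symbol is bounded below on the unit cube. *)
Lemma resolvent_mass_gt0 s omega : 0 < omega -> n%:R / 2 < s ->
  0 < resolvent_mass s omega.
Proof.
move=> o0 ns; have is_ := integrable_symbol o0 ns.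
have s0 : 0 < s by apply: le_lt_trans ns; rewrite divr_ge0.
pose m : R := ((2 * pi * n%:R) `^ (2 * s) + omega)^-1.
have m0 : 0 < m by rewrite invr_gt0 ltr_wpDl ?powR_ge0.
apply: (@lt_le_trans _ _ (m * (2 * 1) ^+ n)); first by rewrite mulr_gt0// exprn_gt0// mulr1.
rewrite -[leLHS]/(fine (m * (2 * 1) ^+ n)%:E) -integral_cst_box ?(ltW m0)//.
have mb := @measurable_box R n 1.
have ib := integrable_indic_fin mb (lebesgue_box_lty n 1).
apply: le_Rintegral => //; first exact: (integrableZl measurableT m ib).
move=> xi _; rewrite indicE; have [xb|_] := boolP (xi \in box 1); last first.
  by rewrite mulr0 ltW// symbol_gt0.
rewrite mulr1 lef_pV2 ?posrE ?weightD_gt0 ?ltr_wpDl ?powR_ge0// lerD2r.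
apply: ge0_ler_powR; rewrite ?nnegrE ?mulr_ge0 ?(ltW s0) ?pi_ge0 ?enorm_ge0//.
rewrite ler_wpM2l ?mulr_ge0 ?pi_ge0// -[leRHS]mulr1; apply: enorm_le_box => //.
by move: xb; rewrite inE.
Qed.

(** The dilation by [tau^(1/2s)] turns the symbol at frequency [tau * omega] into
the one at [omega]; only this homogeneity brings in the dimension. *)
Lemma resolvent_mass_scale s omega tau : 0 < omega -> 0 < tau -> n%:R / 2 < s ->
  resolvent_mass s (tau * omega) = tau `^ (n%:R / (2 * s) - 1) * resolvent_mass s omega.
Proof.
move=> o0 t0 ns; have is_ := integrable_symbol o0 ns.
have s0 : 0 < s by apply: le_lt_trans ns; rewrite divr_ge0.
have s2 : 2 * s != 0 by rewrite gt_eqF// mulr_gt0.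
pose r := tau `^ (2 * s)^-1.
have r0 : 0 < r by exact: powR_gt0.
have rs : r `^ (2 * s) = tau by rewrite -powRrM mulVf// powRr1// ltW.
have rn : r ^+ n = tau `^ (n%:R / (2 * s)).
  by rewrite -powR_mulrn ?(ltW r0)// -powRrM mulrC.
have symbolZ xi : symbol s (tau * omega) (r *: xi : 'rV[R]_n) = tau^-1 * symbol s omega xi.
  rewrite /symbol enormZ ?(ltW r0)//.
  rewrite (_ : 2 * pi * (r * enorm xi) = r * (2 * pi * enorm xi)); last by ring.
  rewrite powRM ?(ltW r0) ?mulr_ge0 ?pi_ge0 ?enorm_ge0// rs -mulrDr invfM.
  by [].
have to0 : 0 < tau * omega by rewrite mulr_gt0.
rewrite /resolvent_mass {1}/Rintegral (ge0_integral_dilation r0); last 2 first.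
- by apply/measurable_EFinP; exact: measurable_symbol.
- by move=> xi; rewrite lee_fin ltW// symbol_gt0.
under eq_integral do rewrite symbolZ EFinM.
rewrite integralZl// fineM//; last first.
  by rewrite fin_numM//; exact: integrable_fin_num.
rewrite fineM//; last exact: integrable_fin_num.
rewrite /= mulrA rn; congr (_ * _).
by rewrite powRB ?powRr1 ?(ltW t0)// (gt_eqF t0)/= implybT.
Qed.

End resolvent.

(** * A one-variable inequality *)

Section power_gap.
Context {R : realType}.
Implicit Types (a e x y t : R).

(** Young's inequality for the conjugate exponents [1/a] and [1/(1 - a)]. *)
Lemma powR_bernoulli a x : 0 < a -> a < 1 -> 0 <= x -> x `^ a <= 1 + a * (x - 1).
Proof.
move=> a0 a1 x0.
have a10 : 0 < 1 - a by rewrite subr_gt0.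
have := @conjugate_powR R (x `^ a) 1 a^-1 (1 - a)^-1 (powR_ge0 _ _) ler01.
rewrite !invr_gt0 !invrK => /(_ a0 a10); rewrite mulr1 -powRrM divff ?gt_eqF//.
rewrite powRr1// powR1 mul1r => /(_ _)/le_trans; apply; first by ring.
by rewrite le_eqVlt; apply/orP; left; apply/eqP; ring.
Qed.

Lemma powR_tangent a x y : 0 < a -> a < 1 -> 0 <= x -> 0 < y ->
  x `^ a <= y `^ a + a * y `^ (a - 1) * (x - y).
Proof.
move=> a0 a1 x0 y0.
have := powR_bernoulli a0 a1 (divr_ge0 x0 (ltW y0)).
rewrite -(ler_pM2l (powR_gt0 a y0)) -powRM ?(ltW y0) ?divr_ge0 ?(ltW y0)//.
rewrite mulrCA divff ?gt_eqF// mulr1 => /le_trans; apply.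
rewrite le_eqVlt; apply/orP; left; apply/eqP.
rewrite powRB ?powRr1 ?(ltW y0)//; last by rewrite (gt_eqF y0) implybT.
by field; rewrite gt_eqF.
Qed.

(** A quantitative continuity of powers at 1, uniform in the exponent. *)
Lemma powR_dist1 a x : 0 < a -> a <= 1 -> 0 <= x -> `|x `^ a - 1| <= `|x - 1|.
Proof.
move=> a0 a1; rewrite le_eqVlt => /predU1P[<-|x0].
  by rewrite powR0 ?gt_eqF.
have [x1|x1] := leP 1 x.
  rewrite !ger0_norm ?subr_ge0//; last by rewrite -(powRr0 x) ler_powR// ltW.
  by rewrite lerD2r -[leRHS](powRr1 (ltW x0)) ler_powR.
have x01 : 0 < x <= 1 by rewrite x0 ltW.
rewrite !ler0_norm ?subr_le0 ?(ltW x1)//; last by rewrite -(powRr0 x) ger_powR// ltW.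
by rewrite !opprB lerD2l lerN2 -[leLHS](powRr1 (ltW x0)) ger_powR.
Qed.

(** The gap in Bernoulli's inequality, normalized to slope 1 at infinity. *)
Definition power_gap a t := t - 1 - (t `^ a - 1) / a.

Lemma gap_tangent a x y : 0 < a -> a < 1 -> 0 <= x -> 0 < y ->
  power_gap a y + (1 - y `^ (a - 1)) * (x - y) <= power_gap a x.
Proof.
move=> a0 a1 x0 y0; have h := powR_tangent a0 a1 x0 y0.
rewrite -subr_ge0 [X in 0 <= X](_ : _ =
    a^-1 * (y `^ a + a * y `^ (a - 1) * (x - y) - x `^ a)).
  by rewrite mulr_ge0 ?subr_ge0 ?invr_ge0 ?(ltW a0).
by rewrite /power_gap; field; rewrite gt_eqF.
Qed.

Lemma gap_ge0 a x : 0 < a -> a < 1 -> 0 <= x -> 0 <= power_gap a x.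
Proof.
move=> a0 a1 x0; have := gap_tangent a0 a1 x0 ltr01.
by rewrite {1}/power_gap powR1 !subrr mul0r mul0r !addr0 subr0.
Qed.

Lemma powR_lt1_gt1 a y : a < 1 -> 1 < y -> y `^ (a - 1) < 1.
Proof.
move=> a1 y1; have y0 : 0 < y by exact: lt_trans y1.
rewrite -opprB powRN invf_lt1 ?powR_gt0//.
have := @gt0_ltr_powR R (1 - a); rewrite subr_gt0 => /(_ a1 1 y).
by rewrite !nnegrE (ltW y0) ler01 powR1 => /(_ isT isT y1).
Qed.

Lemma powR_gt1_lt1 a y : a < 1 -> 0 < y -> y < 1 -> 1 < y `^ (a - 1).
Proof.
move=> a1 y0 y1.
rewrite -opprB powRN invf_gt1 ?powR_gt0//.
have := @gt0_ltr_powR R (1 - a); rewrite subr_gt0 => /(_ a1 y 1).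
by rewrite !nnegrE (ltW y0) ler01 powR1 => /(_ isT isT y1).
Qed.

(** The tangent at the midpoint of [x] and 1 starts from a nonnegative value and
rises towards [x]. *)
Lemma gap_gt0 a x : 0 < a -> a < 1 -> 0 < x -> x != 1 -> 0 < power_gap a x.
Proof.
move=> a0 a1 x0 x1; pose y := (x + 1) / 2.
have y0 : 0 < y by rewrite divr_gt0// addr_gt0.
apply: lt_le_trans (gap_tangent a0 a1 (ltW x0) y0).
rewrite ltr_wpDl ?gap_ge0 ?(ltW y0)//.
have xy : x - y = (x - 1) / 2 by rewrite /y; field.
have [xlt|xgt|xe] := ltgtP x 1; last by rewrite xe eqxx in x1.
- have y1 : y < 1 by rewrite /y; lra.
  have h := powR_gt1_lt1 a1 y0 y1.
  by rewrite xy nmulr_rgt0 ?subr_lt0//; lra.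
- have y1 : 1 < y by rewrite /y; lra.
  have h := powR_lt1_gt1 a1 y1.
  by rewrite xy mulr_gt0 ?subr_gt0//; lra.
Qed.

(** The gap is convex, vanishes only at 1 and grows linearly, so a gap small
relative to [1 + t] confines [t] to a neighbourhood of 1. *)
Lemma gap_coercive a e : 0 < a -> a < 1 -> 0 < e ->
  exists2 eta : R, 0 < eta & forall t, 0 <= t ->
    power_gap a t <= eta * (1 + t) -> `|t - 1| <= e.
Proof.
move=> a0 a1 e0; pose d := Num.min e 2^-1.
have d0 : 0 < d by rewrite lt_min e0 invr_gt0 ltr0n.
have d2 : d <= 2^-1 by rewrite ge_min lexx orbT.
have dp : 1 < 1 + d by rewrite ltrDl.
have dm0 : 0 < 1 - d by lra.
have gp : 0 < power_gap a (1 + d) by apply: gap_gt0 => //; [lra|rewrite gt_eqF].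
have gm : 0 < power_gap a (1 - d) by apply: gap_gt0 => //; rewrite lt_eqF//; lra.
pose m := 1 - (1 + d) `^ (a - 1).
have m0 : 0 < m by rewrite subr_gt0 powR_lt1_gt1.
exists (Num.min (power_gap a (1 + d) / 6) (Num.min m (power_gap a (1 - d) / 4))).
  by rewrite !lt_min m0 !divr_gt0.
move=> t t0; set eta := Num.min _ _ => h.
have eta1 : eta <= power_gap a (1 + d) / 6 by rewrite ge_min lexx.
have eta2 : eta <= m by rewrite !ge_min lexx orbT.
have eta3 : eta <= power_gap a (1 - d) / 4 by rewrite !ge_min lexx !orbT.
have de : d <= e by rewrite ge_min lexx.
rewrite ler_norml; apply/andP; split; rewrite leNgt; apply/negP => ht.
  have td : t < 1 - d by lra.
  have := gap_tangent a0 a1 t0 dm0.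
  have : 0 <= (1 - (1 - d) `^ (a - 1)) * (t - (1 - d)).
    have y1 : 1 - d < 1 by lra.
    have h1 := powR_gt1_lt1 a1 dm0 y1.
    by rewrite nmulr_rge0 ?subr_lt0// subr_le0 ltW.
  have : eta * (1 + t) <= power_gap a (1 - d) / 4 * 2.
    apply: (@le_trans _ _ (power_gap a (1 - d) / 4 * (1 + t))).
      by rewrite ler_wpM2r//; lra.
    by rewrite ler_wpM2l//; lra.
  by lra.
have td : 1 + d < t by lra.
have dp0 : 0 < 1 + d by lra.
have := gap_tangent a0 a1 t0 dp0; rewrite -/m.
have : eta * (t - (1 + d)) <= m * (t - (1 + d)) by rewrite ler_wpM2r//; lra.
have : eta * (2 + d) <= power_gap a (1 + d) / 6 * 3.
  apply: (@le_trans _ _ (power_gap a (1 + d) / 6 * (2 + d))).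
    by rewrite ler_wpM2r//; lra.
  by rewrite ler_wpM2l//; lra.
by move: h; rewrite (_ : eta * (1 + t) = eta * (2 + d) + eta * (t - (1 + d))); [lra|ring].
Qed.

End power_gap.

Section scalar.
Context {R : realType}.
Implicit Types (A b p K : R).

(** The two sides touch at [tau = 1], so they are tangent there; the slopes are
compared by letting [tau] tend to 1 from both sides. *)
Lemma tangent_identity e A b K : 0 < e -> e < 1 -> 0 < K -> K = A + b ->
  (forall tau, 0 < tau -> K * tau `^ e <= A + tau * b) -> b = e * K.
Proof.
move=> e0 e1 K0 KE h.
have key x : 0 < x -> b * (1 - x^-1) <= e * K * x `^ (1 - e) * (1 - x^-1).
  move=> x0; have xV0 : 0 < x^-1 by rewrite invr_gt0.
  have := powR_tangent e0 e1 ler01 xV0; rewrite powR1.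
  rewrite [x^-1 `^ (e - 1)](_ : _ = x `^ (1 - e)); last first.
    by rewrite -powR_inv1 ?ltW// -powRrM; congr (_ `^ _); ring.
  have := h _ xV0; rewrite -(ler_pM2l K0 1).
  move: (x^-1) (x^-1 `^ e) (x `^ (1 - e)) => y z w.
  by rewrite KE; lra.
have e10 : 0 < 1 - e by rewrite subr_gt0.
have e11 : 1 - e <= 1 by rewrite gerBl ltW.
apply/eqP; rewrite eq_le; apply/andP; split.
  apply/ler_addgt0Pr => d d0; pose x := 1 + d / (e * K).
  have eK : 0 < e * K by rewrite mulr_gt0.
  have x1 : 1 < x by rewrite ltrDl divr_gt0.
  have x0 : 0 < x by exact: lt_trans x1.
  have xV : 0 < 1 - x^-1 by rewrite subr_gt0 invf_lt1.
  have := key _ x0; rewrite ler_pM2r// => /le_trans; apply.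
  apply: (@le_trans _ _ (e * K * x)).
    by rewrite ler_pM2l// -[leRHS](powRr1 (ltW x0)) ler_powR// ltW.
  by rewrite /x mulrDr mulr1 mulrCA divff ?gt_eqF// mulr1.
apply/ler_addgt0Pr => d d0; have eK : 0 < e * K by rewrite mulr_gt0.
pose x := (1 + d / (e * K))^-1.
have x1' : 1 < 1 + d / (e * K) by rewrite ltrDl divr_gt0.
have x0 : 0 < x by rewrite invr_gt0; exact: lt_trans x1'.
have x1 : x < 1 by rewrite invf_lt1//; exact: lt_trans x1'.
have xV : 1 - x^-1 < 0 by rewrite subr_lt0 invf_gt1.
have := key _ x0; rewrite ler_nM2r// => bx.
have : e * K * x <= b.
  apply: le_trans bx; rewrite ler_pM2l// -[leLHS](powRr1 (ltW x0)) ger_powR//.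
  by rewrite x0 ltW.
move=> h1; rewrite -lerBlDr; apply: le_trans h1.
have -> : e * K - d = e * K * (1 - d / (e * K)) by field; rewrite !gt_eqF.
rewrite ler_pM2l// /x -[leRHS]mul1r ler_pdivlMr; last exact: lt_trans x1'.
have : 0 <= (d / (e * K)) ^+ 2 by rewrite sqr_ge0.
by move: (d / _) => z; rewrite expr2; lra.
Qed.

(** Here [A] and [b] stand for the Dirichlet form and omega times the mass, [d1]
and [d2] for the deviations of twice the energy and of [b] from their values at the
wave, and [p] for the ratio of the values at the origin.  Tested at the [tau] with
[p ^ 2 = tau ^ th], the last constraint bounds the gap of [tau] for the exponent
[th * (sigma + 1)] by [d1 + tau * d2]. *)
Lemma scalar_stability th sigma K eps : 0 < th -> 0 < sigma ->
  th * (sigma + 1) < 1 -> 0 < K -> 0 < eps ->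
  exists2 eta, 0 < eta & forall d1 d2 A b p, 0 <= A -> 0 <= p ->
    A = th * K - K / (sigma + 1) + d1 + K / (sigma + 1) * p `^ (2 * sigma + 2) ->
    b = (1 - th) * K + d2 -> `|d1| <= eta -> `|d2| <= eta ->
    (forall tau, 0 < tau -> K * p ^+ 2 * tau `^ (1 - th) <= A + tau * b) ->
    A + b - 2 * K * p + K <= eps.
Proof.
move=> th0 s0 a1 K0 eps0; pose a := th * (sigma + 1).
have s10 : 0 < sigma + 1 by rewrite addr_gt0.
have a0 : 0 < a by rewrite mulr_gt0.
have th1 : th < 1.
  by apply: le_lt_trans a1; rewrite ler_peMr ?lerDr ?(ltW th0) ?(ltW s0).
(* The conclusion differs from [d1 + d2] by at most [3 K e]. *)
pose e := eps / (6 * K).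
have e0 : 0 < e by rewrite divr_gt0// mulr_gt0.
have [eta eta0 H] := gap_coercive a0 a1 e0.
exists (Num.min (th * K * eta) (eps / 4)).
  by rewrite lt_min mulr_gt0 ?mulr_gt0 ?divr_gt0.
move=> d1 d2 A b p A0 p0 AE bE; rewrite !le_min => /andP[d11 d12] /andP[d21 d22] htr.
pose tau := p `^ (2 / th).
have tau0 : 0 <= tau by exact: powR_ge0.
have pE : p = tau `^ (th / 2).
  by rewrite -powRrM (_ : 2 / th * (th / 2) = 1) ?powRr1//; field; rewrite gt_eqF.
have paE : p `^ (2 * sigma + 2) = tau `^ a.
  by rewrite -powRrM; congr (_ `^ _); rewrite /a; field; rewrite gt_eqF.
have gapE : th * K * power_gap a tau =
    th * K * (tau - 1) - K / (sigma + 1) * (tau `^ a - 1).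
  by rewrite /power_gap /a; field; rewrite !gt_eqF.
rewrite paE in AE.
have small : th * K * power_gap a tau <= d1 + tau * d2.
  rewrite gapE; have [t0|tpos] := eqVneq tau 0.
    (* If [p = 0] the constraint says nothing; [A >= 0] takes its place. *)
    by move: AE; rewrite t0 powR0 ?(gt_eqF a0)//; lra.
  have tgt : 0 < tau by rewrite lt_neqAle eq_sym tpos.
  have := htr _ tgt; rewrite -mulrA.
  have -> : p ^+ 2 * tau `^ (1 - th) = tau.
    rewrite -powR_mulrn// pE -powRrM -powRD ?(gt_eqF tgt) ?implybT//.
    have -> : th / 2 * 2%:R + (1 - th) = 1 by field.
    by rewrite powRr1.
  by rewrite AE bE; move: (K / _) (tau `^ a) => z w; lra.
have tau1 : `|tau - 1| <= e.
  apply: H => //; rewrite -(ler_pM2l (mulr_gt0 th0 K0)); apply: (le_trans small).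
  rewrite mulrA [leRHS]mulrDr mulr1; apply: lerD.
    exact: le_trans (ler_norm _) d11.
  by rewrite mulrC ler_wpM2r//; exact: le_trans (ler_norm _) d21.
have h1 := powR_dist1 a0 (ltW a1) tau0.
have th20 : 0 < th / 2 by rewrite divr_gt0.
have th21 : th / 2 <= 1 by lra.
have h2 := powR_dist1 th20 th21 tau0; rewrite -pE in h2.
have g1 : K / (sigma + 1) * (tau `^ a - 1) <= K * e.
  apply: (@le_trans _ _ (K / (sigma + 1) * e)).
    rewrite ler_pM2l ?divr_gt0//.
    by apply: le_trans (ler_norm _) _; exact: le_trans h1 tau1.
  by rewrite ler_pM2r// ler_pdivrMr// ler_peMr ?(ltW K0)// lerDr ltW.
have g2 : - (K * (p - 1)) <= K * e.
  rewrite -mulrN ler_pM2l//; apply: le_trans (ler_norm _) _.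
  by rewrite normrN; exact: le_trans h2 tau1.
have KeE : K * e = eps / 6 by rewrite /e; field; rewrite gt_eqF.
have d1e : d1 <= eps / 4 by exact: le_trans (ler_norm _) d12.
have d2e : d2 <= eps / 4 by exact: le_trans (ler_norm _) d22.
move: g1 g2; rewrite KeE AE bE.
move: (K / _) (tau `^ a) => z w; lra.
Qed.

End scalar.

(** * The space H^s *)

Section sobolev.
Context {R : realType} {n : nat}.
Local Notation Rn := 'rV[R]_n.
Local Notation mu := (lebesgue_row R n).
Implicit Types (f g F G : Rn -> R[i]) (a s omega : R) (c : R[i]).

Local Opaque expi cintegral.

Lemma weight_half s (xi : Rn) : weight (s / 2) xi ^+ 2 = weight s xi.
Proof.
rewrite /weight -powR_mulrn ?powR_ge0// -powRrM.
by have -> : 2 * (s / 2) * 2%:R = 2 * s by field.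
Qed.

Lemma cmeasurable_weightM a F : cmeasurable F ->
  cmeasurable (fun xi : Rn => rc (weight a xi) * F xi).
Proof.
move=> mF; apply: cmeasurableM mF; apply: cmeasurable_real.
exact: measurable_weight.
Qed.

Lemma fraclapP a f : (exists h, is_fraclap a f h) -> is_fraclap a f (fraclap a f).
Proof. by move=> [h fh]; exact: (xgetPex _ (ex_intro _ h fh)). Qed.

Lemma sqint0_ae f : cmeasurable f -> sqint mu f = 0%E ->
  {ae mu, forall x, f x = 0}.
Proof.
move=> mf f0; have mf2 := measurable_sqint mf.
have : (\int[mu]_x `|(cabs (f x) ^+ 2)%:E| = 0)%E.
  rewrite -[RHS]f0; apply: eq_integral => x _.
  by rewrite gee0_abs// lee_fin sqr_ge0.
move/(ae_eq_integral_abs mu measurableT mf2); apply: filterS => x /(_ I).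
by move=> /eqP; rewrite eqe expf_eq0/= => /eqP/cabs_eq0.
Qed.

Lemma L2n0_ae f : cmeasurable f -> L2n mu f = 0%E -> {ae mu, forall x, f x = 0}.
Proof.
move=> mf f0; apply: (sqint0_ae mf).
by rewrite -(sqr_sqrte (sqint_ge0 mu f)) -L2nE f0 expe2 mul0e.
Qed.

Lemma ae_eq_sqint f g : cmeasurable f -> cmeasurable g ->
  {ae mu, forall x, f x = g x} -> sqint mu f = sqint mu g.
Proof.
move=> mf mg fg; apply: ge0_ae_eq_integral => //.
- exact: measurable_sqint.
- exact: measurable_sqint.
- by move=> x _; rewrite lee_fin sqr_ge0.
- by move=> x _; rewrite lee_fin sqr_ge0.
- by apply: filterS fg => x + _ => ->.
Qed.

Lemma is_fourier_aeE f F G : is_fourier f F -> is_fourier f G ->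
  {ae mu, forall xi, F xi = G xi}.
Proof.
move=> fF fG; have /is_fourierP[_ [mF _] _] := fF.
have /is_fourierP[_ [mG _] _] := fG.
have := L2n0_ae (cmeasurableB mF mG) (is_fourier_unique fF fG).
by apply: filterS => xi /eqP; rewrite subr_eq0 => /eqP.
Qed.

(** The representative chosen by [fraclap] has the expected transform for every
transform of [f], since these agree almost everywhere. *)
Lemma fraclap_fourier a f F : is_fourier f F -> (exists h, is_fraclap a f h) ->
  is_fourier (fraclap a f) (fun xi => rc (weight a xi) * F xi).
Proof.
move=> fF /fraclapP[G [fG hG]].
have /is_fourierP[_ [mF _] _] := fF; have /is_fourierP[_ [mG _] _] := fG.
have mwF := cmeasurable_weightM a mF; have mwG := cmeasurable_weightM a mG.
have FG := is_fourier_aeE fF fG.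
have /is_fourierP[_ [_ wGoo] _] := hG.
apply: (is_fourier_ae hG).
  split=> //; rewrite (ae_eq_sqint mwF mwG)//.
  by apply: filterS FG => xi ->.
rewrite L2nE (@ae_eq_sqint _ (fun=> 0)).
- rewrite /sqint; under eq_integral do rewrite cabs0 expr0n.
  by rewrite integral0 sqrte0.
- exact: cmeasurableB.
- exact: cmeasurable_cst.
- by apply: filterS FG => xi ->; rewrite subrr.
Qed.

Lemma fraclap_lin a f g c F G : is_fourier f F -> is_fourier g G ->
  (exists h, is_fraclap a f h) -> (exists h, is_fraclap a g h) ->
  is_fraclap a (fun x => f x + c * g x)
    (fun x => fraclap a f x + c * fraclap a g x).
Proof.
move=> fF gG hf hg; exists (fun xi => F xi + c * G xi).
split; first exact: is_fourier_lin.
have := is_fourier_lin c (fraclap_fourier fF hf) (fraclap_fourier gG hg).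
by apply: eq_is_fourier => // xi; rewrite /weight; ring.
Qed.

Lemma L2n_fraclap_lin a f g c F G : is_fourier f F -> is_fourier g G ->
  (exists h, is_fraclap a f h) -> (exists h, is_fraclap a g h) ->
  L2n mu (fraclap a (fun x => f x + c * g x)) =
  L2n mu (fun x => fraclap a f x + c * fraclap a g x).
Proof.
move=> fF gG hf hg; have h := fraclap_lin c fF gG hf hg.
have [K [fK hK]] := h; have h2 := fraclap_fourier fK (ex_intro _ _ h).
exact: etrans (esym (is_fourier_L2n h2)) (is_fourier_L2n hK).
Qed.

Lemma Hs_fourier s f : Hs s f -> exists F, is_fourier f F.
Proof. by move=> [_ _ _ [h [F []]]]; exists F. Qed.

Lemma Hs_fraclap s f F : Hs s f -> is_fourier f F ->
  is_fourier (fraclap (s / 2) f) (fun xi => rc (weight (s / 2) xi) * F xi).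
Proof. by move=> [_ _ _ hf] fF; exact: fraclap_fourier. Qed.

Lemma Hs_cL2 s f : Hs s f -> cL2 mu f.
Proof. by move=> [_ _ /memL2P]. Qed.

Lemma Hs_fraclap_cL2 s f : Hs s f -> cL2 mu (fraclap (s / 2) f).
Proof.
move=> hf; have [F fF] := Hs_fourier hf.
by have /is_fourierP[] := Hs_fraclap hf fF.
Qed.

Lemma Hs_lin s f g c : Hs s f -> Hs s g -> Hs s (fun x => f x + c * g x).
Proof.
move=> Hf Hg; have [F fF] := Hs_fourier Hf; have [G gG] := Hs_fourier Hg.
have [Rf If /memL2P f2 hf] := Hf; have [Rg Ig /memL2P g2 hg] := Hg.
split.
- move=> x; rewrite (_ : _ \o _ = fun x => Re (f x) + (Re c * Re (g x) - Im c * Im (g x))).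
    have h1 := cvgM (cvg_cst (Re c)) (Rg x); have h2 := cvgM (cvg_cst (Im c)) (Ig x).
    exact: (cvgD (Rf x) (cvgB (h1 _ _) (h2 _ _))).
  by apply/funext => y /=; rewrite !ReImE.
- move=> x; rewrite (_ : _ \o _ = fun x => Im (f x) + (Re c * Im (g x) + Im c * Re (g x))).
    have h1 := cvgM (cvg_cst (Re c)) (Ig x); have h2 := cvgM (cvg_cst (Im c)) (Rg x).
    exact: (cvgD (If x) (cvgD (h1 _ _) (h2 _ _))).
  by apply/funext => y /=; rewrite !ReImE.
- by apply/memL2P; apply: cL2D => //; exact: cL2Z.
- by eexists; exact: (fraclap_lin c fF gG hf hg).
Qed.

Lemma HsB s f g : Hs s f -> Hs s g -> Hs s (fun x => f x - g x).
Proof.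
move=> Hf Hg; have := Hs_lin (-1) Hf Hg.
by rewrite (_ : (fun x => _ + _) = fun x => f x - g x)//; apply/funext => x; rewrite mulN1r.
Qed.

Lemma fine_sqintZ c f : cL2 mu f ->
  fine (sqint mu (fun x => c * f x)) = cabs c ^+ 2 * fine (sqint mu f).
Proof.
move=> [mf foo]; have mf2 := measurable_sqint mf.
have -> : sqint mu (fun x => c * f x) = ((cabs c ^+ 2)%:E * sqint mu f)%E.
  rewrite /sqint -ge0_integralZl// ?lee_fin ?sqr_ge0//.
    by apply: eq_integral => x _; rewrite cabsM exprMn EFinM.
  by move=> x _; rewrite lee_fin sqr_ge0.
by rewrite fineM// ge0_fin_numE// sqint_ge0.
Qed.

(** The quantity A of the energy, as a real number. *)
Definition dirichlet s f : R := fine (sqint mu (fraclap (s / 2) f)).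

Lemma dirichlet_ge0 s f : 0 <= dirichlet s f.
Proof. exact/fine_ge0/sqint_ge0. Qed.

Lemma massE f : mass f = fine (sqint mu f).
Proof. by rewrite fine_sqint. Qed.

Lemma mass_ge0 f : 0 <= mass f.
Proof. by rewrite massE; exact/fine_ge0/sqint_ge0. Qed.

Lemma HsnormE s f : Hs s f ->
  Hsnorm s f = (Num.sqrt (dirichlet s f) + Num.sqrt (mass f))%:E.
Proof.
move=> Hf; rewrite /Hsnorm !L2normE (L2n_fine (Hs_cL2 Hf)).
by rewrite (L2n_fine (Hs_fraclap_cL2 Hf)) -massE.
Qed.

Lemma energyE s sigma f : Hs s f ->
  energy s sigma f = 2^-1 * dirichlet s f
    - (2 * sigma + 2)^-1 * cabs (f 0) `^ (2 * sigma + 2).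
Proof.
move=> Hf; rewrite /energy L2normE (L2n_fine (Hs_fraclap_cL2 Hf))/=.
by rewrite sqr_sqrtr// dirichlet_ge0.
Qed.

Lemma HsnormL2 s f : Hsnorm s f = (L2n mu (fraclap (s / 2) f) + L2n mu f)%E.
Proof. by []. Qed.

Lemma Hsnorm_ge0 s f : (0 <= Hsnorm s f)%E.
Proof. by rewrite /Hsnorm !L2normE adde_ge0// L2n_ge0. Qed.

Lemma L2n_fraclap_lin_le s f g c : Hs s f -> Hs s g ->
  (L2n mu (fraclap (s / 2) (fun x => f x + c * g x)%R) <=
   L2n mu (fraclap (s / 2) f) + (cabs c)%:E * L2n mu (fraclap (s / 2) g))%E.
Proof.
move=> Hf Hg; have [F fF] := Hs_fourier Hf; have [G gG] := Hs_fourier Hg.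
have [_ _ _ hf] := Hf; have [_ _ _ hg] := Hg.
have [mf _] := Hs_fraclap_cL2 Hf; have [mg _] := Hs_fraclap_cL2 Hg.
have h1 := L2nD mu mf (cmeasurableM (cmeasurable_cst c) mg).
have h2 := L2n_fraclap_lin c fF gG hf hg.
by rewrite (L2nZ _ c mg) -h2 in h1.
Qed.

End sobolev.

(** * The quadratic form N = A + omega M and the trace at the origin *)

Section trace.
Context {R : realType} {n : nat}.
Local Notation Rn := 'rV[R]_n.
Local Notation mu := (lebesgue_row R n).
Variable s : R.
Hypothesis ns : n%:R / 2 < s.
Implicit Types (f g F G : Rn -> R[i]) (omega : R) (c z : R[i]).

Local Opaque expi cintegral.

Lemma cmeasurable_wsqrt omega F : cmeasurable F ->
  cmeasurable (fun xi : Rn => rc (Num.sqrt (weight s xi + omega)) * F xi).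
Proof.
move=> mF; apply: cmeasurableM mF; apply: cmeasurable_real.
by apply: measurable_sqrt_fun; apply: measurable_funD => //; exact: measurable_weight.
Qed.

(** By Plancherel's theorem, as [(X + omega) |F|^2 = X |F|^2 + omega |F|^2] with X
the square of the weight of order [s / 2]. *)
Lemma form_fourier omega f F : 0 < omega -> Hs s f -> is_fourier f F ->
  cL2 mu (fun xi => rc (Num.sqrt (weight s xi + omega)) * F xi) /\
  fine (sqint mu (fun xi => rc (Num.sqrt (weight s xi + omega)) * F xi)) =
  dirichlet s f + omega * mass f.
Proof.
move=> o0 Hf fF; have hF := Hs_fraclap Hf fF.
have /is_fourierP[_ F2 _] := fF; have [mF Foo] := F2.
have /is_fourierP[_ W2 _] := hF; have [mW Woo] := W2.
have SW : sqint mu (fun xi => rc (weight (s / 2) xi) * F xi) =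
          sqint mu (fraclap (s / 2) f).
  have := is_fourier_L2n hF; rewrite !L2nE => h.
  by rewrite -(sqr_sqrte (sqint_ge0 mu _)) h sqr_sqrte// sqint_ge0.
have SF : sqint mu F = sqint mu f.
  have := is_fourier_L2n fF; rewrite !L2nE => h.
  by rewrite -(sqr_sqrte (sqint_ge0 mu _)) h sqr_sqrte// sqint_ge0.
pose WF (xi : Rn) := rc (weight (s / 2) xi) * F xi.
have E : (sqint mu (fun xi => rc (Num.sqrt (weight s xi + omega)) * F xi)%R =
    sqint mu WF + omega%:E * sqint mu F)%E.
  have mF2 := measurable_sqint mF; have mW2 : measurable_fun setT
      (fun xi => (cabs (WF xi) ^+ 2)%:E) by exact: measurable_sqint.
  rewrite /sqint -ge0_integralZl//; last 2 first.
  - by move=> xi _; rewrite lee_fin sqr_ge0.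
  - by rewrite lee_fin ltW.
  rewrite -ge0_integralD//; first last.
  - by apply: emeasurable_funM => //; exact: measurable_cst.
  - by move=> xi _; rewrite mule_ge0// lee_fin ?sqr_ge0// ltW.
  - by move=> xi _; rewrite lee_fin sqr_ge0.
  apply: eq_integral => xi _; rewrite -EFinM -EFinD; congr (_%:E).
  rewrite /WF !cabsM !cabs_real !exprMn !real_normK ?num_real// weight_half.
  by rewrite sqr_sqrtr ?mulrDl// ltW// weightD_gt0.
have {}SW : sqint mu WF = sqint mu (fraclap (s / 2) f) by exact: SW.
split.
  split; first exact: cmeasurable_wsqrt.
  by rewrite E lte_add_pinfty// lte_mul_pinfty// lee_fin ltW.
rewrite E SW SF massE /dirichlet.
have [_ loo] := Hs_fraclap_cL2 Hf; have foo := (Hs_cL2 Hf).2.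
have fl : sqint mu (fraclap (s / 2) f) \is a fin_num.
  by rewrite ge0_fin_numE// sqint_ge0.
have ff : sqint mu f \is a fin_num by rewrite ge0_fin_numE// sqint_ge0.
by rewrite fineD ?fin_numM// fineM.
Qed.

Definition sqrt_symbol omega (xi : Rn) : R[i] := rc (Num.sqrt (symbol s omega xi)).

Lemma sqrt_symbol_L2 omega : 0 < omega -> cL2 mu (sqrt_symbol omega) /\
  fine (sqint mu (sqrt_symbol omega)) = resolvent_mass (n := n) s omega.
Proof.
move=> o0; have is_ := integrable_symbol o0 ns.
have E : sqint mu (sqrt_symbol omega) = (\int[mu]_xi (symbol s omega xi)%:E)%E.
  apply: eq_integral => xi _; congr (_%:E).
  by rewrite cabs_real real_normK ?num_real// sqr_sqrtr// ltW// symbol_gt0.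
split; last by rewrite E.
split.
  apply: cmeasurable_real; apply: measurable_sqrt_fun.
  exact: measurable_symbol.
rewrite E ltey_eq; apply/orP; left.
by apply: integrable_fin_num is_.
Qed.

Lemma wsqrtK omega (xi : Rn) : 0 < omega ->
  Num.sqrt (weight s xi + omega) * Num.sqrt (symbol s omega xi) = 1.
Proof.
move=> o0; have w0 := weightD_gt0 s xi o0.
by rewrite -sqrtrM ?(ltW w0)// symbolE divff ?sqrtr1// gt_eqF.
Qed.

(** An element of H^s has an integrable transform: it is the product of two square
integrable functions.  This is where [s > n/2] enters. *)
Lemma Hs_fourier_L1 f F : Hs s f -> is_fourier f F -> cintegrable mu F.
Proof.
move=> Hf fF; have [G2 _] := form_fourier ltr01 Hf fF.
have [V2 _] := sqrt_symbol_L2 ltr01.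
have := cintegrable_mulL2 G2 V2.
rewrite (_ : (fun x => _ * _) = F)//; apply/funext => xi.
by rewrite mulrAC -rmorphM/= wsqrtK// mul1r.
Qed.

Lemma Hs_value0 f F : Hs s f -> is_fourier f F -> f 0 = cintegral mu setT F.
Proof.
move=> Hf fF; have [Rf If _ _] := Hf.
exact: fourier_inversion0 Rf If fF (Hs_fourier_L1 Hf fF).
Qed.

(** Completing the square in the form at the vector whose transform is the multiple
[z] of the symbol: the cross term is the value at the origin. *)
Lemma form_square omega f F z : 0 < omega -> Hs s f -> is_fourier f F ->
  fine (sqint mu (fun xi => rc (Num.sqrt (weight s xi + omega)) * F xi
                            - z * sqrt_symbol omega xi)) =
  dirichlet s f + omega * mass f - 2 * Re (conjc z * f 0)
  + cabs z ^+ 2 * resolvent_mass (n := n) s omega.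
Proof.
move=> o0 Hf fF; have [G2 GE] := form_fourier o0 Hf fF.
have [V2 VE] := sqrt_symbol_L2 o0.
have zV2 := cL2N (cL2Z z V2).
rewrite (fine_sqintD G2 zV2) GE.
have -> : fine (sqint mu (fun xi => - (z * sqrt_symbol omega xi))) =
    cabs z ^+ 2 * resolvent_mass (n := n) s omega.
  rewrite -VE -(fine_sqintZ z V2); congr fine; apply: eq_sqint => xi.
  by rewrite cabsN.
have -> : cintegral mu setT (fun xi => rc (Num.sqrt (weight s xi + omega)) * F xi
     * conjc (- (z * sqrt_symbol omega xi))) = - (conjc z * f 0).
  rewrite (Hs_value0 Hf fF) -cintegralZ; last exact: Hs_fourier_L1 fF.
  rewrite -cintegralN; last exact/cintegrableZ/(Hs_fourier_L1 Hf fF).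
  apply: eq_cintegral => xi.
  have -> : conjc (- (z * sqrt_symbol omega xi)) = - (conjc z * sqrt_symbol omega xi).
    by apply: complex_ext; rewrite /sqrt_symbol !ReImE/=; ring.
  rewrite /sqrt_symbol mulrN; congr (- _).
  have := wsqrtK xi o0 => /(congr1 rc); rewrite rmorphM/= => h.
  transitivity (conjc z * F xi * (rc (Num.sqrt (weight s xi + omega)) *
     rc (Num.sqrt (symbol s omega xi)))); first by ring.
  by rewrite h mulr1.
by rewrite ReN; ring.
Qed.

Lemma form_square_ge0 omega f z : 0 < omega -> Hs s f ->
  0 <= dirichlet s f + omega * mass f - 2 * Re (conjc z * f 0)
       + cabs z ^+ 2 * resolvent_mass (n := n) s omega.
Proof.
move=> o0 Hf; have [F fF] := Hs_fourier Hf.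
by rewrite -(form_square z o0 Hf fF); exact/fine_ge0/sqint_ge0.
Qed.

(** The square is completed at the multiple of the symbol that best approximates
[f], that is at [z = f(0)] divided by the resolvent mass. *)
Lemma trace_le omega f : 0 < omega -> Hs s f ->
  cabs (f 0) ^+ 2 <=
  resolvent_mass (n := n) s omega * (dirichlet s f + omega * mass f).
Proof.
move=> o0 Hf; have c0 := resolvent_mass_gt0 (n := n) o0 ns.
set c := resolvent_mass _ _ in c0 *.
have := form_square_ge0 (rc c^-1 * f 0) o0 Hf; rewrite -/c.
have -> : conjc (rc c^-1 * f 0) * f 0 = rc (c^-1 * cabs (f 0) ^+ 2).
  by rewrite conjM conj_real rmorphM/= -mulcJ_real; ring.
rewrite cabsM cabs_real (ger0_norm (ltW _)) ?invr_gt0//=.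
rewrite exprMn => h; rewrite mulrC -ler_pdivrMr// -subr_ge0.
apply: le_trans h _; rewrite le_eqVlt; apply/orP; left; apply/eqP.
by field; rewrite gt_eqF.
Qed.

End trace.

(** * Stability of the orbit of the wave *)

Section standing_wave.
Context {R : realType} {n : nat}.
Local Notation Rn := 'rV[R]_n.
Local Notation mu := (lebesgue_row R n).
Variables (omega s sigma : R) (phi : Rn -> R[i]).
Hypotheses (n1 : (1 <= n)%N) (o0 : 0 < omega) (ns : n%:R / 2 < s).
Hypotheses (sigma0 : 0 < sigma) (sigma1 : sigma < 2 * s / n%:R - 1).
Hypotheses (Hphi : Hs s phi).
Hypothesis phiF : is_fourier phi (standing_wave_hat s omega sigma).
Implicit Types (f g F G : Rn -> R[i]) (z : R[i]).

Local Opaque expi cintegral.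

(* [C] is the amplitude of the wave, [K] its value of the form, and [th] the exponent
   of interpolation of the value at the origin between mass and Dirichlet form. *)
Let c : R := resolvent_mass (n := n) s omega.
Let C : R := c `^ (- (1 + (2 * sigma)^-1)).
Let K : R := C ^+ 2 * c.
Let th : R := n%:R / (2 * s).

Let c0 : 0 < c. Proof. exact: resolvent_mass_gt0. Qed.
Let C0 : 0 < C. Proof. exact: powR_gt0. Qed.
Let K0 : 0 < K. Proof. by rewrite mulr_gt0 ?exprn_gt0. Qed.
Let n0 : 0 < n%:R :> R. Proof. by rewrite ltr0n. Qed.
Let s0 : 0 < s. Proof. by apply: le_lt_trans ns; rewrite divr_ge0. Qed.
Let th0 : 0 < th. Proof. by rewrite divr_gt0// mulr_gt0. Qed.
Let th1 : th < 1.
Proof. by rewrite ltr_pdivrMr ?mulr_gt0// mul1r mulrC -ltr_pdivrMr. Qed.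
(* Subcriticality of the nonlinearity. *)
Let thsigma : th * (sigma + 1) < 1.
Proof.
have : sigma + 1 < 2 * s / n%:R by rewrite -ltrBrDr.
rewrite -(ltr_pM2l th0) => /lt_le_trans; apply; rewrite le_eqVlt; apply/orP; left.
by apply/eqP; rewrite /th; field; rewrite !gt_eqF.
Qed.

Lemma standing_wave_hatE (xi : Rn) :
  standing_wave_hat s omega sigma xi = rc (C * symbol s omega xi).
Proof. by []. Qed.

Lemma standing_wave_at0 : phi 0 = rc (C * c).
Proof.
rewrite (Hs_value0 ns Hphi phiF).
rewrite (eq_cintegral mu standing_wave_hatE) cintegral_real RintegralZl//.
exact: integrable_symbol.
Qed.

(** The exponent in the amplitude of the wave is the one for which the nonlinear
potential produces the multiple [C] of the delta function. *)
Lemma standing_wave_power : (C * c) `^ (2 * sigma) = c^-1.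
Proof.
have -> : C * c = c `^ (- (2 * sigma)^-1).
  rewrite /C -[X in _ * X](powRr1 (ltW c0)) -powRD ?(gt_eqF c0) ?implybT//.
  by congr (_ `^ _); ring.
rewrite -powRrM -(powR_inv1 (ltW c0)); congr (_ `^ _).
by field; rewrite gt_eqF.
Qed.

(** Hence the potential energy of the wave is a multiple of [K]. *)
Lemma standing_wave_power2 : (C * c) `^ (2 * sigma + 2) = K.
Proof.
have Cc0 : 0 < C * c by rewrite mulr_gt0.
rewrite powRD ?(gt_eqF Cc0) ?implybT// standing_wave_power.
rewrite powR_mulrn ?(ltW Cc0)// /K.
by field; rewrite gt_eqF.
Qed.

(** The transform of the wave is a multiple of the symbol, so the form of the
difference is a completed square: its cross term sees [f] only at the origin. *)
Lemma form_orbit f z : Hs s f -> cabs z = 1 ->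
  dirichlet s (fun x => f x + - z * phi x) +
    omega * mass (fun x => f x + - z * phi x) =
  dirichlet s f + omega * mass f - 2 * C * Re (conjc z * f 0) + K.
Proof.
move=> Hf z1; have [F fF] := Hs_fourier Hf.
have Hd := Hs_lin (- z) Hf Hphi; have dF := is_fourier_lin (- z) fF phiF.
have [_ e] := form_fourier o0 Hd dF; apply: (etrans (esym e)) => {e}.
have := form_square ns (z * rc C) o0 Hf fF.
have -> : fine (sqint mu (fun xi => rc (Num.sqrt (weight s xi + omega)) * F xi
             - z * rc C * sqrt_symbol s omega xi)) =
   fine (sqint mu (fun xi => rc (Num.sqrt (weight s xi + omega)) *
             (F xi + - z * standing_wave_hat s omega sigma xi))).
  congr fine; apply: eq_sqint => xi; congr (cabs _).
  rewrite mulrDr; congr (_ + _); rewrite standing_wave_hatE /sqrt_symbol.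
  have := wsqrtK s xi o0; have := sqr_sqrtr (ltW (symbol_gt0 s xi o0)).
  move: (symbol s omega xi) (Num.sqrt (symbol s omega xi)).
  move: (Num.sqrt (weight s xi + omega)) => b y a <- ba.
  rewrite (_ : C * _ = C * (a * a)); last by rewrite expr2.
  transitivity (- z * rc (C * a * (b * a))); last by rewrite !rmorphM/=; ring.
  by rewrite ba mulr1 rmorphM/=; ring.
move=> ->; rewrite cabsM z1 mul1r cabs_real (ger0_norm (ltW C0)) -/c -/K.
rewrite (_ : conjc (z * rc C) * f 0 = rc C * (conjc z * f 0)); last first.
  by rewrite conjM conj_real; ring.
by rewrite (_ : Re (rc C * _) = C * Re (conjc z * f 0)); [ring|rewrite ReM/=; ring].
Qed.

Lemma phase_align z : exists2 l : R[i], cabs l = 1 & Re (conjc l * z) = cabs z.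
Proof.
have [z0|z0] := eqVneq (cabs z) 0.
  exists 1; first exact: cabs1.
  by rewrite (cabs_eq0 z0) mulr0 cabs0.
exists (rc (cabs z)^-1 * z).
  by rewrite cabsM cabs_real ger0_norm ?invr_ge0 ?cabs_ge0// mulVf.
rewrite (_ : conjc _ * z = rc (cabs z)); first by [].
rewrite conjM conj_real -mulrA [conjc z * z]mulrC mulcJ_real -rmorphM/=.
by rewrite expr2 mulKf.
Qed.

Let p0 : R := C * c.
Let p00 : 0 < p0. Proof. by rewrite mulr_gt0. Qed.

(** The trace inequality at frequency [tau * omega], in units of the wave; at
[tau = 1] the wave attains equality. *)
Lemma trace_scaled f tau : 0 < tau -> Hs s f ->
  K * (cabs (f 0) / p0) ^+ 2 * tau `^ (1 - th) <=
  dirichlet s f + tau * (omega * mass f).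
Proof.
move=> t0 Hf; have to0 : 0 < tau * omega by rewrite mulr_gt0.
have := trace_le ns to0 Hf; rewrite (resolvent_mass_scale o0 t0 ns) -/c -/th.
rewrite [tau * (_ * _)]mulrA; set N := dirichlet s f + _ => h.
have tE : tau `^ (1 - th) * tau `^ (th - 1) = 1.
  rewrite -powRD ?(gt_eqF t0) ?implybT// (_ : _ + _ = 0) ?powRr0//; ring.
have tp := powR_gt0 (1 - th) t0.
have -> : K * (cabs (f 0) / p0) ^+ 2 = c^-1 * cabs (f 0) ^+ 2.
  by rewrite /K /p0; field; rewrite !gt_eqF.
rewrite -(ler_pM2l (_ : 0 < c^-1 * tau `^ (1 - th))) in h; last first.
  by rewrite mulr_gt0 ?invr_gt0.
rewrite mulrAC; apply: le_trans h _; rewrite le_eqVlt; apply/orP; left; apply/eqP.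
transitivity (tau `^ (1 - th) * tau `^ (th - 1) * (c^-1 * c) * N); first by ring.
by rewrite tE mulVf ?gt_eqF// !mul1r.
Qed.

Lemma standing_wave_form : dirichlet s phi + omega * mass phi = K.
Proof.
have [_ e] := form_fourier o0 Hphi phiF; apply: (etrans (esym e)) => {e}.
have [V2 VE] := sqrt_symbol_L2 ns o0.
rewrite -/c in VE; rewrite /K -VE.
rewrite -[X in X ^+ 2](ger0_norm (ltW C0)) -cabs_real -(fine_sqintZ _ V2).
congr fine; apply: eq_sqint => xi; congr (cabs _).
rewrite standing_wave_hatE /sqrt_symbol -!rmorphM/=; congr (rc _).
have := wsqrtK s xi o0; have := sqr_sqrtr (ltW (symbol_gt0 s xi o0)).
move: (symbol s omega xi) (Num.sqrt (symbol s omega xi)).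
move: (Num.sqrt (weight s xi + omega)) => b y a <- ba.
by rewrite mulrCA expr2 [b * _]mulrA ba mul1r.
Qed.

(** Equality at [tau = 1] for the wave determines its mass: a Pohozaev identity. *)
Lemma standing_wave_mass : omega * mass phi = (1 - th) * K.
Proof.
apply: (@tangent_identity _ (1 - th) (dirichlet s phi)) => //.
- by rewrite subr_gt0.
- by rewrite gtrBl.
- by rewrite standing_wave_form.
- move=> tau t0; have := trace_scaled t0 Hphi.
  rewrite standing_wave_at0 cabs_real ger0_norm ?(ltW p00)// -/p0 divff ?gt_eqF//.
  by rewrite expr1n mulr1.
Qed.

Lemma standing_wave_dirichlet : dirichlet s phi = th * K.
Proof. by have := standing_wave_form; rewrite standing_wave_mass => h; lra. Qed.

(** The phase is chosen to align the values at the origin; what remains is a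
statement about the three numbers A, M and |f(0)|. *)
Lemma near_orbit eps : 0 < eps -> exists2 eta : R, 0 < eta & forall f, Hs s f ->
  `|2 * (energy s sigma f - energy s sigma phi)| <= eta ->
  `|omega * (mass f - mass phi)| <= eta ->
  exists2 l : R[i], cabs l = 1 & (Hsnorm s (fun x => f x + - l * phi x)%R <= eps%:E)%E.
Proof.
move=> e0; (* A bound [e'] on the form bounds each of the two norms by [eps / 2]. *)
pose e' := Num.min ((eps / 2) ^+ 2) (omega * (eps / 2) ^+ 2).
have e2 : 0 < eps / 2 by rewrite divr_gt0.
have e'0 : 0 < e' by rewrite lt_min ?mulr_gt0 ?exprn_gt0.
have [eta eta0 H] := scalar_stability th0 sigma0 thsigma K0 e'0.
exists eta => // f Hf d1 d2; have [l l1 lf] := phase_align (f 0).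
exists l => //; have Hd := Hs_lin (- l) Hf Hphi.
rewrite (HsnormE Hd) lee_fin.
have := form_orbit Hf l1; rewrite lf.
set A := dirichlet s _; set B := mass _ => AB.
have s10 : 0 < sigma + 1 by rewrite addr_gt0.
pose p := cabs (f 0) / p0.
have pE : cabs (f 0) `^ (2 * sigma + 2) = K * p `^ (2 * sigma + 2).
  rewrite -standing_wave_power2 -/p0 -powRM ?(ltW p00)//; last first.
    by rewrite divr_ge0 ?cabs_ge0// ltW.
  by rewrite /p mulrCA divff ?gt_eqF// mulr1.
have fin : dirichlet s f + omega * mass f - 2 * K * p + K <= e'.
  apply: (H _ _ _ _ p _ _ _ _ d1 d2).
  - exact: dirichlet_ge0.
  - by rewrite divr_ge0 ?cabs_ge0// ltW.
  - rewrite !energyE// pE standing_wave_dirichlet standing_wave_at0 cabs_real.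
    rewrite (ger0_norm (ltW p00)) -/p0 standing_wave_power2.
    by field; rewrite gt_eqF//; lra.
  - by rewrite mulrBr standing_wave_mass; ring.
  - by move=> tau t0; rewrite -/p; exact: trace_scaled.
have {}AB : A + omega * B <= e'.
  rewrite AB; apply: le_trans fin; rewrite lerD2r lerD2l lerN2 le_eqVlt.
  by apply/orP; left; apply/eqP; rewrite /p /p0 /K; field; rewrite !gt_eqF.
have A0 : 0 <= A by exact: dirichlet_ge0.
have B0 : 0 <= B by exact: mass_ge0.
have oB0 : 0 <= omega * B by rewrite mulr_ge0// ltW.
move: AB; rewrite le_min => /andP[AB1 AB2].
rewrite [leRHS](_ : _ = eps / 2 + eps / 2); last by field.
apply: lerD.
  rewrite -[leRHS]ger0_norm ?(ltW e2)// -sqrtr_sqr ler_sqrt ?exprn_ge0 ?(ltW e2)//.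
  by apply: le_trans AB1; rewrite lerDl.
rewrite -[leRHS]ger0_norm ?(ltW e2)// -sqrtr_sqr ler_sqrt ?exprn_ge0 ?(ltW e2)//.
by rewrite -(ler_pM2l o0); apply: le_trans AB2; rewrite lerDr.
Qed.

End standing_wave.

Section continuity.
Context {R : realType} {n : nat}.
Local Notation Rn := 'rV[R]_n.
Local Notation mu := (lebesgue_row R n).
Variable s : R.
Hypothesis ns : n%:R / 2 < s.
Implicit Types (f g : Rn -> R[i]) (c : R[i]).

Local Opaque expi cintegral dirichlet mass.

Let fin_triangle (x y z : \bar R) (a b k d : R) : x = a%:E -> y = b%:E -> z = d%:E ->
  (x <= y + k%:E * z)%E -> a <= b + k * d.
Proof. by move=> -> -> ->; rewrite -EFinM -EFinD lee_fin. Qed.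

Let dist_triangle (a b d k : R) : k = 1 -> a <= b + k * d -> b <= a + k * d ->
  `|a - b| <= d.
Proof.
by move=> -> h1 h2; rewrite ler_norml; apply/andP; split; lra.
Qed.

Let subK f g : (fun x => g x + 1 * (f x - g x)) = f.
Proof. by apply/funext => x; ring. Qed.

Let subKN f g : (fun x => f x + (- 1) * (f x - g x)) = g.
Proof. by apply/funext => x; ring. Qed.

Lemma L2n_mass s' f : Hs s' f -> L2n mu f = (Num.sqrt (mass f))%:E.
Proof. by move=> Hf; rewrite massE; exact: L2n_fine (Hs_cL2 Hf). Qed.

Lemma L2n_dirichlet f : Hs s f ->
  L2n mu (fraclap (s / 2) f) = (Num.sqrt (dirichlet s f))%:E.
Proof. by move=> Hf; exact: L2n_fine (Hs_fraclap_cL2 Hf). Qed.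

Lemma sqrt_mass_lin f g c : Hs s f -> Hs s g ->
  Num.sqrt (mass (fun x => f x + c * g x)) <=
  Num.sqrt (mass f) + cabs c * Num.sqrt (mass g).
Proof.
move=> Hf Hg; have [mf _] := Hs_cL2 Hf; have [mg _] := Hs_cL2 Hg.
have h := L2nD mu mf (cmeasurableM (cmeasurable_cst c) mg).
rewrite (L2nZ mu c mg) in h.
exact: fin_triangle (L2n_mass (Hs_lin c Hf Hg)) (L2n_mass Hf) (L2n_mass Hg) h.
Qed.

Lemma sqrt_dirichlet_lin f g c : Hs s f -> Hs s g ->
  Num.sqrt (dirichlet s (fun x => f x + c * g x)) <=
  Num.sqrt (dirichlet s f) + cabs c * Num.sqrt (dirichlet s g).
Proof.
move=> Hf Hg; have h := L2n_fraclap_lin_le c Hf Hg.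
exact: fin_triangle (L2n_dirichlet (Hs_lin c Hf Hg)) (L2n_dirichlet Hf)
  (L2n_dirichlet Hg) h.
Qed.

Lemma sqrt_dirichlet_dist f g : Hs s f -> Hs s g ->
  `|Num.sqrt (dirichlet s f) - Num.sqrt (dirichlet s g)| <=
  Num.sqrt (dirichlet s (fun x => f x - g x)).
Proof.
move=> Hf Hg; have Hd := HsB Hf Hg.
have h1 := sqrt_dirichlet_lin 1 Hg Hd; have h2 := sqrt_dirichlet_lin (-1) Hf Hd.
rewrite subK in h1; rewrite subKN cabsN in h2.
exact: dist_triangle (@cabs1 R) h1 h2.
Qed.

Lemma sqrt_mass_dist f g : Hs s f -> Hs s g ->
  `|Num.sqrt (mass f) - Num.sqrt (mass g)| <= Num.sqrt (mass (fun x => f x - g x)).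
Proof.
move=> Hf Hg; have Hd := HsB Hf Hg.
have h1 := sqrt_mass_lin 1 Hg Hd; have h2 := sqrt_mass_lin (-1) Hf Hd.
rewrite subK in h1; rewrite subKN cabsN in h2.
exact: dist_triangle (@cabs1 R) h1 h2.
Qed.

(** The Sobolev embedding at the origin. *)
Lemma value0_le f : Hs s f ->
  ((cabs (f 0))%:E <= (Num.sqrt (resolvent_mass (n := n) s 1))%:E * Hsnorm s f)%E.
Proof.
move=> Hf; rewrite (HsnormE Hf) -EFinM lee_fin.
have c0 := resolvent_mass_gt0 (n := n) ltr01 ns.
have := trace_le ns ltr01 Hf; rewrite mul1r.
set a := Num.sqrt (dirichlet s f); set b := Num.sqrt (mass f).
have a0 : 0 <= a by exact: sqrtr_ge0.
have b0 : 0 <= b by exact: sqrtr_ge0.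
have -> : dirichlet s f = a ^+ 2 by rewrite sqr_sqrtr ?dirichlet_ge0.
have -> : mass f = b ^+ 2 by rewrite sqr_sqrtr ?mass_ge0.
move=> h; rewrite -(ler_pXn2r (_ : 0 < 2)%N) ?nnegrE ?cabs_ge0 ?mulr_ge0 ?addr_ge0 ?sqrtr_ge0//.
rewrite exprMn sqr_sqrtr ?(ltW c0)//; apply: le_trans h _; rewrite ler_pM2l//.
by rewrite sqrrD lerD2r lerDl mulrn_wge0// mulr_ge0.
Qed.

Lemma sqrt_dist_le (x y r : R) : 0 <= x -> 0 <= y ->
  `|Num.sqrt x - Num.sqrt y| <= r -> r <= 1 -> `|x - y| <= r * (1 + 2 * Num.sqrt y).
Proof.
move=> x0 y0 h r1; have ex := sqr_sqrtr x0; have ey := sqr_sqrtr y0.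
have := sqrtr_ge0 y; move: ex ey h.
move: (Num.sqrt x) (Num.sqrt y) => a b <- <- ab b0.
rewrite subr_sqr normrM ler_pM ?normr_ge0//.
have -> : a + b = (a - b) + 2 * b by ring.
apply: le_trans (ler_normD _ _) _; rewrite lerD//; first exact: le_trans ab r1.
by rewrite ger0_norm// mulr_ge0.
Qed.

Lemma powR_near (q p0 e : R) : 0 < p0 -> 0 < e -> exists2 d : R, 0 < d &
  forall p, `|p - p0| <= d -> `|p `^ q - p0 `^ q| <= e.
Proof.
move=> p00 e0; have hd := @is_derive1_powR R q p0 p00.
have hc : {for p0, continuous (fun x : R => x `^ q)}.
  by apply: differentiable_continuous; apply/derivable1_diffP; exact: ex_derive.
have /cvgr_dist_le/(_ _ e0) := hc.
rewrite near_nbhs => /nbhs_ballP[d /= d0 H].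
exists (d / 2); first by rewrite divr_gt0.
move=> p pd; rewrite distrC; apply: H; rewrite /ball/= distrC.
by apply: le_lt_trans pd _; rewrite ltr_pdivrMr// ltr_pMr// ltr1n.
Qed.

(** Mass and energy are continuous at the wave in the H^s norm; the potential energy
by the embedding at the origin. *)
Lemma conserved_near sigma (k : R) phi e : 0 < sigma -> 0 < k -> 0 < cabs (phi 0) ->
  Hs s phi -> 0 < e ->
  exists2 d : R, 0 < d & forall g, Hs s g ->
    (Hsnorm s (fun x => g x - phi x)%R < d%:E)%E ->
    `|2 * (energy s sigma g - energy s sigma phi)| <= e /\
    `|k * (mass g - mass phi)| <= e.
Proof.
move=> sigma0 k0 p0 Hp e0; pose q := 2 * sigma + 2.
have [d1 d10 H1] := powR_near q p0 (divr_gt0 e0 (@ltr0Sn R 1)).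
pose A := Num.sqrt (dirichlet s phi); pose B := Num.sqrt (mass phi).
have A0 : 0 <= A by exact: sqrtr_ge0.
have B0 : 0 <= B by exact: sqrtr_ge0.
pose S := Num.sqrt (resolvent_mass (n := n) s 1) + 1.
have S0 : 0 < S by rewrite ltr_wpDl ?sqrtr_ge0.
pose d := Num.min (Num.min 1 (d1 / S))
  (Num.min (e / 2 / (1 + 2 * A)) (e / k / (1 + 2 * B))).
have A1 : 0 < 1 + 2 * A by rewrite ltr_pwDl// mulr_ge0.
have B1 : 0 < 1 + 2 * B by rewrite ltr_pwDl// mulr_ge0.
exists d; first by rewrite !lt_min ltr01 !divr_gt0.
move=> g Hg gd; have Hd := HsB Hg Hp.
have [a [b [a0 b0 hA hB [h0 ab]]]] : exists a b : R, [/\ 0 <= a, 0 <= b,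
    `|Num.sqrt (dirichlet s g) - A| <= a, `|Num.sqrt (mass g) - B| <= b &
    cabs (g 0 - phi 0) <= Num.sqrt (resolvent_mass (n := n) s 1) * (a + b) /\
    a + b < d].
  exists (Num.sqrt (dirichlet s (fun x => g x - phi x))).
  exists (Num.sqrt (mass (fun x => g x - phi x))).
  have h := value0_le Hd; have e1 := HsnormE Hd.
  split; [exact: sqrtr_ge0|exact: sqrtr_ge0| | |].
  - exact: sqrt_dirichlet_dist Hg Hp.
  - exact: sqrt_mass_dist Hg Hp.
  - split; first by rewrite e1 -EFinM lee_fin in h.
    by rewrite e1 lte_fin in gd.
move: ab; rewrite !lt_min => /andP[/andP[hd1 hd2] /andP[hd3 hd4]].
have a1 : a <= 1 by apply: le_trans (ltW hd1); rewrite lerDl.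
have b1 : b <= 1 by apply: le_trans (ltW hd1); rewrite lerDr.
have hA2 := sqrt_dist_le (dirichlet_ge0 s g) (dirichlet_ge0 s phi) hA a1.
have hB2 := sqrt_dist_le (mass_ge0 g) (mass_ge0 phi) hB b1.
have {}hA2 : `|dirichlet s g - dirichlet s phi| <= e / 2.
  by apply: (le_trans hA2); rewrite -ler_pdivlMr// ltW// (le_lt_trans _ hd3)// lerDl.
have {}hB2 : `|mass g - mass phi| <= e / k.
  by apply: (le_trans hB2); rewrite -ler_pdivlMr// ltW// (le_lt_trans _ hd4)// lerDr.
have hp : `|cabs (g 0) `^ q - cabs (phi 0) `^ q| <= e / 2.
  apply: H1; apply: le_trans (cabs_dist _ _) _; apply: (le_trans h0).
  apply: (@le_trans _ _ (S * (a + b))).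
    by rewrite ler_wpM2r ?addr_ge0// lerDl.
  by rewrite mulrC -ler_pdivlMr// ltW.
split; last first.
  by rewrite normrM (ger0_norm (ltW k0)) mulrC -ler_pdivlMr.
rewrite !energyE// -/q.
have q1 : 1 < q / 2 by rewrite /q ltr_pdivlMr// mul1r ltrDr mulr_gt0.
have q0 : 0 < q / 2 by exact: lt_trans q1.
move: hA2 hp; move: (dirichlet s g) (dirichlet s phi).
move: (cabs (g 0) `^ q) (cabs (phi 0) `^ q) => u v x y hA2 hp.
have -> : 2 * (2^-1 * x - q^-1 * u - (2^-1 * y - q^-1 * v)) =
    (x - y) - (q / 2)^-1 * (u - v).
  have q00 : q != 0 by rewrite gt_eqF// addr_gt0// mulr_gt0.
  by field.
apply: le_trans (ler_normB _ _) _; rewrite [leRHS](_ : _ = e / 2 + e / 2); last by field.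
apply: lerD => //; rewrite normrM; apply: le_trans hp.
by rewrite ler_piMl// ger0_norm ?invr_ge0 ?(ltW q0)// invf_le1// ltW.
Qed.

End continuity.

Section orbital.
Context {R : realType} {n : nat}.
Local Notation Rn := 'rV[R]_n.
Variables (omega s sigma : R) (phi : Rn -> R[i]).
Hypotheses (n1 : (1 <= n)%N) (o0 : 0 < omega) (ns : n%:R / 2 < s).
Hypotheses (sigma0 : 0 < sigma) (sigma1 : sigma < 2 * s / n%:R - 1).
Hypotheses (Hphi : Hs s phi).
Hypothesis phiF : is_fourier phi (standing_wave_hat s omega sigma).

Local Opaque expi cintegral dirichlet mass.

(** Mass and energy of the solution stay at their initial values, hence close to
those of the wave, and this alone puts it near the orbit at each time. *)
Lemma conserved_orbital_stability (u : (Rn -> R[i]) -> R -> Rn -> R[i]) :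
  (exists2 delta0 : R, 0 < delta0 &
    forall g, Hs s g -> (Hsnorm s (fun x => g x - phi x)%R < delta0%:E)%E ->
      global_solution s sigma g (u g) /\
      forall t, 0 < t ->
        mass (u g t) = mass g /\ energy s sigma (u g t) = energy s sigma g) ->
  forall eps : R, 0 < eps -> exists2 delta : R, 0 < delta &
    forall g, Hs s g -> (Hsnorm s (fun x => g x - phi x)%R < delta%:E)%E ->
      [/\ global_solution s sigma g (u g),
          forall t, 0 < t -> Hs s (u g t)
        & (ereal_sup
             [set ereal_inf
                [set Hsnorm s
                   (fun x => u g t x - expi (- (omega * t + theta)) * phi x)%R
                   | theta in [set: R]]
                | t in [set t : R | (0 < t)%R]] < eps%:E)%E].
Proof.
move=> [d0 d00 sol] eps e0; have e20 : 0 < eps / 2 by rewrite divr_gt0.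
have [eta eta0 H] := near_orbit n1 o0 ns sigma0 sigma1 Hphi phiF e20.
have p0 : 0 < cabs (phi 0).
  rewrite (standing_wave_at0 o0 ns Hphi phiF) cabs_real normr_gt0 gt_eqF//.
  by rewrite mulr_gt0 ?powR_gt0// resolvent_mass_gt0.
have [d1 d10 H1] := conserved_near ns sigma0 o0 p0 Hphi eta0.
exists (Num.min d0 d1); first by rewrite lt_min d00.
move=> g Hg; rewrite EFin_min lt_min => /andP[gd0 gd1].
have [gs cons] := sol _ Hg gd0.
have Hu t : 0 < t -> Hs s (u g t) by move=> t0; apply: gs.1.1; exact: ltW.
split=> //; apply: (@le_lt_trans _ _ (eps / 2)%:E); last first.
  by rewrite lte_fin ltr_pdivrMr// ltr_pMr// ltr1n.
apply: ge_ereal_sup => _ [t t0 <-].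
have [cm ce] := cons _ t0; have [he hm] := H1 _ Hg gd1.
have [||l l1 hl] := H _ (Hu _ t0); [by rewrite ce|by rewrite cm|].
have [th thl] := expi_surj l1.
apply: le_trans hl; apply: ereal_inf_lbound; exists (- th - omega * t) => //.
congr Hsnorm; apply/funext => x.
by rewrite (_ : - (omega * t + _) = th) ?thl ?mulNr//; ring.
Qed.

End orbital.

(** * Continuous functions and Borel sets *)

Section continuous_measurable.
Context {R : realType}.

(** Rounding the coordinates down to a grid gives a measurable map with countably
many values, and continuity lets the grid be refined. *)
Lemma measurable_continuous_row n (f : 'rV[R]_n -> R) : continuous f ->
  measurable_fun setT f.
Proof.
move=> cf; pose grid (k : nat) (z : {ffun 'I_n -> int}) : 'rV[R]_n :=
  \row_i ((z i)%:~R / k.+1%:R).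
pose cell (k : nat) (x : 'rV[R]_n) := [ffun i => Num.floor (x 0 i * k.+1%:R)].
have mcell k z : measurable [set x | cell k x = z].
  rewrite (_ : [set x | _] = \bigcap_(i in [set: 'I_n])
     ((fun x : 'rV[R]_n => x 0 i * k.+1%:R) @^-1` `[(z i)%:~R, (z i + 1)%:~R[)).
    apply: fin_bigcap_measurable => // i _; rewrite -[X in measurable X]setTI.
    by apply: measurable_funM => //; exact: measurable_coord.
  apply/seteqP; split=> x /=.
    move=> xz i _ /=; rewrite in_itv/= -xz ffunE.
    exact/real_floor_itv/num_real.
  by move=> xz; apply/ffunP => i; rewrite ffunE; apply: floor_def; have := xz i I; rewrite /= in_itv.
apply: (@measurable_fun_cvg _ _ _ _ (fun k => f \o grid k \o cell k)).
  move=> k _ B mB; rewrite setTI.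
  rewrite (_ : _ @^-1` B = \bigcup_m [set x | unpickle m = Some (cell k x) /\
                                       B (f (grid k (cell k x)))]).
    apply: bigcup_measurable => m _; case zE : (unpickle m) => [z|]; last first.
      by rewrite (_ : [set x | _] = set0)// -subset0 => x [].
    have [Bz|nBz] := pselect (B (f (grid k z))).
      rewrite (_ : [set x | _] = [set x | cell k x = z]) ?mcell//.
      by apply/seteqP; split=> x /=; [move=> [[->]]|move=> ->].
    rewrite (_ : [set x | _] = set0)// -subset0 => x /= [[<-]]; exact: nBz.
  apply/seteqP; split=> x /=; last by move=> [m _ []].
  by move=> Bx; exists (pickle (cell k x)) => //=; rewrite pickleK.
move=> x _; have : f (y) @[y --> x] --> f x by exact: cf.
apply: (cvg_comp (fun k => grid k (cell k x)) f).
apply/cvg_ballP => e e0.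
near=> k; split => // i j; rewrite ord1 mxE -ball_normE/=.
have k0 : 0 < k.+1%:R :> R by rewrite ltr0n.
rewrite ffunE; have /real_floor_itv/andP[h1 h2] := num_real (x 0 j * k.+1%:R).
rewrite -[X in X - _](mulfK (lt0r_neq0 k0)) -mulrBl normrM (gtr0_norm (_ : 0 < _^-1)) ?invr_gt0//.
apply: (@le_lt_trans _ _ k.+1%:R^-1); last by near: k; exact: (near_infty_natSinv_lt (PosNum e0)).
rewrite ler_piMl ?invr_ge0 ?ler0n// ger0_norm ?subr_ge0//.
by rewrite lerBlDl ltW//; move: h2; rewrite intrD.
Unshelve. all: by end_near. Qed.

Lemma measurable_continuous_prod n (f : R * 'rV[R]_n -> R) : continuous f ->
  measurable_fun [set: measurableTypeR R * 'rV[R]_n] f.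
Proof.
move=> cf; have -> : f = (f \o @row_uncons R n) \o @row_cons R n.
  by apply/funext => p /=; rewrite row_consK.
apply: measurableT_comp; last exact: measurable_row_cons.
apply: measurable_continuous_row => x.
apply: (continuous_comp (f := @row_uncons R n)); last exact: cf.
have coord (i : 'I_n.+1) : (fun y : 'rV[R]_n.+1 => y 0 i) @ x --> x 0 i.
  exact: differentiable_continuous (differentiable_coord _ _ _).
have tail : (fun y : 'rV[R]_n.+1 => \row_i y 0 (lift ord0 i) : 'rV[R]_n) =
    (rsubmx : 'M[R]_(1, 1 + n) -> 'rV[R]_n).
  apply/funext => y; apply/rowP => i; rewrite !mxE; congr (y _ _).
  exact/val_inj.
have := @continuous_rsubmx _ 1 1 n x; rewrite -tail => tx.
exact: (cvg_pair (coord ord0) tx).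
Qed.

End continuous_measurable.

(** * Smooth functions with compact support *)

Section smooth.
Context {R : realType}.
Implicit Types V W : normedModType R.

(** Smoothness is coinductive, so it can be proved by exhibiting a family closed
under directional derivatives. *)
Lemma smooth_coind V (S : (V -> R) -> Prop) :
  (forall f, S f -> [/\ continuous f, forall x v, derivable f x v &
                        forall v, S ('D_v f)]) ->
  forall f, S f -> smooth f.
Proof.
move=> H f Sf vs; have : S (foldr (fun v k => 'D_v k) f vs).
  by elim: vs => //= v vs /H[].
by move=> /H[].
Qed.

Lemma smooth_derive V (f : V -> R) v : smooth f -> smooth ('D_v f).
Proof. by move=> sf vs; have := sf (rcons vs v); rewrite foldr_rcons. Qed.

Lemma smooth_continuous V (f : V -> R) : smooth f -> continuous f.
Proof. by move=> /(_ [::])[]. Qed.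

Lemma smooth_derivable V (f : V -> R) x v : smooth f -> derivable f x v.
Proof. by move=> /(_ [::])[_]; exact. Qed.

Section affine.
Context {V W : normedModType R} (A : W -> V) (L : W -> V).
(* [L] is the linear part of [A]. *)
Hypothesis AL : forall (h : R) w x, A (h *: w + x) = h *: L w + A x.

Let growth (f : V -> R) x w :
  (fun h => h^-1 *: (((f \o A) \o shift x) (h *: w) - (f \o A) x)) =
  (fun h => h^-1 *: ((f \o shift (A x)) (h *: L w) - f (A x))).
Proof. by apply/funext => h /=; rewrite /shift/= AL. Qed.

Lemma derivable_affine (f : V -> R) x w :
  derivable f (A x) (L w) -> derivable (f \o A) x w.
Proof. by rewrite /derivable growth. Qed.

Lemma derive_affine (f : V -> R) w : 'D_w (f \o A) = 'D_(L w) f \o A.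
Proof. by apply/funext => x /=; rewrite /derive growth. Qed.

Lemma smooth_affine (f : V -> R) : continuous A -> smooth f -> smooth (f \o A).
Proof.
move=> cA sf.
apply: (@smooth_coind _ (fun g => exists2 k, smooth k & g = k \o A)); last by exists f.
move=> _ [k sk ->]; split.
- by move=> x; apply: continuous_comp; [exact: cA|exact: smooth_continuous].
- by move=> x v; apply: derivable_affine; exact: smooth_derivable.
- by move=> v; exists ('D_(L v) k); [exact: smooth_derive|exact: derive_affine].
Qed.

End affine.

(** By Leibniz' rule the sums of products of smooth functions are closed under
directional derivatives; single products are not. *)
Inductive product_span {V} : (V -> R) -> Prop :=
| product_span_mul f g : smooth f -> smooth g -> product_span (f * g)
| product_span_add f g : product_span f -> product_span g -> product_span (f + g).

Lemma product_span_stable V (f : V -> R) : product_span f ->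
  [/\ continuous f, forall x v, derivable f x v & forall v, product_span ('D_v f)].
Proof.
elim=> {f} [f g sf sg|f g _ [cf df Df] _ [cg dg Dg]].
  have df x v := @smooth_derivable _ _ x v sf; have dg x v := @smooth_derivable _ _ x v sg.
  split.
  - by move=> x; apply: cvgM; exact: smooth_continuous.
  - by move=> x v; exact: derivableM.
  - move=> v; have -> : 'D_v (f * g) = f * 'D_v g + 'D_v f * g.
      by apply/funext => x; rewrite deriveM// [g x *: _]mulrC.
    exact: product_span_add (product_span_mul sf (smooth_derive v sg))
      (product_span_mul (smooth_derive v sf) sg).
split.
- by move=> x; apply: cvgD; [exact: cf|exact: cg].
- by move=> x v; exact: derivableD.
- move=> v; have -> : 'D_v (f + g) = 'D_v f + 'D_v g.
    by apply/funext => x; rewrite deriveD.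
  exact: product_span_add.
Qed.

Lemma smoothM V (f g : V -> R) : smooth f -> smooth g -> smooth (f * g).
Proof.
move=> sf sg; apply: (smooth_coind (@product_span_stable V)).
exact: product_span_mul.
Qed.

End smooth.

Section test_functions.
Context {R : realType} {n : nat}.
Local Notation Rn := 'rV[R]_n.
Implicit Types (psi : R -> Rn -> R[i]) (f : R * Rn -> R).

Lemma continuous_pair (T U V : topologicalType) (f : T -> U) (g : T -> V) :
  continuous f -> continuous g -> continuous (fun z => (f z, g z)).
Proof. by move=> cf cg z; exact: (cvg_pair (cf z) (cg z)). Qed.

Let time_line (x : Rn) (h : R) (w t : R) :
  ((h *: w + t, x) : R * Rn) = h *: (w, 0) + (t, x).
Proof. by apply: injective_projections; rewrite /= ?scaler0 ?add0r. Qed.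

Lemma derive1_time f (t : R) (x : Rn) :
  derive1 (fun r => f (r, x)) t = 'D_(1, 0) f (t, x).
Proof.
rewrite derive1E; have h := derive_affine (L := fun r => (r, 0)) (time_line x) f 1.
exact: (congr1 (fun g => g t) h).
Qed.

Lemma smooth_time f (x : Rn) : smooth f -> smooth (fun r => f (r, x)).
Proof.
apply: (smooth_affine (L := fun r => (r, 0)) (time_line x)).
by apply: continuous_pair => r; [exact: cvg_id|exact: cvg_cst].
Qed.

Lemma smooth_shift_time f (a : R) (x0 : Rn) : smooth f ->
  smooth (fun p : R * Rn => f (a + p.1, x0)).
Proof.
apply: (smooth_affine (A := fun p : R * Rn => (a + p.1, x0)) (L := fun p => (p.1, 0))).
  move=> h w y; apply: injective_projections; rewrite /= ?scaler0 ?add0r//.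
  by rewrite addrCA.
apply: continuous_pair => p; last exact: cvg_cst.
by apply: cvgD; [exact: cvg_cst|exact: cvg_fst].
Qed.

Lemma smooth_slice f (a : R) : smooth f -> smooth (fun p : R * Rn => f (a, p.2)).
Proof.
apply: (smooth_affine (A := fun p : R * Rn => (a, p.2)) (L := fun p => (0, p.2))).
  by move=> h w y; apply: injective_projections; rewrite /= ?scaler0 ?add0r.
by apply: continuous_pair => p; [exact: cvg_cst|exact: cvg_snd].
Qed.

Lemma test_function_bounded psi : test_function psi -> exists2 L : R, 0 <= L &
  forall t x, psi t x != 0 -> `|t| <= L /\ `|x| <= L.
Proof.
move=> [_ _ /compact_bounded[M [Mr MK]]].
have [M0 M1] : 0 < `|M| + 1 /\ M < `|M| + 1.
  by split; [rewrite ltr_wpDl|rewrite (le_lt_trans (ler_norm M))// ltrDl].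
exists (`|M| + 1); first exact: ltW.
move=> t x p0; have : `|(t, x) : R * Rn| <= `|M| + 1.
  by apply: (MK _ M1); exact: subset_closure.
by rewrite prod_normE/= ge_max => /andP.
Qed.

(** The product of a function of time by a slice of [psi], both cut out of [psi]
itself so that the support stays compact. *)
Definition separated (chi : R -> R) psi (a : R) (t : R) (x : Rn) : R[i] :=
  rc (chi t) * psi a x.

Lemma test_function_separated (part : R[i] -> R) psi a x0 :
  (part = Re \/ part = Im) -> test_function psi ->
  test_function (separated (fun t => part (psi (a + t) x0)) psi a).
Proof.
move=> partE tpsi; have [L L0 H] := test_function_bounded tpsi.
have [sR sI _] := tpsi.
have schi : smooth (fun p : R * Rn => part (psi (a + p.1) x0)).
  by case: partE => ->; [exact: (smooth_shift_time a x0 sR)|exact: (smooth_shift_time a x0 sI)].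
split.
- have := smoothM schi (smooth_slice a sR); congr smooth.
  by apply/funext => p; rewrite /separated ReM/= mul0r subr0.
- have := smoothM schi (smooth_slice a sI); congr smooth.
  by apply/funext => p; rewrite /separated ImM/= mul0r addr0.
pose C := `[- a - L, - a + L]%classic `*` [set x : Rn | `|x| <= L].
have cC : compact C.
  apply: compact_setX; first exact: segment_compact.
  apply: bounded_closed_compact.
    by exists L; split; [exact: num_real|move=> M LM y /= yL; rewrite (le_trans yL)// ltW].
  rewrite (_ : [set x | _] = (fun x : Rn => `|x|) @^-1` [set y | y <= L])//.
  apply: preimage_closed; last exact: closed_le.
  by move=> y _; exact: norm_continuous.
apply: (subclosed_compact _ cC); first exact: closed_closure.
have clC : closed C by apply: compact_closed => //; exact: norm_hausdorff.
rewrite [X in _ `<=` X](closure_id C).1//; apply: closure_subset => -[t x] /=.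
rewrite /separated mulf_eq0 negb_or => /andP[chi0 psi0].
have [|tL _] := H (a + t) x0.
  apply: contraNN chi0 => /eqP ->; apply/eqP.
  by case: partE => ->.
have [_ xL] := H _ _ psi0; split => //=.
move: tL; rewrite in_itv/= ler_norml => /andP[h1 h2].
by apply/andP; split; lra.
Qed.

End test_functions.

(** * Exchanging the time integral with the pairing *)

Section time_integral.
Context {R : realType}.
Local Notation leb := (@lebesgue_measure R).
Implicit Types (f g : R -> R[i]) (t : R).

(** Time integrals over an interval are turned into integrals over the line, where
the exchange lemmas apply. *)
Definition time_window t (tau : measurableTypeR R) : R[i] := rc (\1_`[0, t] tau).

Definition tintegrable t f := cintegrable leb (fun tau => time_window t tau * f tau).

Lemma tintegralE t f :
  tintegral t f = cintegral leb setT (fun tau => time_window t tau * f tau).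
Proof.
apply: complex_ext; rewrite /tintegral/= Rintegral_mkcond; apply: eq_Rintegral => x _.
  rewrite patchE ReM/= indicE.
  by case: (x \in _); rewrite ?mul1r ?mul0r subr0.
rewrite patchE ImM/= indicE.
by case: (x \in _); rewrite ?mul1r ?mul0r addr0.
Qed.

Local Opaque expi cintegral.

Lemma eq_tintegral t f g : (forall tau, 0 <= tau <= t -> f tau = g tau) ->
  tintegral t f = tintegral t g.
Proof.
move=> fg; rewrite !tintegralE; apply: eq_cintegral => tau.
rewrite /time_window indicE; have [|_] := boolP (tau \in _); last by rewrite !mul0r.
by rewrite inE/= in_itv/= => /fg ->.
Qed.

Lemma eq_tintegrable t f g : (forall tau, 0 <= tau <= t -> f tau = g tau) ->
  tintegrable t f -> tintegrable t g.
Proof.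
move=> fg; congr (cintegrable _ _); apply/funext => tau.
rewrite /time_window indicE; have [|_] := boolP (tau \in _); last by rewrite !mul0r.
by rewrite inE/= in_itv/= => /fg ->.
Qed.

Lemma tintegralZ t z f : tintegrable t f ->
  tintegral t (fun tau => z * f tau) = z * tintegral t f.
Proof.
move=> cf; rewrite !tintegralE -cintegralZ//; apply: eq_cintegral => tau.
by rewrite mulrCA.
Qed.

Lemma tintegralB t f g : tintegrable t f -> tintegrable t g ->
  tintegral t (fun tau => f tau - g tau) = tintegral t f - tintegral t g.
Proof.
move=> cf cg; rewrite !tintegralE -cintegralB//; apply: eq_cintegral => tau.
by rewrite mulrBr.
Qed.

Lemma tintegrableZ t z f : tintegrable t f -> tintegrable t (fun tau => z * f tau).
Proof.
move=> cf; have := cintegrableZ z cf; congr (cintegrable _ _).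
by apply/funext => tau; rewrite mulrCA.
Qed.

Lemma cintegrable_time_window t : cintegrable leb (time_window t).
Proof.
have mi : measurable (`[0, t]%classic : set (measurableTypeR R)).
  exact: measurable_itv.
have fin : (leb (`[0%R, t]%classic : set (measurableTypeR R)) < +oo)%E.
  by rewrite lebesgue_measure_itv/=; case: ifP => _; rewrite ?ltry.
have ii := integrable_indic_fin mi fin.
apply: (cintegrable_le _ ii); last first.
  by move=> x; rewrite cabs_real indicE ger0_norm.
by apply: cmeasurable_real; exact: measurable_indic.
Qed.

Lemma continuous_tintegrable t f : continuous (fun tau => Re (f tau)) ->
  continuous (fun tau => Im (f tau)) -> tintegrable t f.
Proof.
move=> cR cI; have mi : measurable (`[0, t]%classic : set (measurableTypeR R)).
  exact: measurable_itv.
have H (g : R -> R) : continuous g ->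
    leb.-integrable setT (EFin \o (fun tau => \1_`[0, t] tau * g tau)).
  move=> cg; have : leb.-integrable `[0, t]%classic (EFin \o g).
    apply: continuous_compact_integrable; first exact: segment_compact.
    exact: continuous_subspaceT.
  rewrite (integrable_mkcond _ mi); congr (_.-integrable _ _).
  apply/funext => tau; rewrite /= patchE indicE.
  by case: (tau \in _); rewrite ?mul1r ?mul0r.
split.
  have := H _ cR; congr (_.-integrable _ _); apply/funext => tau /=.
  by rewrite ReM/= mul0r subr0.
have := H _ cI; congr (_.-integrable _ _); apply/funext => tau /=.
by rewrite ImM/= mul0r addr0.
Qed.

End time_integral.

Section time_pairing.
Context {R : realType} {n : nat}.
Local Notation Rn := 'rV[R]_n.
Local Notation mu := (lebesgue_row R n).
Local Notation leb := (@lebesgue_measure R).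
Implicit Types (k psi : R -> Rn -> R[i]) (phi : Rn -> R[i]) (t : R).

Local Opaque expi cintegral.

(** What a test function and its time derivative have in common. *)
Definition boxed k := [/\ continuous (fun p : R * Rn => Re (k p.1 p.2)),
  continuous (fun p : R * Rn => Im (k p.1 p.2)) &
  exists2 L : R, 0 <= L & forall t x, k t x != 0 -> `|x| <= L].

(** A continuous function is bounded on the compact product of the time interval
with a ball. *)
Lemma boxed_bound k t : boxed k -> exists L M : R, [/\ 0 <= L, 0 < M,
  forall tau x, k tau x != 0 -> box L x &
  forall tau x, 0 <= tau <= t -> cabs (k tau x) <= M].
Proof.
move=> [cR cI [L L0 kL]].
pose B := `[0, t]%classic `*` [set x : Rn | `|x| <= L].
have cB : compact B.
  apply: compact_setX; first exact: segment_compact.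
  apply: bounded_closed_compact.
    by exists L; split; [exact: num_real|move=> M LM y /= yL; rewrite (le_trans yL)// ltW].
  rewrite (_ : [set x | _] = (fun x : Rn => `|x|) @^-1` [set y | y <= L])//.
  apply: preimage_closed; last exact: closed_le.
  by move=> y _; exact: norm_continuous.
have bd (g : R * Rn -> R) : continuous g -> exists2 M : R, 0 <= M &
    forall p, B p -> `|g p| <= M.
  move=> cg; have : compact (g @` B).
    by apply: continuous_compact => //; exact: continuous_subspaceT.
  move=> /compact_bounded[M [Mr MK]]; exists (`|M| + 1); first by rewrite addr_ge0.
  move=> p Bp; apply: MK; last by exists p.
  by rewrite (le_lt_trans (ler_norm M))// ltrDl.
have [M1 M10 H1] := bd _ cR; have [M2 M20 H2] := bd _ cI.
exists L, (M1 + M2 + 1); split => //.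
- by rewrite ltr_wpDl// addr_ge0.
- move=> tau x /kL xL i; rewrite /= in_itv/= -ler_norml.
  apply: le_trans xL; rewrite [leRHS]mx_normrE.
  exact: (le_bigmax_cond _ (fun ij : 'I_1 * 'I_n => `|x ij.1 ij.2|) (j := (0, i))).
- move=> tau x t0; have [k0|k0] := eqVneq (k tau x) 0.
    by rewrite k0 cabs0 addr_ge0// addr_ge0.
  have Bp : B (tau, x) by split; [rewrite /= in_itv|exact: kL k0].
  apply: le_trans (cabs_le_ReIm _) _.
  have h1 := H1 _ Bp; have h2 := H2 _ Bp.
  by apply: (le_trans (lerD h1 h2)); rewrite lerDl.
Qed.

Lemma cmeasurable_boxed k : boxed k ->
  cmeasurable (fun p : Rn * measurableTypeR R => k p.2 p.1).
Proof.
move=> [cR cI _].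
have sw : measurable_fun setT (fun q : Rn * measurableTypeR R => (q.2, q.1)).
  by apply/measurable_fun_pair; [exact: measurable_snd|exact: measurable_fst].
apply: (cmeasurable_comp (f := fun p : measurableTypeR R * Rn => k p.1 p.2) _ sw).
by split; exact: measurable_continuous_prod.
Qed.

Lemma cmeasurable_slice k tau : boxed k -> cmeasurable (k tau).
Proof.
move=> /cmeasurable_boxed mk.
exact: (cmeasurable_comp mk (@measurable_pair2 _ _ _ (measurableTypeR R) tau)).
Qed.

End time_pairing.

Lemma cintegral0 {R : realType} d (T : measurableType d) (mu : {measure set T -> \bar R}) :
  cintegral mu setT (fun=> 0) = 0 :> R[i].
Proof. by apply: complex_ext; rewrite /cintegral/= /Rintegral integral0. Qed.

Section pairing_swap.
Context {R : realType} {n : nat}.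
Local Notation Rn := 'rV[R]_n.
Local Notation mu := (lebesgue_row R n).
Local Notation leb := (@lebesgue_measure R).
Implicit Types (k psi : R -> Rn -> R[i]) (phi : Rn -> R[i]) (t : R).

Local Opaque expi cintegral.

Lemma time_window_sqr t (tau : R) : time_window t tau * time_window t tau = time_window t tau.
Proof.
rewrite /time_window -rmorphM/= indicE.
by case: (_ \in _); rewrite ?mulr1 ?mulr0.
Qed.

(** On the time interval and the support of [k] the factors [phi] and [c] are
integrable and [k] is bounded, so the kernel exchange lemma applies. *)
Lemma pairing_swap phi k (c : measurableTypeR R -> R[i]) t : cL2 mu phi -> boxed k ->
  cmeasurable c -> (forall tau, cabs (c tau) <= 1) ->
  [/\ tintegral t (fun tau => c tau * pairing phi (k tau)) =
        pairing phi (fun x => tintegral t (fun tau => c tau * k tau x)),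
      cintegrable mu (fun x => phi x * tintegral t (fun tau => c tau * k tau x)),
      tintegrable t (fun tau => c tau * pairing phi (k tau)) &
      forall x, tintegrable t (fun tau => c tau * k tau x)].
Proof.
move=> phi2 bk mc c1; have [L [M [L0 M0 kL kM]]] := boxed_bound t bk.
(* The bound [M] is moved into the first factor, so that the kernel is at most 1. *)
pose b (x : Rn) := rc (M * \1_(box L) x).
have bb : bounded_on_box b.
  split.
    apply: cmeasurable_real; apply: measurable_funM => //.
    by apply: measurable_indic; exact: measurable_box.
  exists M, L => x; rewrite /b cabs_real ger0_norm// mulr_ge0 ?(ltW M0)//.
have [_ b2] := bounded_on_box_L12 bb.
pose f x := phi x * b x.
have cf : cintegrable mu f by exact: cintegrable_mulL2.
pose F (p : Rn * measurableTypeR R) := rc (M^-1 * \1_`[0, t] p.2) * k p.2 p.1.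
have mi : measurable (`[0, t]%classic : set (measurableTypeR R)).
  exact: measurable_itv.
have mF : cmeasurable F.
  apply: cmeasurableM; last exact: cmeasurable_boxed.
  apply: cmeasurable_real; apply: measurable_funM => //.
  apply: (measurableT_comp (f := \1_`[0, t] : measurableTypeR R -> R)) => //.
have F1 p : cabs (F p) <= 1.
  rewrite cabsM cabs_real indicE; have [|_] := boolP (_ \in _); last first.
    by rewrite mulr0 normr0 mul0r.
  rewrite inE/= in_itv/= => pt; rewrite mulr1 ger0_norm ?invr_ge0 ?(ltW M0)//.
  by rewrite mulrC ler_pdivrMr// mul1r; exact: kM.
pose kk tau := time_window t tau * c tau.
have ckk : cintegrable leb kk := cintegrableMb (cintegrable_time_window t) mc c1.
have fF x tau : f x * F (x, tau) = time_window t tau * (phi x * k tau x).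
  rewrite /f /F/= /b /time_window.
  have [->|k0] := eqVneq (k tau x) 0; first by rewrite !mulr0.
  rewrite [\1_(box L) x]indicE mem_set ?mulr1; last exact: kL k0.
  have e : rc M * rc (M^-1 * \1_`[0, t] tau) = rc (\1_`[0, t] tau).
    by rewrite -rmorphM/= mulrA divff ?mul1r// gt_eqF.
  by rewrite -[in RHS]e; ring.
have pF tau : cintegral mu setT (fun x => f x * F (x, tau)) =
    time_window t tau * pairing phi (k tau).
  rewrite (eq_cintegral mu (fF ^~ tau)).
  have [t0|t0] := eqVneq (time_window t tau) 0.
    rewrite t0 mul0r -[RHS](cintegral0 mu); apply: eq_cintegral => x.
    by rewrite mul0r.
  rewrite cintegralZ//.
  have -> : (fun x => phi x * k tau x) = (fun x => f x * F (x, tau)).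
    apply/funext => x; rewrite fF.
    by move: t0; rewrite /time_window indicE; case: (_ \in _); rewrite ?eqxx ?mul1r.
  apply: cintegrableMb cf _ _ => [|x]; last exact: F1.
  exact: (cmeasurable_comp mF (@measurable_pair2 _ _ _ _ tau)).
have kkF x tau : kk tau * F (x, tau) = rc M^-1 * (time_window t tau * (c tau * k tau x)).
  rewrite /kk /F/= rmorphM/= -/(time_window t tau).
  by rewrite -[in RHS](time_window_sqr t tau); ring.
have ikF x : cintegrable leb (fun tau => kk tau * F (x, tau)).
  apply: cintegrableMb ckk _ _ => [|tau]; last exact: F1.
  exact: (cmeasurable_comp mF (@measurable_pair1 _ _ _ _ x)).
have ick x : tintegrable t (fun tau => c tau * k tau x).
  have := cintegrableZ (rc M) (ikF x); congr (cintegrable _ _).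
  apply/funext => tau; rewrite kkF mulrA -rmorphM/= divff ?gt_eqF//.
  by rewrite rmorph1 mul1r.
have mT x : f x * cintegral leb setT (fun tau => kk tau * F (x, tau)) =
    phi x * tintegral t (fun tau => c tau * k tau x).
  transitivity (f x * (rc M^-1 * tintegral t (fun tau => c tau * k tau x))).
    by rewrite tintegralE (eq_cintegral leb (kkF x)) (cintegralZ _ (ick x)).
  rewrite /f /b; have [xb|xb] := pselect (box L x); last first.
    rewrite indicE memNset// mulr0 mulr0 mul0r.
    rewrite (_ : tintegral _ _ = 0) ?mulr0// tintegralE -[RHS](cintegral0 leb).
    apply: eq_cintegral => tau; have [->|/kL//] := eqVneq (k tau x) 0.
    by rewrite !mulr0.
  rewrite indicE mem_set// mulr1 mulrA -[_ * rc M * _]mulrA -rmorphM/=.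
  by rewrite divff ?gt_eqF// rmorph1 mulr1.
have swap := cintegral_kernel_swap cf ckk mF F1.
split.
- rewrite tintegralE; transitivity (cintegral leb setT
     (fun tau => kk tau * cintegral mu setT (fun x => f x * F (x, tau)))).
    apply: eq_cintegral => tau; rewrite pF /kk.
    by rewrite -[in LHS](time_window_sqr t tau); ring.
  by rewrite swap; apply: eq_cintegral => x; exact: mT.
- rewrite (_ : (fun x => _) = fun x => f x * cintegral leb setT (fun tau => kk tau * F (x, tau))).
    pose M' := \int[leb]_tau cabs (kk tau).
    apply: (cintegrableMb (M := M') cf) => [|x].
      apply: (@cmeasurable_partial _ _ _ Rn _ leb (fun p => kk p.2 * F p)).
      apply: cmeasurableM => //.
      exact: (cmeasurable_comp (cintegrable_meas ckk) measurable_snd).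
    apply: le_trans (cabs_cintegral_le (ikF x)) _.
    apply: le_Rintegral => //; [exact: integrable_cabs|exact: integrable_cabs|].
    by move=> tau _; rewrite cabsM ler_piMr ?cabs_ge0.
  by apply/funext => x; rewrite mT.
- rewrite /tintegrable (_ : (fun tau => _) =
      fun tau => kk tau * cintegral mu setT (fun x => f x * F (x, tau))); last first.
    apply/funext => tau; rewrite pF /kk.
    by rewrite -[in LHS](time_window_sqr t tau); ring.
  pose M' := \int[mu]_x cabs (f x).
  apply: (cintegrableMb (M := M') ckk) => [|tau].
    apply: (@cmeasurable_partial _ _ _ (measurableTypeR R) _ mu
      (fun p => f p.2 * F (p.2, p.1))).
    apply: cmeasurableM.
      exact: (cmeasurable_comp (cintegrable_meas cf) measurable_snd).
    apply: (cmeasurable_comp mF).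
    by apply/measurable_fun_pair; [exact: measurable_snd|exact: measurable_fst].
  have ifF : cintegrable mu (fun x => f x * F (x, tau)).
    apply: cintegrableMb cf _ _ => [|x]; last exact: F1.
    exact: (cmeasurable_comp mF (@measurable_pair2 _ _ _ _ tau)).
  apply: le_trans (cabs_cintegral_le ifF) _.
  apply: le_Rintegral => //; [exact: integrable_cabs|exact: integrable_cabs|].
  by move=> x _; rewrite cabsM ler_piMr ?cabs_ge0.
- exact: ick.
Qed.

Lemma cintegrable_pairing phi k tau : cL2 mu phi -> boxed k -> 0 <= tau ->
  cintegrable mu (fun x => phi x * k tau x).
Proof.
move=> phi2 bk t0; have [L [M [L0 M0 kL kM]]] := boxed_bound tau bk.
apply: cintegrable_mulL2 => //.
have [|_ //] := @bounded_on_box_L12 _ _ (k tau); split; first exact: cmeasurable_slice.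
exists M, L => x; have [->|k0] := eqVneq (k tau x) 0.
  by rewrite cabs0 indicE mulr_ge0 ?(ltW M0).
by rewrite indicE mem_set ?mulr1; [apply: kM; rewrite t0 lexx|exact: kL k0].
Qed.

End pairing_swap.

Section time_derivative.
Context {R : realType} {n : nat}.
Local Notation Rn := 'rV[R]_n.
Local Notation mu := (lebesgue_row R n).
Local Notation leb := (@lebesgue_measure R).
Implicit Types (k psi : R -> Rn -> R[i]) (phi : Rn -> R[i]) (t omega : R).

Lemma tintegral_FTC (G g : R -> R[i]) t : 0 < t ->
  (forall tau : R, is_derive tau 1 (fun r : R => Re (G r)) (Re (g tau))) ->
  (forall tau : R, is_derive tau 1 (fun r : R => Im (G r)) (Im (g tau))) ->
  continuous (fun tau => Re (g tau)) -> continuous (fun tau => Im (g tau)) ->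
  tintegral t g = G t - G 0.
Proof.
move=> t0 dR dI cR cI.
have H (F f : R -> R) : (forall tau : R, is_derive tau 1 F (f tau)) -> continuous f ->
    \int[leb]_(tau in `[0, t]) f tau = F t - F 0.
  move=> dF cf; have cF : continuous F.
    move=> x; apply: differentiable_continuous; apply/derivable1_diffP.
    by have [] := dF x.
  rewrite /Rintegral (@continuous_FTC2 _ f F)//.
  - exact: continuous_subspaceT.
  - split; first by move=> x _; have [] := dF x.
    + by apply: cvg_at_right_filter; exact: cF.
    + by apply: cvg_at_left_filter; exact: cF.
  - by move=> x _; rewrite derive1E; have [] := dF x.
by apply: complex_ext; rewrite /tintegral /cintegral/= (H _ _ dR cR, H _ _ dI cI) !ReImE.
Qed.

Lemma is_derive_phase omega (tau : R) :
  is_derive tau 1 (fun r : R => Re (expi (omega * r))) (- (omega * Im (expi (omega * tau)))) /\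
  is_derive tau 1 (fun r : R => Im (expi (omega * r))) (omega * Re (expi (omega * tau))).
Proof.
have dm : is_derive tau 1 (fun r : R => omega * r) omega.
  have := @is_deriveZ R R R id omega tau 1 1 _; rewrite /GRing.scale/= mulr1; exact.
split.
  have := @is_derive1_comp R cos (fun r => omega * r) tau _ _ (is_derive_cos _) dm.
  by move/is_derive_eq; apply; rewrite /= mulNr mulrC.
have := @is_derive1_comp R sin (fun r => omega * r) tau _ _ (is_derive_sin _) dm.
by move/is_derive_eq; apply; rewrite /= mulrC.
Qed.

Local Opaque expi cintegral.

Lemma ReImi (z : R[i]) : (Re ('i%C * z) = - Im z) * (Im ('i%C * z) = Re z).
Proof. by rewrite ReM ImM/= !mul0r !mul1r sub0r add0r. Qed.

Lemma boxed_test_function psi : test_function psi -> boxed psi.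
Proof.
move=> tpsi; have [L L0 H] := test_function_bounded tpsi.
have [sR sI _] := tpsi; split; [exact: smooth_continuous sR|exact: smooth_continuous sI|].
by exists L => // t x /H[].
Qed.

(** The time derivative is the directional derivative along [(1, 0)], which gives
its joint continuity. *)
Lemma boxed_dtime psi : test_function psi -> boxed (dtime psi).
Proof.
move=> tpsi; have [L L0 H] := test_function_bounded tpsi.
have [sR sI _] := tpsi; split.
- rewrite (_ : (fun p => _) = 'D_(1, 0) (fun p : R * Rn => Re (psi p.1 p.2))).
    exact/smooth_continuous/smooth_derive.
  by apply/funext => -[t x]; rewrite -derive1_time.
- rewrite (_ : (fun p => _) = 'D_(1, 0) (fun p : R * Rn => Im (psi p.1 p.2))).
    exact/smooth_continuous/smooth_derive.
  by apply/funext => -[t x]; rewrite -derive1_time.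
exists L => // t x; apply: contraNT; rewrite -ltNge => xL.
have psi0 r : psi r x = 0.
  by apply/eqP; apply: contraTT xL => /H[_]; rewrite -leNgt.
apply/eqP; rewrite /dtime; under eq_fun do rewrite psi0.
under [X in (_ +i* derive1 X _)%C]eq_fun do rewrite psi0.
by rewrite derive1_cst.
Qed.

Lemma is_derive_dtime psi (tau : R) x : test_function psi ->
  is_derive tau 1 (fun r : R => Re (psi r x)) (Re (dtime psi tau x)) /\
  is_derive tau 1 (fun r : R => Im (psi r x)) (Im (dtime psi tau x)).
Proof.
move=> [sR sI _]; rewrite /dtime/= !derive1E; split; apply: derivableP.
  exact: smooth_derivable (smooth_time x sR).
exact: smooth_derivable (smooth_time x sI).
Qed.

Lemma continuous_phase omega :
  continuous (fun r : R => Re (expi (omega * r))) /\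
  continuous (fun r : R => Im (expi (omega * r))).
Proof.
split=> x; apply: differentiable_continuous; apply/derivable1_diffP.
  by have [[h _] _] := is_derive_phase omega x.
by have [_ [h _]] := is_derive_phase omega x.
Qed.

Lemma continuous_slice (f : R * Rn -> R) (x : Rn) : continuous f ->
  continuous (fun r : R => f (r, x)).
Proof.
move=> cf r; apply: (continuous_comp (f := fun r : R => (r, x))); last exact: cf.
by apply: (continuous_pair (f := id) (g := fun=> x)) => ?; [exact: cvg_id|exact: cvg_cst].
Qed.

Lemma cmeasurable_phase omega :
  cmeasurable (fun tau : measurableTypeR R => expi (omega * tau) : R[i]).
Proof. by apply: cmeasurable_expi; exact: measurable_funM. Qed.

Lemma tintegral_phase_parts psi omega t x : test_function psi -> 0 < t ->
  tintegral t (fun tau => expi (omega * tau) * dtime psi tau x) =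
  expi (omega * t) * psi t x - psi 0 x
  - rc omega * 'i%C * tintegral t (fun tau => expi (omega * tau) * psi tau x).
Proof.
move=> tpsi t0; have [cdR cdI _] := boxed_dtime tpsi.
have [cR cI _] := boxed_test_function tpsi; have [pR pI] := continuous_phase omega.
have caR := @continuous_slice _ x cR; have caI := @continuous_slice _ x cI.
have cbR := @continuous_slice _ x cdR; have cbI := @continuous_slice _ x cdI.
rewrite /= in caR caI cbR cbI.
have cM (f g : R -> R) : continuous f -> continuous g -> continuous (fun r => f r * g r).
  by move=> cf cg r; exact: cvgM (cf r) (cg r).
have cB (f g : R -> R) : continuous f -> continuous g -> continuous (fun r => f r - g r).
  by move=> cf cg r; exact: cvgB (cf r) (cg r).
have cD (f g : R -> R) : continuous f -> continuous g -> continuous (fun r => f r + g r).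
  by move=> cf cg r; exact: cvgD (cf r) (cg r).
pose e (tau : R) : R[i] := expi (omega * tau).
have c1 : continuous (fun tau => Re (e tau * dtime psi tau x)).
  rewrite (_ : (fun tau => _) = fun tau => Re (e tau) * Re (dtime psi tau x)
    - Im (e tau) * Im (dtime psi tau x)).
    by apply: cB; apply: cM.
  by apply/funext => tau; rewrite ReM.
have c2 : continuous (fun tau => Im (e tau * dtime psi tau x)).
  rewrite (_ : (fun tau => _) = fun tau => Re (e tau) * Im (dtime psi tau x)
    + Im (e tau) * Re (dtime psi tau x)).
    by apply: cD; apply: cM.
  by apply/funext => tau; rewrite ImM.
have c3 : continuous (fun tau => Re (e tau * psi tau x)).
  rewrite (_ : (fun tau => _) = fun tau => Re (e tau) * Re (psi tau x)
    - Im (e tau) * Im (psi tau x)).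
    by apply: cB; apply: cM.
  by apply/funext => tau; rewrite ReM.
have c4 : continuous (fun tau => Im (e tau * psi tau x)).
  rewrite (_ : (fun tau => _) = fun tau => Re (e tau) * Im (psi tau x)
    + Im (e tau) * Re (psi tau x)).
    by apply: cD; apply: cM.
  by apply/funext => tau; rewrite ImM.
have i1 := continuous_tintegrable t c1 c2; have i2 := continuous_tintegrable t c3 c4.
pose g tau := e tau * dtime psi tau x - - (rc omega * 'i%C) * (e tau * psi tau x).
have gE tau : (Re (g tau) = Re (e tau * dtime psi tau x) - omega * Im (e tau * psi tau x)) *
     (Im (g tau) = Im (e tau * dtime psi tau x) + omega * Re (e tau * psi tau x)).
  rewrite /g mulNr opprK -mulrA; split; rewrite (ReD, ImD); congr (_ + _).
    by rewrite ReM !ReImi/= mul0r subr0 mulrN.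
  by rewrite ImM !ReImi/= mul0r addr0.
have ftc : tintegral t g = e t * psi t x - e 0 * psi 0 x.
  apply: (tintegral_FTC (G := fun tau => e tau * psi tau x)) => //.
  - move=> tau; have [dR dI] := is_derive_dtime tau x tpsi.
    have [eR eI] := is_derive_phase omega tau.
    have := is_deriveB (is_deriveM eR dR) (is_deriveM eI dI).
    rewrite (_ : _ - _ = fun r => Re (e r * psi r x)); last first.
      by apply/funext => r; rewrite ReM.
    move/is_derive_eq; apply; rewrite gE ReM ImM /e /GRing.scale/=; ring.
  - move=> tau; have [dR dI] := is_derive_dtime tau x tpsi.
    have [eR eI] := is_derive_phase omega tau.
    have := is_deriveD (is_deriveM eR dI) (is_deriveM eI dR).
    rewrite (_ : _ + _ = fun r => Im (e r * psi r x)); last first.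
      by apply/funext => r; rewrite ImM.
    move/is_derive_eq; apply; rewrite gE ReM ImM /e /GRing.scale/=; ring.
  - rewrite (_ : (fun tau => _) = fun tau => Re (e tau * dtime psi tau x)
       - omega * Im (e tau * psi tau x)); last by apply/funext => tau; rewrite gE.
    by apply: cB => //; apply: cM => // r; exact: cvg_cst.
  - rewrite (_ : (fun tau => _) = fun tau => Im (e tau * dtime psi tau x)
       + omega * Re (e tau * psi tau x)); last by apply/funext => tau; rewrite gE.
    by apply: cD => //; apply: cM => // r; exact: cvg_cst.
have := tintegralB i1 (tintegrableZ (- (rc omega * 'i%C)) i2).
rewrite -/g in ftc *; rewrite ftc (tintegralZ _ i2) /e mulr0 expi0 mul1r => ->.
by ring.
Qed.

Lemma pairingZ phi (h : Rn -> R[i]) z : cintegrable mu (fun x => phi x * h x) ->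
  pairing (fun x => z * phi x) h = z * pairing phi h.
Proof.
by move=> ch; rewrite -cintegralZ//; apply: eq_cintegral => x; rewrite mulrA.
Qed.

(** The left side of the weak equation for the rotating wave: integration by parts
in time at each point, between two exchanges of integrals, cancels the boundary
terms and leaves the frequency. *)
Lemma wave_parts phi psi omega t : cL2 mu phi -> test_function psi -> 0 < t ->
  'i%C * (pairing (fun x => expi (omega * t) * phi x) (psi t) - pairing phi (psi 0)
     - tintegral t (fun tau => pairing (fun x => expi (omega * tau) * phi x) (dtime psi tau)))
  = - (rc omega) * tintegral t (fun tau => expi (omega * tau) * pairing phi (psi tau)).
Proof.
move=> phi2 tpsi t0; have b1 := boxed_test_function tpsi; have b2 := boxed_dtime tpsi.
have me := cmeasurable_phase omega.
have e1 tau : cabs (expi (omega * tau) : R[i]) <= 1 by rewrite cabs_expi.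
have [s1 j1 k1 l1] := pairing_swap t phi2 b1 me e1.
have [s2 j2 k2 l2] := pairing_swap t phi2 b2 me e1.
have it : cintegrable mu (fun x => phi x * psi t x).
  by apply: cintegrable_pairing => //; exact: ltW.
have i0 : cintegrable mu (fun x => phi x * psi 0 x) by exact: cintegrable_pairing.
rewrite (@eq_tintegral _ t _ (fun tau => expi (omega * tau) * pairing phi (dtime psi tau))); last first.
  by move=> tau /andP[tau0 _]; rewrite pairingZ//; exact: cintegrable_pairing.
rewrite s2 s1 pairingZ//.
pose T x := tintegral t (fun tau => expi (omega * tau) * psi tau x).
have -> : pairing phi (fun x => tintegral t (fun tau => expi (omega * tau) * dtime psi tau x)) =
   expi (omega * t) * pairing phi (psi t) - pairing phi (psi 0)
   - rc omega * 'i%C * pairing phi T.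
  have cA := cintegrableZ (expi (omega * t)) it.
  have cT := cintegrableZ (rc omega * 'i%C) j1.
  rewrite /pairing -(cintegralZ _ it) -(cintegralZ (rc omega * 'i%C) j1).
  rewrite -(cintegralB cA i0) -(cintegralB (cintegrableB cA i0) cT).
  by apply: eq_cintegral => x; rewrite tintegral_phase_parts// -/(T x); ring.
have ii : 'i%C * 'i%C = -1 :> R[i] by apply: complex_ext; rewrite !ReImE/=; ring.
transitivity (rc omega * ('i%C * 'i%C) * pairing phi T); first by ring.
by rewrite ii mulrN1.
Qed.

End time_derivative.

(** * The rotating wave solves the equation *)

Section fraclap_class.
Context {R : realType} {n : nat}.
Local Notation Rn := 'rV[R]_n.
Local Notation mu := (lebesgue_row R n).
Implicit Types (f g h phi : Rn -> R[i]) (a s : R) (c : R[i]).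

Lemma ae_eq_cintegral f g : cmeasurable f -> cmeasurable g ->
  {ae mu, forall x, f x = g x} -> cintegral mu setT f = cintegral mu setT g.
Proof.
move=> [mRf mIf] [mRg mIg] fg; apply: complex_ext; rewrite /cintegral/= /Rintegral;
    congr fine; apply: ae_eq_integral => //.
- exact/measurable_EFinP.
- exact/measurable_EFinP.
- by apply: filterS fg => x -> _.
- exact/measurable_EFinP.
- exact/measurable_EFinP.
- by apply: filterS fg => x -> _.
Qed.

Local Opaque expi cintegral.

Lemma cL2_0 : cL2 mu (fun=> 0).
Proof.
split; first exact: cmeasurable_cst.
by rewrite /sqint; under eq_integral do rewrite cabs0 expr0n; rewrite integral0.
Qed.

Lemma fraclap0 a f : ~ (exists h, is_fraclap a f h) -> fraclap a f = fun=> 0.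
Proof. by move=> nf; apply: xgetPN => h fh; apply: nf; exists h. Qed.

Lemma fraclap_cL2 a f : cL2 mu (fraclap a f).
Proof.
have [hf|nf] := pselect (exists h, is_fraclap a f h).
  by have [F [_ /is_fourierP[]]] := fraclapP hf.
by rewrite (fraclap0 nf); exact: cL2_0.
Qed.

Lemma is_fourierZ f F c : is_fourier f F ->
  is_fourier (fun x => c * f x) (fun xi => c * F xi).
Proof.
by move=> fF; apply: eq_is_fourier (is_fourier_lin (c - 1) fF fF) => x; ring.
Qed.

Lemma is_fraclapZ a f h c : is_fraclap a f h ->
  is_fraclap a (fun x => c * f x) (fun x => c * h x).
Proof.
move=> [F [fF hF]]; exists (fun xi => c * F xi); split; first exact: is_fourierZ.
by apply: eq_is_fourier (is_fourierZ c hF) => // xi; ring.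
Qed.

(** This also holds where the operator is undefined, since then both sides vanish;
test functions can be scaled without knowing that they belong to H^s. *)
Lemma fraclapZ a f c : c != 0 ->
  {ae mu, forall x, fraclap a (fun x => c * f x) x = c * fraclap a f x}.
Proof.
move=> c0; have [hf|nf] := pselect (exists h, is_fraclap a f h); last first.
  rewrite (fraclap0 nf) fraclap0; first by apply: aeW => x; rewrite mulr0.
  move=> [h /(is_fraclapZ c^-1)]; rewrite (_ : (fun x => _) = f) => [fh|].
    by apply: nf; eexists; exact: fh.
  by apply/funext => x; rewrite mulKf.
have [F [fF lF]] := fraclapP hf.
have hZ := is_fraclapZ c (fraclapP hf).
have h1 := fraclap_fourier (is_fourierZ c fF) (ex_intro _ _ hZ).
have h2 : is_fourier (fun x => c * fraclap a f x) (fun xi => rc (weight a xi) * (c * F xi)).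
  by apply: eq_is_fourier (is_fourierZ c lF) => // xi; rewrite /weight; ring.
have [m1 _] := fraclap_cL2 a (fun x => c * f x); have [m2 _] := fraclap_cL2 a f.
have := L2n0_ae (cmeasurableB m1 (cmeasurableM (cmeasurable_cst c) m2)) (is_fourier_inj h1 h2).
by apply: filterS => x /eqP; rewrite subr_eq0 => /eqP.
Qed.

Lemma pairing_ae f g h k : cmeasurable f -> cmeasurable g -> cmeasurable h ->
  cmeasurable k -> {ae mu, forall x, f x = g x} -> {ae mu, forall x, h x = k x} ->
  pairing f h = pairing g k.
Proof.
move=> mf mg mh mk fg hk; apply: ae_eq_cintegral; try exact: cmeasurableM.
by apply: filterS2 fg hk => x -> ->.
Qed.

Lemma pairing_fraclapZ a f g c d : c != 0 -> d != 0 ->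
  pairing (fraclap a (fun x => c * f x)) (fraclap a (fun x => d * g x)) =
  c * d * pairing (fraclap a f) (fraclap a g).
Proof.
move=> c0 d0; have f2 := fraclap_cL2 a f; have g2 := fraclap_cL2 a g.
have [mf _] := f2; have [mg _] := g2.
have [mcf _] := fraclap_cL2 a (fun x => c * f x).
have [mdg _] := fraclap_cL2 a (fun x => d * g x).
have mZ z h : cmeasurable h -> cmeasurable (fun x : Rn => z * h x).
  by move=> mh; apply: cmeasurableM mh; exact: cmeasurable_cst.
apply: (etrans (pairing_ae mcf (mZ c _ mf) mdg (mZ d _ mg) (fraclapZ a f c0) (fraclapZ a g d0))).
apply: (etrans _ (cintegralZ (c * d) (cintegrable_mulL2 f2 g2))).
by apply: eq_cintegral => x; exact: mulrACA.
Qed.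

(** The zero function is twice itself. *)
Lemma pairing_fraclap0 a f : pairing (fraclap a f) (fraclap a (fun=> 0)) = 0.
Proof.
have c2 : (2 : R[i]) != 0 by rewrite pnatr_eq0.
have := pairing_fraclapZ a f (fun=> 0) (oner_neq0 _) c2.
rewrite (_ : (fun x => 1 * f x) = f); last by apply/funext => x; rewrite mul1r.
rewrite (_ : (fun x : Rn => 2 * 0) = fun=> 0); last by apply/funext => x; rewrite mulr0.
move=> h; have : pairing (fraclap a f) (fraclap a (fun=> 0)) *+ 2 =
    pairing (fraclap a f) (fraclap a (fun=> 0)) by rewrite {2}h; ring.
by rewrite mulr2n => /(congr1 (fun z => z - pairing (fraclap a f) (fraclap a (fun=> 0)))); rewrite addrK subrr.
Qed.

(** The H^s norm is a norm on classes. *)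
Lemma Hs_ae_fraclap s f g : Hs s f -> Hs s g ->
  Hsnorm s (fun x => f x - g x) = 0%E ->
  {ae mu, forall x, f x = g x} /\
  {ae mu, forall x, fraclap (s / 2) f x = fraclap (s / 2) g x}.
Proof.
move=> Hf Hg; rewrite HsnormL2 => /eqP; rewrite padde_eq0 ?L2n_ge0// => /andP[/eqP l0 /eqP d0].
have [mf _] := Hs_cL2 Hf; have [mg _] := Hs_cL2 Hg.
split.
  have := L2n0_ae (cmeasurableB mf mg) d0.
  by apply: filterS => x /eqP; rewrite subr_eq0 => /eqP.
have [F fF] := Hs_fourier Hf; have [G gG] := Hs_fourier Hg.
have [_ _ _ hf] := Hf; have [_ _ _ hg] := Hg.
have [mlf _] := Hs_fraclap_cL2 Hf; have [mlg _] := Hs_fraclap_cL2 Hg.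
have h := L2n_fraclap_lin (-1) fF gG hf hg.
have subE (k l : Rn -> R[i]) : (fun x => k x + -1 * l x) = fun x => k x - l x.
  by apply/funext => x; rewrite mulN1r.
rewrite !subE l0 in h.
have := L2n0_ae (cmeasurableB mlf mlg) (esym h).
by apply: filterS => x /eqP; rewrite subr_eq0 => /eqP.
Qed.

Lemma HsZ s f c : Hs s f -> Hs s (fun x => c * f x).
Proof.
move=> Hf; have := Hs_lin (c - 1) Hf Hf; congr (Hs s _).
by apply/funext => x; ring.
Qed.

Lemma HsnormZ s f c : Hs s f -> Hsnorm s (fun x => c * f x) = ((cabs c)%:E * Hsnorm s f)%E.
Proof.
move=> Hf; have [F fF] := Hs_fourier Hf; have [_ _ _ hf] := Hf.
have [mf _] := Hs_cL2 Hf; have [mlf _] := Hs_fraclap_cL2 Hf.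
have h := L2n_fraclap_lin (c - 1) fF fF hf hf.
have ZE (k : Rn -> R[i]) : (fun x => k x + (c - 1) * k x) = fun x => c * k x.
  by apply/funext => x; ring.
rewrite !ZE (L2nZ _ c mlf) in h.
apply: (etrans (congr2 adde h (L2nZ mu c mf))).
exact: esym (ge0_muleDr _ (L2n_ge0 mu (fraclap (s / 2) f)) (L2n_ge0 mu f)).
Qed.

End fraclap_class.

Section rotating_wave.
Context {R : realType} {n : nat}.
Local Notation Rn := 'rV[R]_n.
Local Notation mu := (lebesgue_row R n).
Local Notation leb := (@lebesgue_measure R).
Variables (omega s sigma : R) (phi : Rn -> R[i]).
Hypotheses (ns : n%:R / 2 < s) (Hphi : Hs s phi).
Implicit Types (psi : R -> Rn -> R[i]) (t : R).

Local Opaque expi cintegral.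

Local Notation wave := (fun (t : R) (x : Rn) => expi (omega * t) * phi x).

(** The slices of test functions on space-time, rather than test functions in space,
are what the time-dependent equation involves. *)
Definition weak_standing_wave : Prop :=
  forall psi, test_function psi -> forall a,
    pairing (fraclap (s / 2) phi) (fraclap (s / 2) (psi a)) =
    rc (cabs (phi 0) `^ (2 * sigma)) * phi 0 * psi a 0 - rc omega * pairing phi (psi a).

Let kappa : R[i] := rc (cabs (phi 0) `^ (2 * sigma)) * phi 0.

Lemma expi_continuous (t : R) :
  cabs (expi (omega * r) - expi (omega * t) : R[i]) @[r --> t] --> 0.
Proof.
have [cR cI] := @continuous_phase R omega.
apply/cvgrPdist_le => e e0; have e2 : 0 < e / 2 by rewrite divr_gt0.
have /cvgrPdist_le/(_ _ e2) hR := cR t; have /cvgrPdist_le/(_ _ e2) hI := cI t.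
apply: filterS (filterI hR hI) => r [h1 h2].
rewrite sub0r normrN ger0_norm ?cabs_ge0// [leRHS]splitr.
apply: le_trans (cabs_le_ReIm _) _; rewrite ReD ImD ReN ImN.
by rewrite lerD// distrC.
Qed.

Lemma wave_Hs_continuous : Hs_continuous s wave.
Proof.
split=> [t _|t _]; first exact: HsZ.
pose N := Num.sqrt (dirichlet s phi) + Num.sqrt (mass phi).
have -> : (fun r => Hsnorm s (fun x => wave r x - wave t x)) =
    EFin \o (fun r => cabs (expi (omega * r) - expi (omega * t)) * N).
  apply/funext => r /=; rewrite EFinM -(HsnormE Hphi) -(HsnormZ _ Hphi).
  by congr Hsnorm; apply/funext => x; rewrite mulrBl.
have h : cabs (expi (omega * r) - expi (omega * t) : R[i]) * N @[r --> t] --> 0.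
  by rewrite -[X in _ --> X](mul0r N); apply: cvgMr_tmp; exact: expi_continuous.
apply: cvg_within_filter; apply: cvg_EFin; first by near=> r.
exact: h.
Unshelve. all: by end_near. Qed.

(** After the integration by parts in time the weak equation is the time integral of
the standing wave equation of the slices. *)
Lemma wave_global_solution : weak_standing_wave ->
  global_solution s sigma phi wave.
Proof.
move=> W; split; first exact: wave_Hs_continuous.
move=> psi tpsi t t0; have phi2 := Hs_cL2 Hphi.
have bpsi := boxed_test_function tpsi.
have e1 tau : cabs (expi (omega * tau) : R[i]) <= 1 by rewrite cabs_expi.
have [_ _ i1 _] := pairing_swap t phi2 bpsi (cmeasurable_phase omega) e1.
rewrite (wave_parts omega phi2 tpsi t0).
pose P tau := expi (omega * tau) * pairing phi (psi tau).
pose Q tau := expi (omega * tau) * (kappa * psi tau 0).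
have iQ : tintegrable t Q.
  have [_ _ _ j1] := pairing_swap t phi2 bpsi (cmeasurable_phase omega) e1.
  have := tintegrableZ kappa (j1 0); congr (tintegrable t _).
  by apply/funext => tau; rewrite /Q mulrCA.
rewrite (@eq_tintegral _ t (fun tau => pairing _ (fraclap _ (psi tau)))
   (fun tau => Q tau - rc omega * P tau)); last first.
  move=> tau _; have := pairing_fraclapZ (s / 2) phi (psi tau) (expi_neq0 (omega * tau)) (oner_neq0 _).
  rewrite (_ : (fun x => 1 * psi tau x) = psi tau); last by apply/funext => x; rewrite mul1r.
  by move=> ->; rewrite (W _ tpsi) -/kappa mulr1 /P /Q mulrBr [rc omega * (_ * _)]mulrCA.
rewrite (@eq_tintegral _ t (fun tau => _ * psi tau 0) Q); last first.
  by move=> tau _; rewrite /Q cabsM cabs_expi mul1r /kappa; ring.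
rewrite (tintegralB iQ (tintegrableZ _ i1)) (tintegralZ _ i1).
by rewrite addrC addKr mulNr.
Qed.

(** The end point 0 is excluded because continuous dependence says nothing there. *)
Lemma eq_tintegral_open (t : R) (f g : R -> R[i]) :
  (forall tau, 0 < tau <= t -> f tau = g tau) -> tintegrable t g ->
  tintegral t f = tintegral t g.
Proof.
Local Transparent cintegral.
have mi : measurable (`[0, t]%classic : set (measurableTypeR R)).
  exact: measurable_itv.
have H (u v : R -> R) : (forall tau, 0 < tau <= t -> u tau = v tau) ->
    leb.-integrable `[0, t]%classic (EFin \o v) ->
    \int[leb]_(tau in `[0, t]) u tau = \int[leb]_(tau in `[0, t]) v tau.
  move=> uv iv.
  have iv' : leb.-integrable `]0, t]%classic (EFin \o v).
    by apply: integrableS iv => //; apply: subset_itvr; rewrite bnd_simp.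
  rewrite -!Rintegral_itv_obnd_cbnd//; last first.
    apply: eq_integrable iv' => //= tau; rewrite inE/= in_itv/= => /uv ->//.
  by apply: eq_Rintegral => tau; rewrite inE/= in_itv/= => /uv.
move=> fg [iR iI]; rewrite /tintegral /cintegral.
congr (_ +i* _)%C; apply: H => [tau /fg -> //|].
  rewrite (integrable_mkcond _ mi); move: iR; congr (_.-integrable _ _).
  apply/funext => tau; rewrite patchE /time_window ReM/= mul0r subr0 indicE.
  by case: (_ \in _); rewrite ?mul1r ?mul0r.
rewrite (integrable_mkcond _ mi); move: iI; congr (_.-integrable _ _).
apply/funext => tau; rewrite patchE /time_window ImM/= mul0r addr0 indicE.
by case: (_ \in _); rewrite ?mul1r ?mul0r.
Qed.

End rotating_wave.

Section weak_equation.
Context {R : realType} {n : nat}.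
Local Notation Rn := 'rV[R]_n.
Local Notation mu := (lebesgue_row R n).
Local Notation leb := (@lebesgue_measure R).
Variables (omega s sigma : R) (phi : Rn -> R[i]).
Hypotheses (ns : n%:R / 2 < s) (Hphi : Hs s phi).
Implicit Types (psi : R -> Rn -> R[i]) (t : R).

Local Opaque expi cintegral.

Local Notation wave := (fun (t : R) (x : Rn) => expi (omega * t) * phi x).

(** On a short time interval the phase has not turned enough for the oscillating
integral to vanish. *)
Lemma short_time (chi : R -> R) T : continuous chi -> chi 0 != 0 -> 0 < T ->
  exists t, [/\ 0 < t, t < T, forall tau, 0 <= tau <= t -> chi tau != 0,
    tintegrable t (fun tau => expi (omega * tau) * rc (chi tau)) &
    tintegral t (fun tau => expi (omega * tau) * rc (chi tau)) != 0].
Proof.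
move=> cchi chi0 T0; have [cR cI] := @continuous_phase R omega.
(* The real part of the integrand, normalized to 1 at time 0. *)
pose y (tau : R) := Re (expi (omega * tau) : R[i]) * chi tau * (chi 0)^-1.
have cy : continuous y.
  move=> x; have cc : {for x, continuous (fun=> (chi 0)^-1 : R)} by exact: cvg_cst.
  by have := continuousM (continuousM (cR x) (cchi x)) cc; exact.
have y0 : y 0 = 1.
  by rewrite /y mulr0 expi0 mul1r divff.
have h2 : 0 < (2^-1 : R) by rewrite invr_gt0.
have /cvgrPdist_le/(_ _ h2) := cy 0.
move/nbhs_ballP => [d /= d0 H].
pose t := Num.min (d / 2) (T / 2).
have t0 : 0 < t by rewrite lt_min !divr_gt0.
have td : t < d by rewrite gt_min ltr_pdivrMr// ltr_pMr// ltr1n.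
have tT : t < T by rewrite gt_min orbC ltr_pdivrMr// ltr_pMr// ltr1n.
have yge tau : 0 <= tau <= t -> 2^-1 <= y tau.
  move=> /andP[tau0 taut]; have := H tau; rewrite y0 => hb.
  have : `|1 - y tau| <= 2^-1.
    by apply: hb; rewrite -ball_normE/= sub0r normrN ger0_norm// (le_lt_trans taut).
  by rewrite ler_distl => /andP[_]; lra.
have ii : tintegrable t (fun tau => expi (omega * tau) * rc (chi tau)).
  apply: continuous_tintegrable => x.
    rewrite (_ : (fun tau => _) = fun tau => Re (expi (omega * tau) : R[i]) * chi tau).
      exact: continuousM (cR x) (cchi x).
    by apply/funext => tau; rewrite ReM/= mulr0 subr0.
  rewrite (_ : (fun tau => _) = fun tau => Im (expi (omega * tau) : R[i]) * chi tau).
    exact: continuousM (cI x) (cchi x).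
  by apply/funext => tau; rewrite ImM/= mulr0 add0r.
exists t; split=> //.
  move=> tau /yge; apply: contraTneq => c0.
  by rewrite /y c0 mulr0 mul0r -ltNge.
pose J := tintegral t (fun tau => expi (omega * tau) * rc (chi tau)).
have iJ := tintegrableZ (rc (chi 0)^-1) ii.
have JE : Re (rc (chi 0)^-1 * J) = \int[leb]_tau (\1_`[0, t] tau * y tau).
  rewrite /J -(tintegralZ _ ii) tintegralE.
  Local Transparent cintegral.
  rewrite /cintegral/=; apply: eq_Rintegral => tau _.
  Local Opaque cintegral.
  rewrite /time_window /y; move: (expi _) => e; rewrite !ReM !ImM/=.
  by rewrite !(mul0r, mulr0, subr0, add0r, addr0); ring.
rewrite -/J; apply/eqP => J0; move: JE; rewrite J0 mulr0/=.
have [iR _] := iJ; have [iw _] := cintegrable_time_window t.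
have yE : (fun tau : measurableTypeR R => (Re (time_window t tau *
    (rc (chi 0)^-1 * (expi (omega * tau) * rc (chi tau)))))%:E) =
    (fun tau => (\1_`[0, t] tau * y tau)%:E).
  apply/funext => tau; congr (_%:E).
  rewrite /time_window /y; move: (expi _) => e; rewrite !ReM !ImM/=.
  by rewrite !(mul0r, mulr0, subr0, add0r, addr0); ring.
have mi : measurable (`[0%R, t]%classic : set (measurableTypeR R)).
  exact: measurable_itv.
have ml : leb (`[0%R, t]%classic : set (measurableTypeR R)) = t%:E.
  by rewrite lebesgue_measure_itv/= lte_fin t0 -EFinD subr0.
have : 2^-1 * t <= \int[leb]_tau (\1_`[0, t] tau * y tau).
  have -> : 2^-1 * t = \int[leb]_tau (2^-1 * Re (time_window t tau)).
    rewrite RintegralZl//; congr (_ * _).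
    rewrite /time_window/= /Rintegral integral_indic//.
    by rewrite setIT; exact: esym (congr1 fine ml).
  apply: le_Rintegral => //.
  - exact: (integrableZl measurableT 2^-1 iw).
  - by rewrite yE in iR.
  - move=> tau _; rewrite /time_window/= indicE.
    have [|_] := boolP (tau \in _); last by rewrite mulr0 mul0r.
    by rewrite inE/= in_itv/= => /yge; rewrite mulr1 mul1r.
move=> h1 h3; rewrite -h3 in h1.
by move: h1; rewrite leNgt mulr_gt0.
Qed.

(** A solution that agrees with the wave for a short time is tested against
[chi(t) psi(a, x)]: both sides are then multiples of one time integral, and the
factors give the equation for the slice [psi a].  The function [chi] is a time
section of [psi] itself at a point where the slice does not vanish. *)
Lemma local_wave_weak (v : R -> Rn -> R[i]) T : 0 < T ->
  global_solution s sigma phi v ->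
  (forall t, 0 < t -> t < T -> Hsnorm s (fun x => v t x - wave t x) = 0%E) ->
  weak_standing_wave omega s sigma phi.
Proof.
move=> T0 [[vHs _] sol] vw psi tpsi a.
have phi2 := Hs_cL2 Hphi; have [mphi _] := phi2.
have bpsi := boxed_test_function tpsi.
have [[x0 px0]|nx] := pselect (exists x0, psi a x0 != 0); last first.
  have psi0 : psi a = fun=> 0.
    apply/funext => x; apply/eqP; apply: contrapT => /negP px; apply: nx.
    by exists x.
  rewrite psi0 pairing_fraclap0 mulr0 (_ : pairing phi _ = 0) ?mulr0 ?subr0//.
  rewrite -[RHS](cintegral0 mu); apply: eq_cintegral => x; exact: mulr0.
have [part partE pp0] : exists2 part : R[i] -> R, part = Re \/ part = Im &
    part (psi a x0) != 0.
  have [r0|r0] := eqVneq (Re (psi a x0)) 0; last by exists Re => //; left.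
  exists Im; first by right.
  apply: contraNneq px0 => i0; apply/eqP; exact: complex_ext.
pose chi (t : R) := part (psi (a + t) x0).
have tPsi : test_function (separated chi psi a) by exact: test_function_separated.
have cchi : continuous chi.
  have [cR cI _] := bpsi; move=> r.
  apply: (continuous_comp (f := fun r : R => a + r) (g := fun r => part (psi r x0))).
    by apply: (cvgD (cvg_cst a) cvg_id).
  by case: partE => ->; [exact: (@continuous_slice _ _ _ x0 cR)|exact: (@continuous_slice _ _ _ x0 cI)].
have chi00 : chi 0 != 0 by rewrite /chi addr0.
have [t [t0 tT chin0 iJ J0]] := short_time cchi chi00 T0.
set J := tintegral t _ in J0.
have := sol _ tPsi _ t0.
have near_wave tau : 0 < tau <= t -> [/\ {ae mu, forall x, v tau x = wave tau x},
    {ae mu, forall x, fraclap (s / 2) (v tau) x = fraclap (s / 2) (wave tau) x} &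
    v tau 0 = wave tau 0].
  move=> /andP[tau0 taut]; have z := vw _ tau0 (le_lt_trans taut tT).
  have Hv := vHs _ (ltW tau0); have Hw := HsZ (expi (omega * tau)) Hphi.
  have [h1 h2] := Hs_ae_fraclap Hv Hw z; split=> //.
  have := value0_le ns (HsB Hv Hw); rewrite z mule0 lee_fin => c0.
  have c1 : cabs (v tau 0 - wave tau 0) = 0.
    by apply/eqP; rewrite eq_le c0 cabs_ge0.
  by have /eqP := cabs_eq0 c1; rewrite subr_eq0 => /eqP.
have mh k tau : boxed k -> cmeasurable (k tau) by exact: cmeasurable_slice.
have bPsi := boxed_test_function tPsi; have bdPsi := boxed_dtime tPsi.
have mw tau : cmeasurable (wave tau).
  by apply: cmeasurableM mphi; exact: cmeasurable_cst.
have mv tau : 0 < tau -> cmeasurable (v tau).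
  by move=> tau0; have [] := Hs_cL2 (vHs _ (ltW tau0)).
have pv tau h : 0 < tau <= t -> cmeasurable h -> pairing (v tau) h = pairing (wave tau) h.
  move=> tt mh'; have [h1 _ _] := near_wave _ tt; have /andP[tau0 _] := tt.
  by apply: pairing_ae => //; [exact: mv|exact: aeW].
have e1 tau : cabs (expi (omega * tau) : R[i]) <= 1 by rewrite cabs_expi.
have [_ _ i2 _] := pairing_swap t phi2 bdPsi (cmeasurable_phase omega) e1.
rewrite (pv t); [|by rewrite t0 lexx|exact: mh].
rewrite (@eq_tintegral_open _ t _ (fun tau => pairing (wave tau) (dtime (separated chi psi a) tau))); first last.
- apply: eq_tintegrable i2 => tau /andP[tau0 _].
  by rewrite pairingZ//; exact: cintegrable_pairing.
- by move=> tau tt; apply: pv => //; exact: mh.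
rewrite (wave_parts omega phi2 tPsi t0).
pose m := pairing phi (psi a).
have mE tau : 0 <= tau <= t ->
    expi (omega * tau) * pairing phi (separated chi psi a tau) =
    m * (expi (omega * tau) * rc (chi tau)).
  move=> tt; have c0 : rc (chi tau) != 0 :> R[i].
    by apply: contraNneq (chin0 _ tt) => /(congr1 (@complex.Re R))/= ->.
  rewrite mulrCA; congr (_ * _); rewrite mulrC /m /pairing -cintegralZ.
    by apply: eq_cintegral => x; rewrite /separated mulrCA.
  have /andP[tau0 _] := tt.
  have := cintegrableZ (rc (chi tau))^-1 (cintegrable_pairing phi2 bPsi tau0).
  congr (cintegrable _ _); apply/funext => x; rewrite /separated.
  by rewrite mulrCA mulKf.
rewrite (eq_tintegral mE) (tintegralZ _ iJ) -/J.
pose P := pairing (fraclap (s / 2) phi) (fraclap (s / 2) (psi a)).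
rewrite (@eq_tintegral_open _ t (fun tau => pairing (fraclap _ (v tau)) _)
  (fun tau => P * (expi (omega * tau) * rc (chi tau)))); last 2 first.
- move=> tau tt; have [_ h2 _] := near_wave _ tt; have /andP[tau0 taut] := tt.
  have [ml1 _] := fraclap_cL2 (s / 2) (v tau).
  have [ml2 _] := fraclap_cL2 (s / 2) (wave tau).
  have [ml3 _] := fraclap_cL2 (s / 2) (separated chi psi a tau).
  rewrite (pairing_ae ml1 ml2 ml3 ml3 h2 (aeW _ (fun=> erefl))).
  have c0 : rc (chi tau) != 0 :> R[i].
    have := chin0 tau; rewrite (ltW tau0) taut => /(_ isT).
    by apply: contraNneq => /(congr1 (@complex.Re R))/= ->.
  rewrite [P * _]mulrC.
  exact: (pairing_fraclapZ (s / 2) phi (psi a) (expi_neq0 (omega * tau)) c0).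
- exact: tintegrableZ.
rewrite (tintegralZ _ iJ) -/J.
set kappa := rc (cabs (phi 0) `^ (2 * sigma)) * phi 0.
rewrite (@eq_tintegral_open _ t (fun tau => rc _ * v tau 0 * _)
  (fun tau => kappa * psi a 0 * (expi (omega * tau) * rc (chi tau)))); last 2 first.
- move=> tau tt; have [_ _ ->] := near_wave _ tt.
  by rewrite cabsM cabs_expi mul1r /kappa /separated; ring.
- exact: tintegrableZ.
rewrite (tintegralZ _ iJ) -/J => E.
apply: (mulIf J0); rewrite -/P -/m mulrBl.
have -> : P * J = (P * J - kappa * psi a 0 * J) + kappa * psi a 0 * J by rewrite subrK.
by rewrite -E; ring.
Qed.

End weak_equation.

Theorem theorem3 (R : realType) (n : nat) (omega s sigma : R)
    (phi : 'rV[R]_n -> R[i])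
    (u : ('rV[R]_n -> R[i]) -> R -> 'rV[R]_n -> R[i]) :
  (1 <= n)%N -> 0 < omega -> n%:R / 2 < s ->
  0 < sigma -> sigma < 2 * s / n%:R - 1 ->
  Hs s phi -> is_fourier phi (standing_wave_hat s omega sigma) ->
  (exists2 delta0 : R, 0 < delta0 &
    forall g, Hs s g -> (Hsnorm s (fun x => g x - phi x)%R < delta0%:E)%E ->
      global_solution s sigma g (u g) /\
      forall t, 0 < t ->
        mass (u g t) = mass g /\ energy s sigma (u g t) = energy s sigma g) ->
  (exists2 T0 : R, 0 < T0 &
    forall eps : R, 0 < eps -> exists2 delta : R, 0 < delta &
      forall g, Hs s g -> (Hsnorm s (fun x => g x - phi x)%R < delta%:E)%E ->
        (ereal_sup
           [set Hsnorm s (fun x => u g t x - expi (omega * t) * phi x)%R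
              | t in [set t : R | (0 < t < T0)%R]] < eps%:E)%E) ->
  global_solution s sigma phi (fun t x => expi (omega * t) * phi x) /\
  forall eps : R, 0 < eps -> exists2 delta : R, 0 < delta &
    forall g, Hs s g -> (Hsnorm s (fun x => g x - phi x)%R < delta%:E)%E ->
      [/\ global_solution s sigma g (u g),
          forall t, 0 < t -> Hs s (u g t)
        & (ereal_sup
             [set ereal_inf
                [set Hsnorm s
                   (fun x => u g t x - expi (- (omega * t + theta)) * phi x)%R
                   | theta in [set: R]]
                | t in [set t : R | (0 < t)%R]] < eps%:E)%E].

Proof.
move=> n1 o0 ns sigma0 sigma1 Hphi phiF sol dep; split; last first.
  exact: conserved_orbital_stability n1 o0 ns sigma0 sigma1 Hphi phiF u sol.
have phi0 : Hsnorm s (fun x => phi x - phi x)%R = 0%E.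
  rewrite (_ : (fun x => _) = fun x => 0 * phi x).
    by rewrite (HsnormZ _ Hphi) cabs0 mul0e.
  by apply/funext => x; rewrite subrr mul0r.
have [d0 d00 {}sol] := sol.
have [|gs _] := sol _ Hphi; first by rewrite phi0 lte_fin.
have [T T0 {}dep] := dep.
apply: (wave_global_solution Hphi); apply: (local_wave_weak ns Hphi T0 gs).
move=> t t0 tT; apply/eqP; rewrite eq_le Hsnorm_ge0 andbT.
apply/lee_addgt0Pr => e e0; rewrite add0e.
have [d d0' {}dep] := dep _ e0.
apply: le_trans (ltW (dep _ Hphi _)); last by rewrite phi0 lte_fin.
by apply: ereal_sup_ubound; exists t => //=; rewrite t0.
Qed.
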